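(* Let $m\in\{0,1,2,\ldots\}$, let $X$ be a nonnegative random variable with distribution function $F$ and $\mathbf{E}X^m<\infty$, let $\overline F=1-F$, $r>1$, let $\ell$ be slowly varying at infinity, and let $\alpha=m+\beta$ with $\beta\in[0,1]$. With $f_m$ and $g_m$ as defined in the context, the following are equivalent: (1) $f_m(s)\sim s^\alpha\,\ell(1/s)\,\tilde q_m(s)$ as $s\downarrow0$, for some $\tilde q_m\in\mathcal{P}_r$; (2) $g_m(s)\sim s^\beta\,\ell(1/s)\,q_m(s)$ as $s\downarrow0$, for some $q_m\in\mathcal{P}_r$; (3) for some $p\in\mathcal{P}_r$, $$\begin{cases}\displaystyle\lim_{n\to\infty}\ell(r^n)^{-1}\int_{r^nz}^\infty y^m\,\mathrm{d}F(y)=p(z)\ \text{ for each } z\in C_p, & \text{if }\beta=0,\\[2mm] \displaystyle\lim_{n\to\infty}\frac{(r^nz)^\alpha}{\ell(r^nz)}\,\overline F(r^nz)=p(z)\ \text{ for each } z\in C_p, & \text{if }\beta\in(0,1),\\[2mm] \displaystyle\lim_{n\to\infty}\ell(r^n)^{-1}\int_0^{r^nz}y^{m+1}\,\mathrm{d}F(y)=p(z)\ \text{ for each } z\in C_p, & \text{if }\beta=1.\end{cases}$$ If $\beta>0$, then (1)--(3) are further equivalent to (4) $(-1)^{m+1}\widehat F^{(m+1)}(s)\sim s^{\beta-1}\,\ell(1/s)\,q_{m+1}(s)$ as $s\downarrow0$, for some $q_{m+1}\in\mathcal{P}_r$, and $q_{m+1}=\mathrm{B}_\beta^{-1}q_m$.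 Moreover, the relations between the appearing functions are the following: - for $\beta\in[0,1]$: $q_m=\mathrm{B}_{\alpha-(m-1)}^{-1}\mathrm{B}_{\alpha-(m-2)}^{-1}\cdots\mathrm{B}_\alpha^{-1}\tilde q_m$ (with $q_0=\tilde q_0$ when $m=0$); - for $\beta\in(0,1)$, setting $p_{0,m}=\mathrm{B}_{1-\beta}^{-1}\mathrm{A}_{1-\beta}^{-1}q_m$, one has $p=p_{0,m}-m\,\mathrm{B}_{-m-\beta}\,p_{0,m}$ and $p_{0,m}=p+m\,\mathrm{B}_{-\beta}\,p$; - if $\beta\in\{0,1\}$, then necessarily $p(x)\equiv p>0$ and $q_m(s)\equiv q_m>0$ are constant, and $p=q_m$.
   Context: A function $\ell:(0,\infty)\to(0,\infty)$ is slowly varying at infinity if it is measurable and $\ell(\lambda x)/\ell(x)\to1$ as $x\to\infty$ for every $\lambda>0$. $\widehat F(s)=\int_0^\infty e^{-sx}\,\mathrm{d}F(x)$ is the Laplace transform of $X$, and $\mu_k=\mathbf{E}X^k$. For $s>0$, $$f_m(s)=(-1)^{m+1}\Big[\widehat F(s)-\sum_{k=0}^m\mu_k\frac{(-s)^k}{k!}\Big],\qquad g_m(s)=\frac{\mathrm{d}^m}{\mathrm{d}s^m}f_m(s)=\mu_m-(-1)^m\widehat F^{(m)}(s).$$ For $r>1$, $\mathcal{P}_r$ is the set of functions $p:(0,\infty)\to(0,\infty)$ that are bounded, right-continuous, satisfy $\inf_{x\in[1,r]}p(x)>0$, and $p(xr)=p(x)$ for all $x>0$. $C_p$ is the set of continuity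 points of $p$. For $\rho\ge0$, $\mathcal{P}_{r,\rho}$ is the set of $p\in\mathcal{P}_r$ such that $x^\rho p(x)$ is nondecreasing, and $\mathcal{Q}_{r,\rho}$ is the set of functions $q:(0,\infty)\to(0,\infty)$ such that $s^{-\rho}q(s)$ is completely monotone and $q(sr)=q(s)$ for all $s>0$. For $\rho>0$, $\mathrm{A}_\rho:\mathcal{P}_{r,\rho}\to\mathcal{Q}_{r,\rho}$ is the operator $\mathrm{A}_\rho p(s)=s^\rho\int_0^\infty e^{-sx}\,\mathrm{d}(p(x)x^\rho)$; it is a bijection, with inverse $\mathrm{A}_\rho^{-1}$. For $p\in\mathcal{P}_r$, $\mathrm{B}_\rho p(x)=x^{-\rho}\int_0^xy^{\rho-1}p(y)\,\mathrm{d}y$ if $\rho>0$, and $\mathrm{B}_\rho p(x)=x^{-\rho}\int_x^\infty y^{\rho-1}p(y)\,\mathrm{d}y$ if $\rho<0$. The operator $\mathrm{B}_\rho$ is injective on $\mathcal{P}_r$, and $\mathrm{B}_\rho^{-1}q$ denotes the unique element of $\mathcal{P}_r$ mapped to $q$ by $\mathrm{B}_\rho$ (for $\rho>0$, $\mathrm{B}_\rho^{-1}q(x)=x^{1-\rho}\frac{\mathrm{d}}{\mathrm{d}x}[x^\rho q(x)]$ wherever the derivative exists). Assertions involving $\mathrm{A}_\rho^{-1}$ or $\mathrm{B}_\rho^{-1}$ include that the argument lies in the range of the corresponding operator. $f\sim g$ means $f/g\to1$. *)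

(* Defs.v *)
From HB Require Import structures.
From mathcomp Require Import all_boot all_order all_algebra.
From mathcomp Require Import all_classical all_reals all_analysis.

Set Implicit Arguments.
Unset Strict Implicit.
Unset Printing Implicit Defensive.

Import Order.TTheory GRing.Theory Num.Theory.
Import numFieldNormedType.Exports.

Local Open Scope classical_set_scope.
Local Open Scope ring_scope.

(* A function on (0,oo) is a function R -> R of
   which only the values at positive arguments matter: every condition below,
   including equality of two such functions, is restricted to x > 0. *)

Section LogPeriodic.
Context {R : realType}.
Implicit Types (r rho : R) (f g p q ell : R -> R).

Definition eq_pos f g := forall x : R, 0 < x -> f x = g x.

Definition asymp0 f g := f s / g s @[s --> 0^'+] --> (1 : R).

Definition slowly_varying ell :=
  [/\ forall x : R, 0 < x -> 0 < ell x,
      measurable_fun (`]0, +oo[ : set R) ell &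
      forall (lam : R), 0 < lam -> ell (lam * x) / ell x @[x --> +oo] --> (1 : R)].

(* the class P_r *)
Definition logper r p :=
  [/\ forall x : R, 0 < x -> 0 < p x,
      exists M, forall x : R, 0 < x -> p x <= M,
      forall x : R, 0 < x -> p @ x^'+ --> p x,
      0 < inf (p @` `[1, r]) &
      forall x : R, 0 < x -> p (x * r) = p x].

(* z \in C_p *)
Definition continuity_point p z := 0 < z /\ {for z, continuous p}.

(* the class P_{r,rho} *)
Definition logper_mono r rho p :=
  logper r p /\
  forall x y : R, 0 < x -> x <= y -> x `^ rho * p x <= y `^ rho * p y.

Definition completely_monotone f := forall n (s : R), 0 < s ->
  derivable (derive1n n f) s 1 /\ 0 <= (-1) ^+ n * derive1n n f s.

(* the class Q_{r,rho} *)
Definition logper_cm r rho q :=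
  [/\ forall s : R, 0 < s -> 0 < q s,
      completely_monotone (fun s => s `^ (- rho) * q s) &
      forall s : R, 0 < s -> q (s * r) = q s].

Section Stieltjes.
Variables (G : R -> R) (G_cumul : nondecreasing G /\ right_continuous G).

Definition cumul_of of nondecreasing G /\ right_continuous G := G.

HB.instance Definition _ := isCumulative.Build R _ R (cumul_of G_cumul)
  (proj1 G_cumul) (proj2 G_cumul).

Definition cumulative_of : cumulative R R := cumul_of G_cumul.
End Stieltjes.

(* dG, with the junk value 0 if G is not nondecreasing and right-continuous. *)
Definition stieltjes G : {measure set (measurableTypeR R) -> \bar R} :=
  match pselect (nondecreasing G /\ right_continuous G) with
  | left GP => lebesgue_stieltjes_measure (cumulative_of GP)
  | right _ => mzero
  end.

(* x^rho p(x) on (0,oo), extended by 0; for rho > 0 and p bounded there is no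
   jump at 0, and powmul_cumulative excludes the degenerate case of stieltjes. *)
Definition powmul rho p x := if 0 < x then x `^ rho * p x else 0.

Lemma powmul_cumulative r rho p : 0 < rho -> logper_mono r rho p ->
  nondecreasing (powmul rho p) /\ right_continuous (powmul rho p).
Proof.
move=> rho0 [[p0 [M pM] prc _ _] pnd]; split.
  move=> x y xy; rewrite /powmul; case: (ltP 0 x) => x0.
    by rewrite (lt_le_trans x0 xy) pnd.
  by case: ifPn => // y0; rewrite mulr_ge0 ?powR_ge0// ltW ?p0.
move=> x; case: (ltgtP 0 x) => [x0|x0|<-].
- have -> : powmul rho p x = x `^ rho * p x by rewrite /powmul x0.
  apply: (@cvg_trans _ ((y `^ rho * p y) @[y --> x^'+])).
    apply: near_eq_cvg; near=> y; rewrite /powmul ifT//.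
    by rewrite (lt_trans x0)//; near: y; exact: nbhs_right_gt.
  apply: cvgM; last exact: prc.
  have : differentiable (fun y : R => y `^ rho) x.
    by apply/derivable1_diffP; have [] := is_derive1_powR rho x0.
  by move/differentiable_continuous => /cvg_at_right_filter.
- have -> : powmul rho p x = 0 by rewrite /powmul ltNge ltW.
  apply: cvg_near_cst; near=> y; rewrite /powmul ltNge.
  by rewrite ltW//; near: y; exact: nbhs_right_lt.
- rewrite {2}/powmul ltxx.
  apply: (@squeeze_cvgr _ _ _ _ (fun=> 0) (fun y => y `^ rho * M)).
  + near=> y; have y0 : 0 < y by near: y; exact: nbhs_right_gt.
    rewrite /powmul y0 mulr_ge0 ?powR_ge0 ?(ltW (p0 _ _))//=.
    by rewrite ler_wpM2l ?powR_ge0 ?pM.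
  + exact: cvg_cst.
  + rewrite -[X in _ --> X](mul0r M); apply: cvgM; last exact: cvg_cst.
    exact: powR_cvg0.
Unshelve. all: by end_near.
Qed.

Definition opA rho p s : R :=
  s `^ rho *
  \int[stieltjes (powmul rho p)]_(x in `[0, +oo[) expR (- (s * x)).

(* Used only for rho != 0. *)
Definition opB rho p x : R :=
  x `^ (- rho) *
  (if 0 < rho
   then \int[@lebesgue_measure R]_(y in `]0, x]) (y `^ (rho - 1) * p y)
   else \int[@lebesgue_measure R]_(y in `]x, +oo[) (y `^ (rho - 1) * p y)).

(* p = A_rho^-1 q and p = B_rho^-1 q, as graphs of the inverse operators: they
   hold only if q is in the range of the operator. *)
Definition is_invA r rho q p :=
  [/\ logper_cm r rho q, logper_mono r rho p & eq_pos (opA rho p) q].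

Definition is_invB r rho q p := logper r p /\ eq_pos (opB rho p) q.

(* p = B_{rho-k+1}^-1 ... B_{rho-1}^-1 B_rho^-1 q *)
Fixpoint is_invB_iter r rho k q p : Prop :=
  if k is k'.+1 then
    exists2 h, is_invB r rho q h & is_invB_iter r (rho - 1) k' h p
  else eq_pos p q.

End LogPeriodic.

Section Transforms.
Context {d : measure_display} {T : measurableType d} {R : realType}.
Context {P : probability T R}.
Implicit Types (X : {RV P >-> R}) (m : nat) (r alpha beta : R) (ell : R -> R).

Definition distr_fun X (x : R) : R := fine (cdf X x).

(* dF is the law of X. *)
Definition laplace X (s : R) : R :=
  \int[distribution P X]_(x in `[0, +oo[) expR (- (s * x)).

Definition moment X k : R := fine 'E_P[fun t => (X t ^+ k)%R].

Definition f_ X m (s : R) : R :=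
  (-1) ^+ m.+1 *
  (laplace X s - \sum_(k < m.+1) moment X k * ((- s) ^+ k / k`!%:R)).

(* The derivatives are used at s > 0 only, where laplace X is smooth. *)
Definition g_ X m : R -> R := derive1n m (f_ X m).

Definition f_asymp X m r alpha ell (q : R -> R) :=
  logper r q /\
  asymp0 (f_ X m) (fun s => s `^ alpha * ell s^-1 * q s).

Definition g_asymp X m r beta ell (q : R -> R) :=
  logper r q /\
  asymp0 (g_ X m) (fun s => s `^ beta * ell s^-1 * q s).

Definition tail_limit X m r alpha beta ell (p : R -> R) :=
  logper r p /\
  forall z : R, continuity_point p z ->
  [/\ beta = 0 ->
        (ell (r ^+ n))^-1 *
          \int[distribution P X]_(y in `](r ^+ n * z), +oo[) y ^+ m
        @[n --> \oo] --> p z,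
      0 < beta < 1 ->
        (r ^+ n * z) `^ alpha / ell (r ^+ n * z) *
          (1 - distr_fun X (r ^+ n * z))
        @[n --> \oo] --> p z &
      beta = 1 ->
        (ell (r ^+ n))^-1 *
          \int[distribution P X]_(y in `[0, (r ^+ n * z)]) y ^+ m.+1
        @[n --> \oo] --> p z].

Definition laplace_deriv_asymp X m r beta ell (q : R -> R) :=
  logper r q /\
  asymp0 (fun s => (-1) ^+ m.+1 * derive1n m.+1 (laplace X) s)
         (fun s => s `^ (beta - 1) * ell s^-1 * q s).

End Transforms.

(* Main.v *)
(* Write c_n(a) = (r^n)^(-a) ell(r^n).  Since ell is slowly varying, locally
   uniformly so, an asymptotic relation H(s) ~ s^a ell(1/s) q(s) with a
   log-periodic q is the same as locally uniform convergence of
   H(s r^(-n)) / c_n(a) to s^a q(s).  All the functions in the statement are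
   members of one family rem k s = E[X^(m+1-k) psi_k(s X)] in which
   d/ds rem (k+1) = rem k: f_m = rem (m+1), g_m = rem 1, and rem 0 is, up to
   sign, the (m+1)-st derivative of the Laplace transform.  Passing from rem (k+1) to rem k is a
   monotone density argument, where s^2 |psi_k''| <= C psi_k makes the scaled
   derivatives equi-Lipschitz; the converse is integration, through the
   Stolz-Cesaro theorem.
   From rem 1 (or rem 0 if beta = 1) to the tails one approximates, as Karamata
   does, indicators by polynomials in exp(-x) (Weierstrass); a monotone function
   is then recovered at its continuity points.  Conversely, rem 1 is an integral
   of a tail of X against the kernel d/dt [t^j (1 - exp(-s t))], and a discrete
   Potter bound allows dominated convergence.  The relations between the
   limit functions are the limits of the identities that Tonelli's theorem gives
   between E[X^m; X > x], P(X > x) and their integrals. *)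
Require Import Defs.
From mathcomp Require Import all_boot all_order all_algebra.
From mathcomp Require Import all_classical all_reals all_analysis.
From mathcomp Require Import measurable_realfun zify ring lra.

Set Implicit Arguments.
Unset Strict Implicit.
Unset Printing Implicit Defensive.

Import Order.TTheory GRing.Theory Num.Theory.
Import numFieldNormedType.Exports.

Local Open Scope classical_set_scope.
Local Open Scope ring_scope.

(** * Bernstein polynomials *)

(** Limits are taken along [r ^+ n] only, and each one must be shown to exist, to be strictly
    positive (the log-periodic class demands it) and to be attained uniformly over a period.
    Equi-Lipschitz bounds settle the first and the last point: derivatives are trapped by difference
    quotients, and pointwise convergence becomes locally uniform. Positivity comes from
    monotonicity: a zero would spread over a whole period or over the whole half-line. The test
    functions of the Weierstrass step may carry a factor [y^(-j)], so the asymptotics of [rem 1]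
    yield all the tails E[X^(m-j); X > x] at once; [p] and [p0] come from [j = m] and [j = 0], which
    is where their relations originate. Against a tail limit of order t^(-j-beta), the kernel of
    [rem 1] behaves like t^j at 0: at [beta = 1] the product is t^(-1), not integrable, hence the
    detour through [rem 0]. For [j > 0] the kernel is of order t^(j-1) at infinity, which excludes
    [beta = 0]; there [j = 0] has an exponentially decaying kernel. Preimages under A and B are
    exhibited: the preimage of [q] under A is an average of the limit of [tail 0]. *)

Section Bernstein.
Context {R : realType}.
Implicit Types (f g : nat -> R) (x : R).

(** The value at [x] is the expectation of [f (S_n)] for [S_n] binomial with parameters [n] and [x],
    and the recursion conditions on one trial. [f] is indexed by the number of successes; the
    rescaling by [n] is left to [weierstrass]. *)
Fixpoint bernstein n f : {poly R} :=
  if n is n'.+1 then 'X * bernstein n' (f \o succn) + (1 - 'X) * bernstein n' f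
  else (f 0%N)%:P.

Lemma bernsteinS n f x : (bernstein n.+1 f).[x] =
  x * (bernstein n (f \o succn)).[x] + (1 - x) * (bernstein n f).[x].
Proof. by rewrite /= !hornerE. Qed.

Lemma bernstein_le n f g x : 0 <= x <= 1 ->
  (forall k, (k <= n)%N -> f k <= g k) ->
  (bernstein n f).[x] <= (bernstein n g).[x].
Proof.
move=> /andP[x0 x1]; elim: n f g => [|n IH] f g fg; first by rewrite !hornerE fg.
rewrite !bernsteinS lerD// ler_wpM2l ?subr_ge0//; apply: IH => k kn /=; apply: fg => //.
exact: leqW.
Qed.

Lemma bernsteinB_cst n f c x :
  (bernstein n (fun k => f k - c)).[x] = (bernstein n f).[x] - c.
Proof.
elim: n f => [|n IH] f; first by rewrite !hornerE.
rewrite !bernsteinS IH (IH (f \o succn)); ring.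
Qed.

Lemma bernsteinN n f x :
  (bernstein n (fun k => - f k)).[x] = - (bernstein n f).[x].
Proof.
elim: n f => [|n IH] f; first by rewrite !hornerE.
rewrite !bernsteinS IH (IH (f \o succn)); ring.
Qed.

(** Variance plus squared bias of the binomial law. The centre [c] has to vary in the induction,
    since [succn] moves it to [c - 1]. *)
Lemma bernstein_quad n (a b c : R) x :
  (bernstein n (fun k => a + b * (k%:R - c) ^+ 2)).[x] =
  a + b * (n%:R * x * (1 - x) + (n%:R * x - c) ^+ 2).
Proof.
elim: n c => [|n IH] c; first by rewrite /= !hornerE; ring.
rewrite bernsteinS IH.
rewrite (_ : _ \o _ = fun k => a + b * (k%:R - (c - 1)) ^+ 2); last first.
  by apply/funext => k /=; rewrite -natr1; ring.
by rewrite IH -natr1; ring.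
Qed.

Lemma unif_cont01 (h : R -> R) : continuous h -> forall e : R, 0 < e ->
  exists2 d : R, 0 < d & forall x y, 0 <= x <= 1 -> `|x - y| < d -> `|h x - h y| < e.
Proof.
move=> ch e e0.
have : compact (`[0, 1] : set R) by exact: segment_compact.
move/compact_near_coveringP/(_ R (0^'+)
  (fun d x => forall y, `|x - y| < d -> `|h x - h y| < e)) => [].
- move=> x _.
  have /cvgrPdist_lt/(_ (e / 2)) := ch x.
  rewrite divr_gt0// => /(_ isT)[d /= d0 xd].
  exists (ball x (d / 2), [set t | t < d / 2]).
    split; first by apply: nbhsx_ballx; rewrite divr_gt0.
    exact: nbhs_right_lt (divr_gt0 d0 _).
  move=> [x' t] /= [xx' td] y x'y.
  have {}xx' : `|x - x'| < d / 2 := xx'.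
  have xy : `|x - y| < d.
    rewrite (_ : x - y = (x - x') + (x' - y)); last by ring.
    by rewrite (le_lt_trans (ler_normD _ _))// [ltRHS]splitr ltrD// (lt_trans x'y).
  have := xd _ xy; have := xd x'; rewrite /ball_ /= => /(_ _) H1 H2.
  have {}H1 : `|h x - h x'| < e / 2 by apply: H1; rewrite (lt_trans xx')// gtr_pMr// invf_lt1// ltr1n.
  rewrite (_ : h x' - h y = - (h x - h x') + (h x - h y)); last by ring.
  by rewrite (le_lt_trans (ler_normD _ _))// normrN [ltRHS]splitr ltrD.
- move=> d /= d0 H.
  exists (d / 2); first by rewrite divr_gt0.
  move=> x y x01; apply: (H (d / 2)) => //=.
  + by rewrite sub0r normrN gtr0_norm ?divr_gt0// gtr_pMr// invf_lt1// ltr1n.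
  + by rewrite divr_gt0.
Qed.

Lemma weierstrass (h : R -> R) : continuous h -> forall e : R, 0 < e ->
  exists p : {poly R}, forall x, 0 <= x <= 1 -> `|h x - p.[x]| <= e.
Proof.
move=> ch e e0.
have e20 : 0 < e / 2 by rewrite divr_gt0.
have [d d0 hd] := unif_cont01 ch e20.
have [M [M0 hM]] : exists M : R, 0 < M /\ forall x, 0 <= x <= 1 -> `|h x| <= M.
  have : compact (h @` `[0, 1]).
    by apply: continuous_compact; [exact: continuous_subspaceT|exact: segment_compact].
  move/compact_bounded => [M [_ HM]]; exists (`|M| + 1); split.
    by rewrite ltr_wpDl.
  move=> x x01; apply: HM; first by rewrite (le_lt_trans (ler_norm _))// ltrDl.
  by exists x => //=; rewrite in_itv.
(* Chebyshev's argument: with this [K] the bound [|h y - h x| <= e / 2 + K (y - x)^2] holds on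
   [[0, 1]] whether or not [y] is within [d] of [x], and the variance [x (1 - x) / n] turns the
   second term into at most [K / n]. *)
pose K := 2 * M / d ^+ 2.
have K0 : 0 < K by rewrite divr_gt0 ?mulr_gt0 ?exprn_gt0.
have [n n0 nK] : exists2 n, (0 < n)%N & K / n%:R <= e / 2.
  have [n Hn] : exists n, K / (e / 2) < n%:R.
    by exists (Num.bound (K / (e / 2))); rewrite archi_boundP// divr_ge0// ltW.
  have n0 : (0 < n)%N.
    by rewrite -(@ltr0n R) (lt_trans _ Hn)// divr_gt0.
  exists n => //; rewrite ler_pdivrMr ?ltr0n// mulrC -ler_pdivrMr//.
  exact: ltW.
have nN0 : n%:R != 0 :> R by rewrite pnatr_eq0 -lt0n.
exists (bernstein n (fun k => h (k%:R / n%:R))) => x x01.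
have Kx k : (k <= n)%N -> `|h (k%:R / n%:R) - h x| <= e / 2 + K / n%:R ^+ 2 * (k%:R - n%:R * x) ^+ 2.
  move=> kn.
  have kn01 : 0 <= (k%:R / n%:R : R) <= 1.
    by rewrite divr_ge0//= ler_pdivrMr ?ltr0n// mul1r ler_nat.
  have -> : K / n%:R ^+ 2 * (k%:R - n%:R * x) ^+ 2 = K * (k%:R / n%:R - x) ^+ 2.
    by field.
  have [xk|xk] := ltP `|x - k%:R / n%:R| d.
    rewrite distrC; apply: (le_trans (ltW (hd _ _ x01 xk))).
    by rewrite lerDl mulr_ge0 ?sqr_ge0// ltW.
  rewrite distrC in xk.
  apply: (@le_trans _ _ (M + M)).
    by rewrite (le_trans (ler_normB _ _))// lerD// hM.
  apply: (@le_trans _ _ (K * d ^+ 2)).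
    by rewrite /K divfK ?gt_eqF ?exprn_gt0// mulrDl !mul1r.
  rewrite -(real_normK (num_real (k%:R / n%:R - x))) ler_wpDl ?(ltW e20)// ler_pM2l//.
  by rewrite lerXn2r ?nnegrE// ltW.
have bK : e / 2 + K / n%:R ^+ 2 * (n%:R * x * (1 - x) + (n%:R * x - n%:R * x) ^+ 2) <= e.
  rewrite [leRHS]splitr lerD2l (le_trans _ nK)//.
  rewrite subrr expr0n /= addr0.
  have -> : K / n%:R ^+ 2 * (n%:R * x * (1 - x)) = K / n%:R * (x * (1 - x)) by field.
  rewrite ler_piMr ?divr_ge0// ?(ltW K0)//; nra.
rewrite distrC ler_norml; apply/andP; split.
  rewrite lerNl -bernsteinB_cst -bernsteinN (le_trans _ bK)//.
  rewrite -bernstein_quad; apply: bernstein_le => // k kn.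
  by rewrite (le_trans _ (Kx k kn))// -normrN ler_norm.
rewrite -bernsteinB_cst (le_trans _ bK)//.
rewrite -bernstein_quad; apply: bernstein_le => // k kn.
by rewrite (le_trans _ (Kx k kn))// ler_norm.
Qed.

End Bernstein.

(** * Uniform convergence of slowly varying functions *)

Section UniformConvergence.
Context {R : realType}.
Local Notation mu := (@lebesgue_measure R).

Lemma lebesgue_measure_shift (u : R) (A : set R) :
  measurable A -> pushforward mu ((fun x => x + u) : _ -> measurableTypeR R) A = mu A.
Proof.
move=> mA.
have mu_ : measurable_fun setT ((fun x => x + u) : R -> measurableTypeR R).
  exact: measurable_funD.
apply/esym/lebesgue_measure_unique => //= _ [[a b]] _ <-.
rewrite /pushforward (_ : _ @^-1` _ = `]a - u, b - u]%classic); last first.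
  by apply/seteqP; split => x /=; rewrite !in_itv/= ltrBlDr lerBrDr.
rewrite !lebesgue_measure_itv/= !lte_fin ltrD2r -!EFinB.
by rewrite opprD opprK addrACA addNr addr0.
Qed.

(* Egorov's theorem applied to v |-> h (x n + v) - h (x n) and to its translate by u n produces a
   point common to a large set and to the translate of another one. *)
Lemma uniform_shift (h : R -> R) (a : R) : measurable_fun setT h -> 0 <= a ->
  (forall v, h (x + v) - h x @[x --> +oo] --> (0 : R)) ->
  forall e : R, 0 < e -> exists M : R, forall x u : R, M < x ->
    0 <= u <= a -> `|h (x + u) - h x| < e.
Proof.
move=> mh a0 hv e e0; apply: contrapT => /forallNP H.
have /choice[xu Hxu] : forall n : nat, exists xu : R * R,
    [/\ n%:R < xu.1, 0 <= xu.2 <= a & e <= `|h (xu.1 + xu.2) - h xu.1|].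
  move=> n; have /existsNP[x /existsNP[u]] := H n%:R.
  by move=> /not_implyP[nx /not_implyP[ua /negP]]; rewrite -leNgt => eh; exists (x, u).
pose y n := (xu n).1; pose z n := (xu n).1 + (xu n).2.
have cvgy (s : nat -> R) : (forall n, n%:R <= s n) -> s @ \oo --> +oo.
  move=> ns; apply/cvgryPge => A; near=> n; rewrite (le_trans _ (ns n))//.
  by near: n; exact: nbhs_infty_ger.
have Hy (s : nat -> R) v : (forall n, n%:R <= s n) ->
    (fun n => h (s n + v) - h (s n)) @ \oo --> (0 : R).
  by move=> ns; apply: (cvg_comp _ _ (cvgy s ns) (hv v)).
have yn n : n%:R <= y n by have [/ltW] := Hxu n.
have zn n : n%:R <= z n.
  by have [n1 /andP[n2 _] _] := Hxu n; rewrite (le_trans (yn n))// lerDl.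
have e20 : 0 < e / 2 by rewrite divr_gt0.
have egorov (s : nat -> R) (b : R) : (forall n, n%:R <= s n) ->
    exists B : set R, [/\ measurable B, (mu B < (4^-1)%:E)%E &
      \forall n \near \oo, forall v : R, 0 <= v <= b -> ~ B v ->
        `|h (s n + v) - h (s n)| < e / 2].
  move=> ns.
  have [|||||B [mB B4 U]] := @pointwise_almost_uniform _ R (measurableTypeR R) mu
    (fun n v => h (s n + v) - h (s n)) (fun=> 0) `[0, b] 4^-1 => //.
  - move=> n; apply: measurable_funTS; apply: measurable_funB => //.
    by apply: measurableT_comp => //; exact: measurable_funD.
  - move=> /=. by rewrite lebesgue_measure_itv/=; case: ifP => _; rewrite ?ltry// -EFinB ltry.
  - by move=> v _; exact: Hy.
  exists B; split => //.
  have := U [set g : R -> R | forall v, (`[0, b] `\` B) v -> `|g v| < e / 2].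
  move=> [].
    apply/uniform_nbhs; exists [set xy : R * R | `|xy.2 - xy.1| < e / 2]; split.
      by rewrite -entourage_ballE; exists (e / 2) => // -[p q]/=; rewrite /ball/= distrC.
    by move=> g /= Hg v Bv; have := Hg v Bv; rewrite subr0.
  move=> N _ HN; exists N => // n Nn v va nB; have := HN n Nn v; apply.
  by split => //=; rewrite in_itv.
(* The increment from [y n] to [z n] is compared through the common point [y n + (u + w) = z n + w].
   With [w] in [[0, 1]], [u + w] may reach [a + 1]. Each exceptional set has measure below 1/4, so
   some [w] avoids both. *)
have [B1 [mB1 B1s]] := egorov y (a + 1) yn.
have [B2 [mB2 B2s]] := egorov z 1 zn.
move=> [N2 _ HN2] [N1 _ HN1].
pose n := maxn N1 N2.
have [_ /andP[u0 ua] eh] := Hxu n.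
pose u := (xu n).2.
have [w [w01 B2w B1w]] : exists w : R, [/\ 0 <= w <= 1, ~ B2 w & ~ B1 (w + u)].
  apply: contrapT => Hw.
  have : (mu `[0%R, 1%R]%classic <= mu (B2 `|` ((fun x : R => (x + u)%R) @^-1` B1)))%E.
    apply: le_measure; rewrite ?inE//.
      apply: measurableU => //; rewrite -[X in measurable X]setTI.
      exact: measurable_funD.
    move=> w /=; rewrite in_itv/= => w01; apply: contrapT => /not_orP[B2w B1w].
    by apply: Hw; exists w.
  have mB1u : measurable ((fun x : R => x + u) @^-1` B1).
    by rewrite -[X in measurable X]setTI; exact: measurable_funD.
  apply/negP; rewrite -ltNge.
  rewrite (le_lt_trans (measureU2 _ _ _))//.
  have E : mu ((fun x : R => (x + u)%R) @^-1` B1) = mu B1 by exact: lebesgue_measure_shift.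
  rewrite [X in (_ + X)%E]E (lt_le_trans (lteD B2s B1s))//.
  by rewrite lebesgue_measure_itv/= lte01 oppr0 addr0 -EFinD lee_fin; lra.
have := HN2 n (leq_maxr _ _) w w01 B2w.
have := HN1 n (leq_maxl _ _) (w + u) _ B1w.
have /andP[w0 w1] := w01.
rewrite addr_ge0//= addrC lerD// => /(_ isT) K1 K2.
move: eh; apply/negP; rewrite -ltNge.
rewrite -/(z n) -/(y n).
rewrite (_ : h (z n) - h (y n) = (h (y n + (u + w)) - h (y n)) - (h (z n + w) - h (z n))); last first.
  by rewrite /z /y -/u addrA; ring.
by rewrite (le_lt_trans (ler_normB _ _))// [ltRHS]splitr ltrD.
Unshelve. all: by end_near. Qed.

(** In logarithmic coordinates the ratio is the exponential of an increment of [ln o ell o exp]. As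
    [uniform_shift] covers shifts from 0 upwards, the range from [ln A] to [ln B] is measured from
    [ln x + ln A]; the remaining shift by [ln A] is one instance of slow variation. *)
Lemma slowly_varying_uniform (ell : R -> R) (A B e : R) : slowly_varying ell ->
  0 < A -> 0 < e -> exists M : R, forall x lam : R, M < x -> A <= lam <= B ->
    `|ell (lam * x) / ell x - 1| < e.
Proof.
move=> [ell0 mell ellv] A0 e0.
have [BA|AB] := ltP B A.
  by exists 0 => x lam _ /andP[Al lB]; have := le_trans Al lB; rewrite leNgt BA.
pose h x := ln (ell (expR x)).
have mh : measurable_fun setT h.
  apply: measurableT_comp => //.
  apply: (@measurable_comp _ _ _ _ _ _ (`]0, +oo[ : set R)) => //.
  by move=> _ [x _ <-] /=; rewrite in_itv/= expR_gt0.
have hv v : h (x + v) - h x @[x --> +oo] --> (0 : R).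
  apply/cvgrPdist_lt => d d0.
  have /cvgrPdist_lt/(_ d d0)[M [_ HM]] : ln (ell (expR v * x) / ell x) @[x --> +oo] --> (0 : R).
    rewrite -(@ln1 R); apply: (cvg_comp _ _ (ellv (expR v) (expR_gt0 v))).
    exact: continuous_ln.
  exists M; split => [|x Mx]; first exact: num_real.
  have := HM (expR x); rewrite /= /h expRD [expR x * _]mulrC ln_div ?posrE ?ell0 ?mulr_gt0 ?expR_gt0//.
  by apply; rewrite (lt_le_trans Mx)// (le_trans _ (expR_ge1Dx x))// lerDr.
have [d d0 Hd] : exists2 d : R, 0 < d & forall t : R, `|t| < d -> `|expR t - 1| < e.
  have /cvgrPdist_lt/(_ e e0)[d /= d0 Hd] := @continuous_expR R 0.
  exists d => // t td; have := Hd t; rewrite /= sub0r normrN expR0 distrC; exact.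
have AB0 : 0 <= ln B - ln A.
  by rewrite subr_ge0 ler_ln ?posrE// (lt_le_trans A0).
have [|M HM] := @uniform_shift h (ln B - ln A) mh AB0 hv (d / 2); first by rewrite divr_gt0.
have /cvgrPdist_lt/(_ (d / 2)) := hv (ln A).
rewrite divr_gt0// => /(_ isT)[N [_ HN]].
exists (expR (Num.max N (M - ln A))) => x lam Mx /andP[Al lB].
have x0 : 0 < x by rewrite (lt_trans _ Mx)// expR_gt0.
have l0 : 0 < lam by rewrite (lt_le_trans A0).
have Nx : N < ln x.
  by rewrite -ltr_expR lnK ?posrE// (le_lt_trans _ Mx)// ler_expR le_max lexx.
have MAx : M < ln x + ln A.
  by rewrite -ltrBlDr -ltr_expR lnK ?posrE// (le_lt_trans _ Mx)// ler_expR le_max lexx orbT.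
have := HN _ Nx; rewrite sub0r normrN => H1.
have := HM _ (ln lam - ln A) MAx.
have lnAl : ln A <= ln lam by rewrite ler_ln.
have lnlB : ln lam <= ln B by rewrite ler_ln// posrE (lt_le_trans l0).
rewrite subr_ge0 lerD2r lnAl lnlB => /(_ isT) H2.
have -> : ell (lam * x) / ell x = expR (h (ln x + ln lam) - h (ln x)).
  have Ex : expR (ln x) = x by rewrite lnK.
  have El : expR (ln lam) = lam by rewrite lnK.
  by rewrite /h [expR (ln x + _)]expRD Ex El expRB !lnK ?posrE ?ell0 ?mulr_gt0// [lam * x]mulrC.
apply: Hd.
have -> : h (ln x + ln lam) - h (ln x) =
   (h (ln x + ln A + (ln lam - ln A)) - h (ln x + ln A)) + (h (ln x + ln A) - h (ln x)).
  have -> : ln x + ln A + (ln lam - ln A) = ln x + ln lam by ring.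
  by rewrite addrA subrK.
by rewrite (le_lt_trans (ler_normD _ _))// [ltRHS]splitr ltrD.
Qed.

End UniformConvergence.

(** * Log-periodic regular variation along geometric sequences *)

Section LogPeriodicClass.
Context {R : realType}.
Implicit Types (r a : R) (q : R -> R).

Lemma exprn_pinfty r : 1 < r -> (fun n => r ^+ n) @ \oo --> +oo.
Proof.
move=> r1; have r0 : 0 < r - 1 by rewrite subr_gt0.
have bern n : n%:R * (r - 1) <= r ^+ n.
  elim: n => [|n IH]; first by rewrite mul0r expr0.
  rewrite exprS -natr1 mulrDl mul1r.
  have : 1 <= r ^+ n by rewrite exprn_ege1// ltW.
  by move: IH; nra.
apply/cvgryPge => A; near=> n.
apply: le_trans (bern n); rewrite -ler_pdivrMr//.
by near: n; exact: nbhs_infty_ger.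
Unshelve. all: by end_near. Qed.

Lemma exprn_floor r x : 1 < r -> 1 <= x -> exists n, r ^+ n <= x < r ^+ n.+1.
Proof.
move=> r1 x1.
have [N HN] : exists N, x < r ^+ N.
  have /cvgryPgt/(_ x)[N _ HN] := exprn_pinfty r1.
  by exists N; apply: HN => /=.
have : exists n, x < r ^+ n by exists N.
case/ex_minnP => -[|n] xn minn; first by move: xn; rewrite expr0 ltNge x1.
exists n; rewrite xn andbT leNgt; apply/negP => /minn.
by rewrite ltnn.
Qed.

Lemma fundamental_domain r x : 1 < r -> 0 < x ->
  exists s n, 1 <= s <= r /\ (x = s * r ^+ n \/ x = s / r ^+ n).
Proof.
move=> r1 x0; have r0 : 0 < r by rewrite (lt_trans _ r1).
have [x1|x1] := leP 1 x.
  have [n /andP[nx xn]] := exprn_floor r1 x1.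
  exists (x / r ^+ n), n; split; last by left; rewrite divfK// gt_eqF ?exprn_gt0.
  rewrite ler_pdivlMr ?exprn_gt0// mul1r nx/= ler_pdivrMr ?exprn_gt0//.
  by rewrite -exprS ltW.
have xV1 : 1 <= x^-1 by rewrite invf_ge1// ltW.
have [n /andP[nx xn]] := exprn_floor r1 xV1.
exists (x * r ^+ n.+1), n.+1; split; last by right; rewrite mulfK// gt_eqF ?exprn_gt0.
apply/andP; split.
  by rewrite mulrC -ler_pdivrMr// mul1r ltW.
by rewrite exprS mulrCA -[leRHS]mulr1 ler_pM2l// mulrC -ler_pdivlMr// mul1r.
Qed.

Lemma logperX r q : 1 < r -> (forall x, 0 < x -> q (x * r) = q x) ->
  forall x n, 0 < x -> q (x * r ^+ n) = q x.
Proof.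
move=> r1 qr x n x0; elim: n => [|n IH]; first by rewrite expr0 mulr1.
by rewrite exprSr mulrA qr// mulr_gt0// exprn_gt0// (lt_trans _ r1).
Qed.

Lemma logperV r q : 1 < r -> (forall x, 0 < x -> q (x * r) = q x) ->
  forall x n, 0 < x -> q (x / r ^+ n) = q x.
Proof.
move=> r1 qr x n x0.
have rn : 0 < r ^+ n by rewrite exprn_gt0// (lt_trans _ r1).
by rewrite -(logperX r1 qr n (divr_gt0 x0 rn)) divfK// gt_eqF.
Qed.

Lemma logper_domain r q : 1 < r -> (forall x, 0 < x -> q (x * r) = q x) ->
  forall x, 0 < x -> exists2 s, 1 <= s <= r & q x = q s.
Proof.
move=> r1 qr x x0; have [s [n [sr [->|->]]]] := fundamental_domain r1 x0.
  exists s => //; rewrite logperX//; by case/andP: sr => /(lt_le_trans ltr01).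
by exists s => //; rewrite logperV//; case/andP: sr => /(lt_le_trans ltr01).
Qed.

Lemma logper_bounds r q : 1 < r -> logper r q ->
  exists k K : R, [/\ 0 < k, 0 < K & forall x, 0 < x -> k <= q x <= K].
Proof.
move=> r1 [q0 [M qM] _ iq qr].
exists (inf (q @` `[1, r])), M; split => //; first by rewrite (lt_le_trans (q0 1 ltr01)) ?qM.
move=> x x0; rewrite qM// andbT.
have [s s1r ->] := logper_domain r1 qr x0.
apply: ge_inf; last by exists s => //=; rewrite in_itv.
by exists 0 => _ [y /= + <-]; rewrite in_itv/= => /andP[/(lt_le_trans ltr01) + _] => /q0/ltW.
Qed.

Lemma powR_itv_bounds a (A B : R) : 0 < A -> exists k K : R, [/\ 0 < k, 0 < K &
  forall x, A <= x <= B -> k <= x `^ a <= K].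
Proof.
move=> A0; have [BA|AB] := ltP B A.
  by exists 1, 1; split => // x /andP[Ax /(le_trans Ax)]; rewrite leNgt BA.
have B0 : 0 < B by rewrite (lt_le_trans A0).
have [a0|a0] := leP 0 a.
  exists (A `^ a), (B `^ a); split; rewrite ?powR_gt0// => x /andP[Ax xB].
  by rewrite !ge0_ler_powR// nnegrE ?(ltW A0) ?(ltW B0)// (le_trans (ltW A0)).
exists (B `^ a), (A `^ a); split; rewrite ?powR_gt0// => x /andP[Ax xB].
have x0 : 0 < x by rewrite (lt_le_trans A0).
have E y : 0 < y -> y `^ a = (y `^ (- a))^-1 by move=> y0; rewrite powRN invrK.
rewrite !E//; apply/andP; split; rewrite lef_pV2 ?posrE ?powR_gt0//.
  by rewrite ge0_ler_powR ?nnegrE ?oppr_ge0// ltW.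
by rewrite ge0_ler_powR ?nnegrE ?oppr_ge0// ltW.
Qed.

Lemma logper_itv_bounds r a q (A B : R) : 1 < r -> logper r q -> 0 < A ->
  exists k K : R, [/\ 0 < k, 0 < K &
    forall x, A <= x <= B -> k <= x `^ a * q x <= K].
Proof.
move=> r1 qr A0.
have [k [K [k0 K0 kK]]] := logper_bounds r1 qr.
have [k' [K' [k'0 K'0 kK']]] := powR_itv_bounds a B A0.
exists (k' * k), (K' * K); split; rewrite ?mulr_gt0// => x xAB.
have x0 : 0 < x by case/andP: xAB => /(lt_le_trans A0).
have /andP[? ?] := kK x x0; have /andP[? ?] := kK' x xAB.
by rewrite !ler_pM// ?ltW// ?powR_gt0//; case: qr => q0 _ _ _ _; exact: q0.
Qed.

Lemma continuous_logper r q : 1 < r -> (forall x, 0 < x -> 0 < q x) ->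
  (forall x, 0 < x -> {for x, continuous q}) ->
  (forall x, 0 < x -> q (x * r) = q x) -> logper r q.
Proof.
move=> r1 q0 qc qr.
have qc1r : {within `[1, r], continuous q}.
  apply: continuous_in_subspaceT => x; rewrite inE/= in_itv/= => /andP[x1 _].
  by apply: qc; rewrite (lt_le_trans _ x1).
have [M M1r HM] := EVT_max (ltW r1) qc1r.
have [m m1r Hm] := EVT_min (ltW r1) qc1r.
split => //.
- exists (q M) => x x0; have [s s1r ->] := logper_domain r1 qr x0.
  by apply: HM; rewrite in_itv.
- by move=> x x0; apply: cvg_at_right_filter; exact: qc.
- apply: (@lt_le_trans _ _ (q m)).
    by apply: q0; move: m1r; rewrite in_itv/= => /andP[/(lt_le_trans ltr01)].
  apply: lb_le_inf; first by exists (q 1); exists 1 => //=; rewrite in_itv/= lexx ltW.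
  by move=> _ [x /= x1r <-]; exact: Hm.
Qed.

End LogPeriodicClass.

Section RegularVariation.
Context {R : realType} (r : R) (ell : R -> R).
Hypotheses (r_gt1 : 1 < r) (ell_sv : slowly_varying ell).
Implicit Types (a : R) (q H G : R -> R).

Let r_gt0 : 0 < r. Proof. by rewrite (lt_trans _ r_gt1). Qed.
Let rX_gt0 n : 0 < r ^+ n. Proof. by rewrite exprn_gt0. Qed.
Let rX_neq0 n : r ^+ n != 0. Proof. by rewrite gt_eqF. Qed.
Let ell_gt0 x : 0 < x -> 0 < ell x. Proof. by case: ell_sv => + _ _; apply. Qed.

Definition scale a n := (r ^+ n) `^ (- a) * ell (r ^+ n).

Definition scaled a H n s := H (s / r ^+ n) / scale a n.

Definition unif_scaled a H G := forall A B e : R, 0 < A -> 0 < e ->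
  exists N, forall n s, (N <= n)%N -> A <= s <= B -> `|scaled a H n s - G s| < e.

Lemma scale_gt0 a n : 0 < scale a n.
Proof. by rewrite mulr_gt0 ?powR_gt0 ?ell_gt0. Qed.

(** The factor [(r ^+ n)^-1] that the chain rule produces from [H (s / r ^+ n)] is absorbed by
    passing from [a] to [a - 1]. *)
Lemma scaleB1 a n : scale (a - 1) n = r ^+ n * scale a n.
Proof.
by rewrite /scale opprB addrC powRD ?rX_neq0 ?implybT// powRr1 ?ltW// mulrA [_ * r ^+ n]mulrC.
Qed.

Lemma scale_ratio a : scale a n.+1 / scale a n @[n --> \oo] --> r `^ (- a).
Proof.
have [_ _ ellv] := ell_sv.
rewrite -[X in _ --> X]mulr1.
have -> : (fun n => scale a n.+1 / scale a n) =
   (fun n => r `^ (- a) * (ell (r * r ^+ n) / ell (r ^+ n))).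
  apply/funext => n; rewrite /scale exprS powRM ?(ltW r_gt0) ?(ltW (rX_gt0 n))//.
  by field; rewrite !gt_eqF ?ell_gt0 ?powR_gt0.
apply: cvgM; first exact: cvg_cst.
exact: (cvg_comp _ _ (exprn_pinfty r_gt1) (ellv r r_gt0)).
Qed.

End RegularVariation.

Lemma powRV {R : realType} (x a : R) : 0 <= x -> x^-1 `^ a = (x `^ a)^-1.
Proof. by move=> x0; rewrite -powR_inv1// powRAC powR_inv1// powR_ge0. Qed.

Lemma powR_gt1 {R : realType} (x a : R) : 1 < x -> 0 < a -> 1 < x `^ a.
Proof.
move=> x1 a0; rewrite (_ : 1 = 1 `^ a); last by rewrite powR1.
by apply: gt0_ltr_powR => //; rewrite nnegrE// ltW// (lt_trans _ x1).
Qed.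

Lemma locally_lipschitz_continuous {R : realType} (D : R -> R) :
  (forall A B : R, 0 < A -> exists K : R, 0 <= K /\
    forall s t, A <= s <= B -> A <= t <= B -> `|D s - D t| <= K * `|s - t|) ->
  forall s : R, 0 < s -> {for s, continuous D}.
Proof.
move=> lip s s0; have s20 : 0 < s / 2 by rewrite divr_gt0.
have [K [K0 DL]] := lip (s / 2) (s + s / 2) s20.
apply/cvgrPdist_lt => e e0.
near=> t.
have st : `|s - t| < s / 2.
  by near: t; apply: (@nbhsx_ballx _ _ s); exact: s20.
have st' : `|s - t| < e / (K + 1).
  by near: t; apply: (@nbhsx_ballx _ _ s); rewrite divr_gt0// ltr_wpDl.
apply: (@le_lt_trans _ _ (K * `|s - t|)).
  apply: DL; first by apply/andP; split; lra.
  by move: st; rewrite ltr_norml => /andP[? ?]; apply/andP; split; lra.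
move: st'; rewrite ltr_pdivlMr ?ltr_wpDl// => st'.
by rewrite (le_lt_trans _ st')// mulrC ler_wpM2l// lerDl.
Unshelve. all: by end_near. Qed.

Section ScaledLimits.
Context {R : realType} (r : R) (ell : R -> R).
Hypotheses (r_gt1 : 1 < r) (ell_sv : slowly_varying ell).
Implicit Types (a : R) (q H G : R -> R).
Local Notation scale := (scale r ell).
Local Notation scaled := (scaled r ell).
Local Notation unif_scaled := (unif_scaled r ell).

Let r_gt0 : 0 < r. Proof. by rewrite (lt_trans _ r_gt1). Qed.
Let rX_gt0 n : 0 < r ^+ n. Proof. by rewrite exprn_gt0. Qed.
Let rX_neq0 n : r ^+ n != 0. Proof. by rewrite gt_eqF. Qed.
Let ell_gt0 x : 0 < x -> 0 < ell x. Proof. by case: ell_sv => + _ _; apply. Qed.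

Lemma unif_scaledW a H G s : unif_scaled a H G -> 0 < s ->
  scaled a H n s @[n --> \oo] --> G s.
Proof.
move=> HG s0; apply/cvgrPdist_lt => e e0.
have [N HN] := HG s s e s0 e0.
by exists N => // n /= Nn; rewrite distrC HN ?lexx.
Qed.

Lemma asymp0_unif_scaled a H q : logper r q ->
  asymp0 H (fun s => s `^ a * ell s^-1 * q s) ->
  unif_scaled a H (fun s => s `^ a * q s).
Proof.
move=> qr Hq A B e A0 e0.
have [BA|AB] := ltP B A.
  by exists 0%N => n s _ /andP[As /(le_trans As)]; rewrite leNgt BA.
have B0 : 0 < B by rewrite (lt_le_trans A0).
have [q0 _ _ _ qper] := qr.
have [k [K [_ K0 HK]]] := logper_itv_bounds a B r_gt1 qr A0.
(* [d <= 1] keeps the ratio [v] of the slowly varying factors below 2, so the relative error is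
   below [2 d + d] and the absolute one below [4 d K <= e]. *)
pose d := Num.min 1 (e / (4 * K)).
have d0 : 0 < d by rewrite lt_min ltr01 divr_gt0// mulr_gt0.
have dK : d * (4 * K) <= e by rewrite -ler_pdivlMr ?mulr_gt0// ge_min lexx orbT.
have BV0 : 0 < B^-1 by rewrite invr_gt0.
have [M HM] := slowly_varying_uniform A^-1 ell_sv BV0 d0.
move/cvgrPdist_lt: Hq => /(_ d d0)[t /= t0 Ht].
have /cvgryPgt/(_ (Num.max M (B / t)))[N _ HN] := exprn_pinfty r_gt1.
exists N => n s Nn AsB; have /andP[As sB] := AsB.
have s0 : 0 < s by rewrite (lt_le_trans A0).
have := HN n Nn; rewrite gt_max => /andP[Mn Btn].
have sn0 : 0 < s / r ^+ n by rewrite divr_gt0.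
have snt : s / r ^+ n < t.
  by rewrite ltr_pdivrMr// mulrC -ltr_pdivrMr// (le_lt_trans _ Btn)// ler_pM2r ?invr_gt0.
have {Ht} := Ht (s / r ^+ n); rewrite /= sub0r normrN gtr0_norm// => /(_ snt sn0).
have := HM (r ^+ n) s^-1 Mn.
rewrite !lef_pV2 ?posrE// As sB => /(_ isT).
have -> : H (s / r ^+ n) / ((s / r ^+ n) `^ a * ell (s / r ^+ n)^-1 * q (s / r ^+ n)) =
   scaled a H n s / (s `^ a * q s) / (ell (s^-1 * r ^+ n) / ell (r ^+ n)).
  rewrite (logperV r_gt1 qper)// invf_div [r ^+ n / s]mulrC /scaled /scale.
  rewrite powRM ?invr_ge0 ?(ltW s0)// ?(ltW (rX_gt0 n))// powRV ?(ltW (rX_gt0 n))// powRN.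
  by field; rewrite !gt_eqF ?powR_gt0 ?q0 ?ell_gt0// mulr_gt0 ?invr_gt0.
set u := scaled a H n s; set G := s `^ a * q s; set v := ell _ / _.
have G0 : 0 < G by rewrite mulr_gt0 ?powR_gt0 ?q0.
have GK : G <= K by have /andP[] := HK s AsB.
have v0 : 0 < v by rewrite divr_gt0 ?ell_gt0// mulr_gt0 ?invr_gt0.
have d1 : d <= 1 by rewrite ge_min lexx.
move=> Hv Hu.
have -> : u - G = G * ((u / G / v - 1) * v + (v - 1)).
  by field; rewrite !gt_eqF.
have v2 : v < 2.
  by move: Hv; rewrite ltr_norml => /andP[_]; lra.
rewrite normrM (gtr0_norm G0).
have Hb : `|(u / G / v - 1) * v + (v - 1)| < d * 2 + d.
  rewrite (le_lt_trans (ler_normD _ _))// ltrD// normrM (gtr0_norm v0).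
  by apply: ltr_pM => //; rewrite ?(ltW v0)// distrC.
rewrite (lt_le_trans _ dK)// (@le_lt_trans _ _ (K * (d * 2 + d)))//; last by nra.
by rewrite ler_pM// ltW.
Qed.

(** Every small [t] is [s / r ^+ n.+1] with [s] in [[1, r]], so uniformity over a single period
    reaches all of them; the lower bound [k] of [s^a q(s)] turns the absolute error into a relative
    one. *)
Lemma unif_scaled_asymp0 a H q : logper r q ->
  unif_scaled a H (fun s => s `^ a * q s) ->
  asymp0 H (fun s => s `^ a * ell s^-1 * q s).
Proof.
move=> qr HG; apply/cvgrPdist_lt => e e0.
have [q0 _ _ _ qper] := qr.
have [k [K [k0 _ HK]]] := logper_itv_bounds a r r_gt1 qr ltr01.
(* [d <= 1 / 2] gives [v >= 1 / 2], hence [v^-1 <= 2]; two errors of size [d] then amount to less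
   than [4 d <= e]. *)
pose d := Num.min (1 / 2) (e / 4).
have d0 : 0 < d by rewrite lt_min !divr_gt0.
have d1 : d <= 1 / 2 by rewrite ge_min lexx.
have de : d * 4 <= e by rewrite -ler_pdivlMr// ge_min lexx orbT.
have [N HN] := HG 1 r (d * k) ltr01 (mulr_gt0 d0 k0).
have rV0 : 0 < r^-1 by rewrite invr_gt0.
have [M HM] := slowly_varying_uniform 1 ell_sv rV0 d0.
exists (Num.min 1 (r ^+ N.+1 * (1 + `|M|))^-1) => /=.
  by rewrite lt_min ltr01 invr_gt0 mulr_gt0// ltr_wpDr.
move=> t /= + t0; rewrite sub0r normrN gtr0_norm// lt_min => /andP[t1 tM].
have tV1 : 1 <= t^-1 by rewrite invf_ge1// ltW.
have [n /andP[nt tn]] := exprn_floor r_gt1 tV1.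
have tV : r ^+ N.+1 * (1 + `|M|) < t^-1.
  by rewrite -[ltLHS]invrK ltf_pV2 ?posrE// invr_gt0 mulr_gt0// ltr_wpDr.
have M1 : 1 <= 1 + `|M| by rewrite lerDl.
have Nn : (N <= n.+1)%N.
  rewrite leqNgt; apply/negP => nN; move: tn; rewrite ltNge => /negP; apply.
  apply: (le_trans _ (ltW tV)); rewrite -[leLHS]mulr1 ler_pM ?ler01 ?(ltW (rX_gt0 _))//.
  by rewrite ler_eXn2l// leqW// ltnW.
have Mr : M < r ^+ n.+1.
  apply: lt_trans tn; apply: le_lt_trans tV.
  have := ler_norm M; have := exprn_ege1 N.+1 (ltW r_gt1).
  by nra.
pose s := t * r ^+ n.+1.
have s0 : 0 < s by rewrite mulr_gt0.
have st : s / r ^+ n.+1 = t by rewrite mulfK.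
have s1 : 1 <= s by rewrite /s mulrC -ler_pdivrMr// mul1r ltW.
have sr : s <= r by rewrite /s exprS mulrCA -[leRHS]mulr1 ler_pM2l// mulrC -ler_pdivlMr// mul1r.
have s1r : 1 <= s <= r by rewrite s1.
have := HN n.+1 s Nn s1r.
have := HM (r ^+ n.+1) s^-1 Mr.
rewrite invf_le1// s1 lef_pV2 ?posrE// sr => /(_ isT).
rewrite -st.
have -> : H (s / r ^+ n.+1) / ((s / r ^+ n.+1) `^ a * ell (s / r ^+ n.+1)^-1 * q (s / r ^+ n.+1)) =
   scaled a H n.+1 s / (s `^ a * q s) / (ell (s^-1 * r ^+ n.+1) / ell (r ^+ n.+1)).
  rewrite (logperV r_gt1 qper)// invf_div [r ^+ n.+1 / s]mulrC /scaled /scale.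
  rewrite powRM ?invr_ge0 ?(ltW s0)// ?(ltW (rX_gt0 _))// powRV ?(ltW (rX_gt0 _))// powRN.
  by field; rewrite !gt_eqF ?powR_gt0 ?q0 ?ell_gt0// mulr_gt0 ?invr_gt0.
set u := scaled a H n.+1 s; set G := s `^ a * q s; set v := ell _ / _.
have G0 : 0 < G by rewrite mulr_gt0 ?powR_gt0 ?q0.
have kG : k <= G by have /andP[] := HK s s1r.
move=> Hv Hu.
have v2 : 1 / 2 <= v.
  by move: Hv; rewrite ltr_norml => /andP[+ _]; move: d1; lra.
have v0 : 0 < v by move: v2; lra.
have -> : 1 - u / G / v = v^-1 * ((v - 1) + (G - u) / G).
  by field; rewrite !gt_eqF.
rewrite normrM gtr0_norm ?invr_gt0// (lt_le_trans _ de)//.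
have Hb : `|(v - 1) + (G - u) / G| < d + d.
  rewrite (le_lt_trans (ler_normD _ _))// ltrD//.
  rewrite normrM [in X in _ * X]gtr0_norm ?invr_gt0// ltr_pdivrMr// distrC.
  by rewrite (lt_le_trans Hu)// ler_pM2l.
have vV : v^-1 <= 2 by rewrite -[2]invrK lef_pV2 ?posrE ?invr_gt0//; move: v2; lra.
have vV0 : 0 < v^-1 by rewrite invr_gt0.
by have := normr_ge0 ((v - 1) + (G - u) / G); nra.
Qed.

(* [s^-a * G s] is log-periodic because [scale a] has ratio tending to [r^-a]. *)
Lemma scaled_limit_periodic a H G s : 0 < s ->
  scaled a H n s @[n --> \oo] --> G s ->
  scaled a H n (s * r) @[n --> \oo] --> G (s * r) -> G (s * r) = r `^ a * G s.
Proof.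
move=> s0 Hs Hsr.
have H1 : scaled a H n.+1 (s * r) @[n --> \oo] --> G (s * r) by rewrite (cvg_shiftS (fun n => scaled a H n (s * r))).
suff H2 : scaled a H n.+1 (s * r) @[n --> \oo] --> r `^ a * G s.
  by have/cvg_lim <- // := H1; exact/cvg_lim.
have -> : (fun n => scaled a H n.+1 (s * r)) =
    (fun n => (scale a n.+1 / scale a n)^-1 * scaled a H n s).
  apply/funext => n; rewrite /scaled exprSr -mulf_div divff ?gt_eqF// mulr1.
  by field; rewrite !gt_eqF ?scale_gt0.
apply: cvgM => //; rewrite -[r `^ a]invrK -powRN; apply: cvgV.
  by rewrite gt_eqF ?powR_gt0.
exact: scale_ratio.
Qed.

Lemma continuous_powR (a s : R) : 0 < s -> {for s, continuous (fun x : R => x `^ a)}.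
Proof.
move=> s0; apply/differentiable_continuous/derivable1_diffP.
by apply: derivable_powR; rewrite in_itv/= s0.
Qed.

(** Closeness is propagated from [A] in steps of length [d]. Inside a step [u n] and [G] each move
    by at most [K d], and at the nodes pointwise convergence applies; [d] is chosen so that
    [2 K d <= e / 2]. *)
Lemma equilip_unif (u : nat -> R -> R) (G : R -> R) (A B K : R) N : 0 <= K ->
  (forall s, A <= s <= B -> u n s @[n --> \oo] --> G s) ->
  (forall n s t, (N <= n)%N -> A <= s <= B -> A <= t <= B ->
    `|u n s - u n t| <= K * `|s - t|) ->
  (forall s t, A <= s <= B -> A <= t <= B -> `|G s - G t| <= K * `|s - t|) /\
  forall e : R, 0 < e -> exists M, forall n s, (M <= n)%N -> A <= s <= B ->
    `|u n s - G s| < e.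
Proof.
move=> K0 uG uK.
have GK s t : A <= s <= B -> A <= t <= B -> `|G s - G t| <= K * `|s - t|.
  move=> sAB tAB; have /cvgr_to_le : (fun n => `|u n s - u n t|) @ \oo --> `|G s - G t|.
    by apply: cvg_norm; apply: cvgB; exact: uG.
  by apply; exists N => // n /= Nn; exact: uK.
split => // e e0.
pose d := e / (4 * (K + 1)).
have K10 : 0 < K + 1 by rewrite ltr_wpDl.
have d0 : 0 < d by rewrite divr_gt0// mulr_gt0.
have dK : d * (4 * (K + 1)) = e by rewrite divfK// gt_eqF// mulr_gt0.
suff H k : exists M, forall n s, (M <= n)%N -> A <= s <= B -> s <= A + k%:R * d ->
    `|u n s - G s| < e.
  have [M HM] := H (Num.bound ((B - A) / d)).
  exists M => n s Mn sAB; apply: HM => //.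
  have [BA|AB] := ltP B A.
    by move/andP: sAB => [As sB]; have := le_trans As sB; rewrite leNgt BA.
  rewrite -lerBlDl -ler_pdivrMr//; apply: le_trans (ltW (archi_boundP _)).
    by rewrite ler_pM2r ?invr_gt0// lerD2r; case/andP: sAB.
  by rewrite divr_ge0 ?subr_ge0// ltW.
elim: k => [|k [M HM]].
  have [BA|AB] := ltP B A.
    by exists 0%N => n s _ /andP[As sB]; have := le_trans As sB; rewrite leNgt BA.
  have /cvgrPdist_lt/(_ e e0)[M _ HM] := uG A ltac:(by rewrite lexx).
  exists M => n s Mn /andP[As _] sA.
  have -> : s = A by apply/eqP; rewrite eq_le As andbT; move: sA; rewrite mul0r addr0.
  by rewrite distrC; exact: HM.
have [BA|AB] := ltP B (A + k%:R * d).
  exists M => n s Mn sAB _; apply: HM => //; case/andP: sAB => _ sB.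
  exact: le_trans sB (ltW BA).
pose x := A + k%:R * d.
have xAB : A <= x <= B by rewrite AB lerDl mulr_ge0// ltW.
have e20 : 0 < e / 2 by rewrite divr_gt0.
have /cvgrPdist_lt/(_ _ e20)[M' _ HM'] := uG x xAB.
exists (maxn M (maxn M' N)) => n s.
rewrite !geq_max => /and3P[Mn M'n Nn] sAB sk.
have [sx|xs] := leP s x; first exact: HM.
have sxd : `|s - x| <= d.
  rewrite gtr0_norm ?subr_gt0// lerBlDl; move: sk; rewrite /x -natr1; nra.
have := HM' n M'n; rewrite /= distrC => H1.
have H2 := uK n s x Nn sAB xAB.
have H3 := GK s x sAB xAB.
have -> : u n s - G s = (u n s - u n x) + (u n x - G x) - (G s - G x) by ring.
rewrite (le_lt_trans (ler_normB _ _))// (@le_lt_trans _ _ (K * d + `|u n x - G x| + K * d))//.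
  rewrite lerD ?(le_trans H3) ?ler_wpM2l//.
  by rewrite (le_trans (ler_normD _ _))// lerD2r (le_trans H2)// ler_wpM2l.
by move: dK; nra.
Qed.

(** The device that produces all the log-periodic functions of Laplace type: the Lipschitz bounds
    make the limit continuous and the convergence locally uniform, while periodicity comes from the
    ratio of consecutive [scale]. *)
Lemma equilip_asymp0 a H G :
  (forall s, 0 < s -> 0 < G s) ->
  (forall s, 0 < s -> scaled a H n s @[n --> \oo] --> G s) ->
  (forall A B : R, 0 < A -> exists K N, 0 <= K /\ forall n s t, (N <= n)%N ->
    A <= s <= B -> A <= t <= B ->
    `|scaled a H n s - scaled a H n t| <= K * `|s - t|) ->
  let q := fun s => s `^ (- a) * G s in
  logper r q /\ asymp0 H (fun s => s `^ a * ell s^-1 * q s).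
Proof.
move=> G0 HG lip q.
have qE s : 0 < s -> s `^ a * q s = G s.
  by move=> s0; rewrite /q powRN mulrA divff ?mul1r// gt_eqF ?powR_gt0.
have Gc s : 0 < s -> {for s, continuous G}.
  apply: locally_lipschitz_continuous => A B A0.
  have [K [N [K0 HK]]] := lip A B A0.
  have AG t : A <= t <= B -> scaled a H n t @[n --> \oo] --> G t.
    by move=> /andP[At _]; apply: HG; rewrite (lt_le_trans A0).
  by have [GL _] := equilip_unif K0 AG HK; exists K.
have qr : logper r q.
  apply: continuous_logper => //.
  - by move=> s s0; rewrite mulr_gt0 ?powR_gt0 ?G0.
  - by move=> s s0; apply: cvgM; [exact: continuous_powR|exact: Gc].
  - move=> s s0; rewrite /q (scaled_limit_periodic s0 (HG _ s0)); last first.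
      by apply: HG; rewrite mulr_gt0.
    rewrite powRM ?ltW// -mulrA [X in _ * X]mulrA -powRD; last first.
      by rewrite (gt_eqF r_gt0) implybT.
    by rewrite addNr powRr0 mul1r.
split=> //; apply: unif_scaled_asymp0 => // A B e A0 e0.
have [K [N [K0 HK]]] := lip A B A0.
have AG t : A <= t <= B -> scaled a H n t @[n --> \oo] --> G t.
  by move=> /andP[st _]; apply: HG; rewrite (lt_le_trans A0).
have [_ /(_ e e0)[M HM]] := equilip_unif K0 AG HK.
exists M => n s Mn /andP[As sB]; rewrite qE ?(lt_le_trans A0)//.
by apply: HM => //; rewrite As.
Qed.
End ScaledLimits.

(** * Calculus on the half-line *)

Section HalfLine.
Context {R : realType}.
Implicit Types (f df G D : R -> R) (A B s t x y l : R).
Local Notation mu := (@lebesgue_measure R).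

Lemma is_derive_continuous f (df : R) x : is_derive x 1 f df -> {for x, continuous f}.
Proof. by move=> [fx _]; apply/differentiable_continuous/derivable1_diffP. Qed.

Lemma MVT_pos f df A B s t : 0 < A ->
  (forall x, 0 < x -> is_derive x 1 f (df x)) -> A <= s <= B -> A <= t <= B ->
  exists x, [/\ A <= x <= B, `|x - s| <= `|t - s|, `|x - t| <= `|t - s| &
    f t - f s = df x * (t - s)].
Proof.
move=> A0 fdf.
wlog st : s t / s <= t.
  move=> H sAB tAB; have [st|/ltW ts] := leP s t; first exact: H.
  have [x [xAB xt xs E]] := H t s ts tAB sAB.
  by exists x; split; rewrite // ?(distrC t)// -opprB E -mulrN opprB.
move=> /andP[As sB] /andP[At tB].
have [||x xst E] := @MVT_segment _ f df s t st.
- move=> x; rewrite in_itv/= => /andP[sx _]; apply: fdf.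
  by rewrite (lt_trans _ sx)// (lt_le_trans A0).
- apply: continuous_in_subspaceT => x; rewrite inE/= in_itv/= => /andP[sx _].
  apply: (@is_derive_continuous _ (df x)); apply: fdf.
  by rewrite (lt_le_trans A0)// (le_trans As).
exists x; move: xst; rewrite in_itv/= => /andP[sx xt]; split => //.
- by rewrite (le_trans As)//= (le_trans xt).
- by rewrite !ger0_norm ?subr_ge0// lerD2r.
- by rewrite distrC !ger0_norm ?subr_ge0// lerD2l lerN2.
Qed.

(** [D] may be unbounded at 0, so the interval is exhausted by the segments [[x / n.+1, x]] and
    monotone convergence is applied. *)
Lemma integral_FTC_left G D x l : 0 < x ->
  (forall y, 0 < y -> is_derive y 1 G (D y)) ->
  (forall y, 0 < y -> 0 <= D y) ->
  (forall y, 0 < y -> {for y, continuous D}) ->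
  G y @[y --> 0^'+] --> l ->
  (\int[mu]_(y in `]0%R, x]) (D y)%:E = (G x - l)%:E)%E.
Proof.
move=> x0 GD D0 Dc Gl.
pose F n := (`[x / n.+1%:R, x] : set R)%classic.
have Fpos n y : F n y -> 0 < y.
  by rewrite /F/= in_itv/= => /andP[+ _]; apply: lt_le_trans; rewrite divr_gt0.
have FE : \bigcup_n F n = `]0, x]%classic.
  apply/seteqP; split => y /=.
    by move=> [n _ Fy]; rewrite in_itv/= (Fpos n)//; move: Fy; rewrite /F/= in_itv/= => /andP[].
  rewrite in_itv/= => /andP[y0 yx].
  exists (Num.bound (x / y)) => //; rewrite /F/= in_itv/= yx andbT.
  rewrite ler_pdivrMr// mulrC -ler_pdivrMr//.
  rewrite (le_trans (ltW (archi_boundP _)))//; first by rewrite divr_ge0// ltW.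
  by rewrite ler_nat.
have FI n : (\int[mu]_(y in F n) (D y)%:E = (G x - G (x / n.+1%:R))%:E)%E.
  have [->|n0] := eqVneq n 0%N.
    by rewrite /F divr1 set_itv1 integral_set1 subrr.
  have ax : x / n.+1%:R < x.
    by rewrite ltr_pdivrMr// ltr_pMr// ltr1n ltnS lt0n.
  have a0 : 0 < x / n.+1%:R by rewrite divr_gt0.
  rewrite EFinB; apply: continuous_FTC2 => //.
  - apply: continuous_in_subspaceT => y; rewrite inE => /Fpos; exact: Dc.
  - split.
    + move=> y; rewrite in_itv/= => /andP[ay _].
      by have [] := GD y (lt_trans a0 ay).
    + by apply: cvg_at_right_filter; apply: (@is_derive_continuous _ (D (x / n.+1%:R))); exact: GD.
    + by apply: cvg_at_left_filter; apply: (@is_derive_continuous _ (D x)); exact: GD.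
  - move=> y; rewrite in_itv/= => /andP[ay _].
    by rewrite derive1E; apply: derive_val; apply: GD; apply: lt_trans ay.
have H1 : (\int[mu]_(y in F n) (D y)%:E)%E @[n --> \oo] --> (\int[mu]_(y in `]0%R, x]) (D y)%:E)%E.
  rewrite -FE; apply: ge0_nondecreasing_set_cvg_integral.
  - apply/nondecreasing_seqP => n; rewrite subsetEset => y.
    rewrite /F/= !in_itv/= => /andP[+ ->]; rewrite andbT; apply: le_trans.
    by rewrite ler_pM2l// lef_pV2 ?posrE// ler_nat.
  - by move=> n; exact: measurable_itv.
  - move=> n; apply/measurable_EFinP.
    apply: subspace_continuous_measurable_fun; first exact: measurable_itv.
    by apply: continuous_in_subspaceT => y; rewrite inE => /Fpos; exact: Dc.
  - by move=> n y /Fpos y0; rewrite lee_fin D0.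
have H2 : (\int[mu]_(y in F n) (D y)%:E)%E @[n --> \oo] --> (G x - l)%:E.
  under eq_fun do rewrite FI.
  apply: cvg_EFin; first exact: nearW.
  apply: cvgB; first exact: cvg_cst.
  move/cvg_at_rightP : Gl; apply; split => [n|]; first by rewrite divr_gt0.
  rewrite -[X in _ --> X](mulr0 x); apply: cvgM; first exact: cvg_cst.
  exact: cvg_harmonic.
by have/cvg_lim <- // := H1; exact/cvg_lim.
Qed.

Lemma integral_FTC_right G D x l : 0 < x ->
  (forall y, 0 < y -> is_derive y 1 G (D y)) ->
  (forall y, 0 < y -> 0 <= D y) ->
  (forall y, 0 < y -> {for y, continuous D}) ->
  G y @[y --> +oo] --> l ->
  (\int[mu]_(y in `]x, +oo[) (D y)%:E = (l - G x)%:E)%E.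
Proof.
move=> x0 GD D0 Dc Gl.
rewrite integral_itv_obnd_cbnd; last first.
  apply/measurable_EFinP; apply: open_continuous_measurable_fun; first exact: interval_open.
  by move=> y; rewrite inE/= in_itv/= andbT => xy; apply: Dc; apply: lt_trans xy.
rewrite EFinB; apply: ge0_continuous_FTC2y => //.
- by move=> y xy; apply: D0; apply: lt_le_trans xy.
- apply: continuous_in_subspaceT => y; rewrite inE/= in_itv/= andbT => xy.
  by apply: Dc; apply: lt_le_trans xy.
- by move=> y xy; have [] := GD y (lt_trans x0 xy).
- by apply: cvg_at_right_filter; apply: (@is_derive_continuous _ (D x)); exact: GD.
- move=> y; rewrite in_itv/= andbT => xy.
  by rewrite derive1E; apply: derive_val; apply: GD; apply: lt_trans xy.
Qed.

(** A quadratic remainder bound with a fixed [K] passes to pointwise limits, which differentiability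
    does not; this turns the bound back into a derivative of the limit. *)
Lemma quad_is_derive G (d K e x : R) : 0 < e ->
  (forall t, `|t - x| <= e -> `|G t - G x - d * (t - x)| <= K * `|t - x| ^+ 2) ->
  is_derive x 1 G d.
Proof.
move=> e0 HG.
have : h^-1 *: (G (h *: 1 + x) - G x) @[h --> 0^'] --> d.
  apply/cvgrPdist_lt => eps eps0.
  pose K' := `|K| + 1; have K'0 : 0 < K' by rewrite ltr_wpDl.
  near=> h.
  have h0 : h != 0 by near: h; exact: nbhs_dnbhs_neq.
  have hn0 : 0 < `|h| by rewrite normr_gt0.
  have he : `|h| <= e by apply: ltW; near: h; apply: dnbhs0_lt.
  have hK : `|h| < eps / K' by near: h; apply: dnbhs0_lt; rewrite divr_gt0.
  have := HG (h *: 1 + x); rewrite addrK [h *: 1]mulr1 => /(_ he) H.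
  rewrite -normrN opprB.
  have -> : h^-1 *: (G (h + x) - G x) - d = h^-1 * (G (h + x) - G x - d * h).
    by rewrite /GRing.scale/=; field.
  rewrite normrM normfV ltr_pdivrMl// (le_lt_trans H)//.
  move: hK; rewrite ltr_pdivlMr// /K' => hK.
  have := ler_norm K; have := normr_ge0 K; nra.
move=> H; apply: DeriveDef; first by apply/cvg_ex; exists d.
exact/cvg_lim.
Unshelve. all: by end_near. Qed.

Lemma quadratic_remainder f df (A B K : R) s t : 0 < A -> 0 <= K ->
  (forall x, 0 < x -> is_derive x 1 f (df x)) ->
  (forall s t, A <= s <= B -> A <= t <= B -> `|df s - df t| <= K * `|s - t|) ->
  A <= s <= B -> A <= t <= B ->
  `|f t - f s - df s * (t - s)| <= K * `|t - s| ^+ 2.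
Proof.
move=> A0 K0 fdf HK sAB tAB.
have [x [xAB xs _ ->]] := MVT_pos A0 fdf sAB tAB.
rewrite -mulrBl normrM expr2 mulrA ler_wpM2r//.
by rewrite (le_trans (HK _ _ xAB sAB))// ler_wpM2l.
Qed.

End HalfLine.

(** * Passing asymptotics through differentiation and integration *)

Section MonotoneDensity.
Context {R : realType} (r : R) (ell : R -> R).
Hypotheses (r_gt1 : 1 < r) (ell_sv : slowly_varying ell).
Implicit Types (a s t : R) (q H h G : R -> R).
Local Notation scale := (scale r ell).
Local Notation scaled := (scaled r ell).

Let r_gt0 : 0 < r. Proof. by rewrite (lt_trans _ r_gt1). Qed.
Let rX_gt0 n : 0 < r ^+ n. Proof. by rewrite exprn_gt0. Qed.
Let rX_neq0 n : r ^+ n != 0. Proof. by rewrite gt_eqF. Qed.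

Lemma asymp0_scaled a H q s : logper r q ->
  asymp0 H (fun s => s `^ a * ell s^-1 * q s) -> 0 < s ->
  scaled a H n s @[n --> \oo] --> s `^ a * q s.
Proof. by move=> qr Hq s0; apply: unif_scaledW (asymp0_unif_scaled _ _ qr Hq) s0. Qed.

Lemma asymp0_unique a H q1 q2 : logper r q1 -> logper r q2 ->
  asymp0 H (fun s => s `^ a * ell s^-1 * q1 s) ->
  asymp0 H (fun s => s `^ a * ell s^-1 * q2 s) -> eq_pos q1 q2.
Proof.
move=> r1 r2 H1 H2 s s0.
have K1 := asymp0_scaled r1 H1 s0; have K2 := asymp0_scaled r2 H2 s0.
have : s `^ a * q1 s = s `^ a * q2 s.
  by have/cvg_lim <- // := K1; exact/cvg_lim.
by apply: mulfI; rewrite gt_eqF ?powR_gt0.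
Qed.

Lemma is_derive_scaled a H h n s : (forall s : R, 0 < s -> is_derive s 1 H (h s)) ->
  0 < s -> is_derive s 1 (scaled a H n) (scaled (a - 1) h n s).
Proof.
move=> Hh s0; rewrite /scaled scaleB1//.
have sn0 : 0 < s / r ^+ n by rewrite divr_gt0.
have D1 : is_derive s 1 (fun s => s / r ^+ n) (r ^+ n)^-1.
  have -> : (fun s : R => s / r ^+ n) = (r ^+ n)^-1 *: id.
    by apply/funext => x; rewrite /GRing.scale/= mulrC.
  by apply: is_derive_eq; rewrite /GRing.scale/= mulr1.
have D2 := @is_derive1_comp _ H (fun s => s / r ^+ n) s _ _ (Hh _ sn0) D1.
have -> : (fun s : R => H (s / r ^+ n) / scale a n) =
    (scale a n)^-1 *: (H \o (fun s => s / r ^+ n)).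
  by apply/funext => x; rewrite /GRing.scale/= mulrC.
apply: is_derive_eq; rewrite /GRing.scale/=.
by field; rewrite rX_neq0 gt_eqF ?scale_gt0.
Qed.

Section Derivative.
Variables (a C : R) (H h h2 q : R -> R).
Hypotheses (Hh : forall s : R, 0 < s -> is_derive s 1 H (h s))
  (hh2 : forall s : R, 0 < s -> is_derive s 1 h (h2 s))
  (h_ge0 : forall s : R, 0 < s -> 0 <= h s)
  (h2_le : forall s : R, 0 < s -> s ^+ 2 * `|h2 s| <= C * H s)
  (qr : logper r q) (Hq : asymp0 H (fun s => s `^ a * ell s^-1 * q s)).

(** The bound [h2_le] is scale invariant: [x^2] times the rescaled second derivative is at most [C]
    times [scaled a H], and the latter is bounded on [[A, B]] from some [N] on by locally uniform
    convergence. *)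
Lemma scaled_derive_lip (A B : R) : 0 < A -> exists (K : R) N, 0 <= K /\
  forall n s t, (N <= n)%N -> A <= s <= B -> A <= t <= B ->
  `|scaled (a - 1) h n s - scaled (a - 1) h n t| <= K * `|s - t|.
Proof.
move=> A0.
have [k [K [k0 K0 HK]]] := logper_itv_bounds a B r_gt1 qr A0.
have [N HN] := asymp0_unif_scaled r_gt1 ell_sv qr Hq B A0 ltr01.
exists (`|C| * (K + 1) / A ^+ 2), N; split.
  by rewrite divr_ge0 ?sqr_ge0// mulr_ge0// addr_ge0// ltW.
move=> n s t Nn sAB tAB.
have [x [xAB _ _ ->]] := MVT_pos A0 (is_derive_scaled (a - 1) n ^~ hh2) tAB sAB.
rewrite normrM ler_wpM2r//.
have x0 : 0 < x by rewrite (lt_le_trans A0)//; case/andP: xAB.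
have /andP[Ax xB] := xAB.
have c0 : 0 < scale a n by rewrite scale_gt0.
have HK' : `|scaled a H n x| <= K + 1.
  have /andP[kx xK] := HK x xAB; have := HN n x Nn xAB.
  by rewrite ler_norml ltr_norml => /andP[? ?]; apply/andP; split; lra.
rewrite ler_pdivlMr ?exprn_gt0//.
apply: (@le_trans _ _ (C * scaled a H n x)).
  rewrite /scaled !scaleB1//.
  have := h2_le (divr_gt0 x0 (rX_gt0 n)).
  rewrite normrM [X in `|_| * X]gtr0_norm; last by rewrite invr_gt0; apply: mulr_gt0 => //; exact: mulr_gt0.
  move=> h2x; rewrite [leRHS]mulrA ler_pdivlMr//; apply: le_trans h2x.
  have -> : `|h2 (x / r ^+ n)| / (r ^+ n * (r ^+ n * scale a n)) * A ^+ 2 * scale a n =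
    A ^+ 2 / (r ^+ n) ^+ 2 * `|h2 (x / r ^+ n)|.
    by field; rewrite rX_neq0 gt_eqF.
  rewrite expr_div_n.
  rewrite ler_wpM2r// ler_pM2r ?invr_gt0 ?exprn_gt0//.
  by rewrite lerXn2r ?nnegrE// ltW.
by rewrite (le_trans (ler_norm _))// normrM ler_wpM2l.
Qed.

(** The difference quotient of [scaled a H n] with a fixed step [d] converges to [W], and it stays
    within [K d] of the derivative uniformly in [n]. The derivatives thus end up arbitrarily close
    to fixed numbers, which is the Cauchy criterion. *)
Lemma scaled_derive_cvg s : 0 < s -> cvgn (fun n => scaled (a - 1) h n s).
Proof.
move=> s0.
have [K [N [K0 HK]]] := scaled_derive_lip (s + s) s0.
apply/cauchy_cvgP/cauchy_exP => e e0.
(* [d <= s] keeps [s + d] in the interval [[s, s + s]] of the Lipschitz bound, and the other term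
   makes [K d <= e / 2]. *)
pose d := Num.min s (e / (2 * (K + 1))).
have K10 : 0 < 2 * (K + 1) by rewrite mulr_gt0// ltr_wpDl.
have d0 : 0 < d by rewrite lt_min s0 divr_gt0.
have ds : d <= s by rewrite ge_min lexx.
have dK : d * (2 * (K + 1)) <= e by rewrite -ler_pdivlMr// ge_min lexx orbT.
have sd0 : 0 < s + d by rewrite addr_gt0.
pose w n := (scaled a H n (s + d) - scaled a H n s) / d.
pose W := ((s + d) `^ a * q (s + d) - s `^ a * q s) / d.
have wW : w n @[n --> \oo] --> W.
  apply: cvgM; last exact: cvg_cst.
  by apply: cvgB; exact: asymp0_scaled.
exists W.
have e20 : 0 < e / 2 by rewrite divr_gt0.
have /cvgrPdist_lt/(_ _ e20)[M _ HM] := wW.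
exists (maxn M N) => // n /=; rewrite geq_max => /andP[Mn Nn].
rewrite /ball/=.
have := quadratic_remainder s0 K0 (is_derive_scaled a n ^~ Hh)
  (fun s t => HK n s t Nn) (s := s) (t := s + d).
rewrite lexx lerDl (ltW s0) lerDl (ltW d0) lerD2l ds => /(_ isT isT).
rewrite [s + d - s]addrC addKr (gtr0_norm d0) => Hr.
have Hr' : `|w n - scaled (a - 1) h n s| <= K * d.
  have -> : w n - scaled (a - 1) h n s =
     (scaled a H n (s + d) - scaled a H n s - scaled (a - 1) h n s * d) / d.
    by rewrite /w; field; rewrite gt_eqF.
  rewrite normrM normfV (gtr0_norm d0) ler_pdivrMr//.
  by rewrite (le_trans Hr)// expr2 mulrA.
have := HM n Mn; rewrite /= => HW.
rewrite (_ : W - _ = (W - w n) + (w n - scaled (a - 1) h n s)); last by ring.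
rewrite (le_lt_trans (ler_normD _ _))// [ltRHS]splitr ltr_leD// (le_trans Hr')//.
by move: dK; nra.
Qed.

Definition scaled_derive_lim s := limn (fun n => scaled (a - 1) h n s).
Local Notation D := scaled_derive_lim.

Lemma scaled_derive_limP s : 0 < s -> scaled (a - 1) h n s @[n --> \oo] --> D s.
Proof. by move/scaled_derive_cvg. Qed.

Lemma scaled_derive_lim_lip (A B : R) : 0 < A -> exists K : R, 0 <= K /\
  forall s t, A <= s <= B -> A <= t <= B -> `|D s - D t| <= K * `|s - t|.
Proof.
move=> A0; have [K [N [K0 HK]]] := scaled_derive_lip (B) A0.
exists K; split => // s t sAB tAB.
have s0 : 0 < s by case/andP: sAB => /(lt_le_trans A0).
have t0 : 0 < t by case/andP: tAB => /(lt_le_trans A0).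
have /cvgr_to_le : (fun n => `|scaled (a - 1) h n s - scaled (a - 1) h n t|) @ \oo --> `|D s - D t|.
  by apply: cvg_norm; apply: cvgB; exact: scaled_derive_limP.
by apply; exists N => // n /= Nn; exact: HK.
Qed.

Lemma is_derive_scaled_lim s : 0 < s ->
  is_derive s 1 (fun s => s `^ a * q s) (D s).
Proof.
move=> s0; have s20 : 0 < s / 2 by rewrite divr_gt0.
have [K [N [K0 HK]]] := scaled_derive_lip (s + s / 2) s20.
apply: (@quad_is_derive _ _ _ K (s / 2)) => // t ts.
have tAB : s / 2 <= t <= s + s / 2.
  by move: ts; rewrite ler_norml => /andP[? ?]; apply/andP; split; lra.
have sAB : s / 2 <= s <= s + s / 2 by apply/andP; split; lra.
have t0 : 0 < t by case/andP: tAB => /(lt_le_trans s20).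
have /cvgr_to_le : (fun n => `|scaled a H n t - scaled a H n s - scaled (a - 1) h n s * (t - s)|) @ \oo -->
   `|t `^ a * q t - s `^ a * q s - D s * (t - s)|.
  apply: cvg_norm; apply: cvgB.
    by apply: cvgB; exact: asymp0_scaled.
  by apply: cvgM; [exact: scaled_derive_limP|exact: cvg_cst].
apply; exists N => // n /= Nn.
exact: quadratic_remainder s20 K0 (is_derive_scaled a n ^~ Hh) (fun s t => HK n s t Nn) sAB tAB.
Qed.

Hypotheses (a_gt0 : 0 < a)
  (h_mono : (forall s t : R, 0 < s -> s <= t -> h s <= h t) \/
            (forall s t : R, 0 < s -> s <= t -> h t <= h s)).

Lemma scaled_derive_lim_ge0 s : 0 < s -> 0 <= D s.
Proof.
move=> s0; have /cvgr_to_ge := scaled_derive_limP s0; apply.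
near=> n; rewrite /scaled divr_ge0 ?h_ge0 ?divr_ge0 ?(ltW s0)//.
  by rewrite divr_gt0.
by rewrite ltW// scale_gt0.
Unshelve. all: by end_near. Qed.

(** If [D] vanished at [s], monotonicity of [h] would make it vanish on the period to the left of
    [s] (nondecreasing case) or to the right (nonincreasing case). Then [x^a q(x)] would take equal
    values at both ends of that period, where [q] agrees but [x^a] does not because [a > 0]. *)
Lemma scaled_derive_lim_gt0 s : 0 < s -> 0 < D s.
Proof.
move=> s0; rewrite lt_neqAle scaled_derive_lim_ge0// andbT eq_sym.
apply/negP => /eqP Ds.
have [q0 _ _ _ qper] := qr.
have cntr x : 0 < x -> (forall t, x <= t <= x * r -> D t = 0) -> False.
  move=> x0 D0.
  have xr : x <= x <= x * r by rewrite lexx ler_peMr// ltW.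
  have xr' : x <= x * r <= x * r by rewrite lexx andbT; case/andP: xr.
  have [y [yx _ _]] := MVT_pos x0 is_derive_scaled_lim xr xr'.
  rewrite (D0 y yx) mul0r => /eqP; rewrite subr_eq0 qper// => /eqP.
  move/(mulIf (_ : q x != 0)); rewrite gt_eqF ?q0// => /(_ isT) /eqP.
  by rewrite gt_eqF// gt0_ltr_powR ?nnegrE ?ltW// ?ltr_pMr// ?mulr_gt0.
have Dle x y : 0 < x -> 0 < y -> (forall n, scaled (a - 1) h n x <= scaled (a - 1) h n y) -> D x <= D y.
  move=> x0 y0 xy; apply: ler_lim; [exact: scaled_derive_cvg|exact: scaled_derive_cvg|exact: nearW].
have sc0 n : 0 < scale (a - 1) n by rewrite scale_gt0.
case: h_mono => hm.
  have sr0 : 0 < s / r by rewrite divr_gt0.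
  apply: (cntr _ sr0) => t /andP[st]; rewrite divfK ?gt_eqF// => ts.
  have t0 : 0 < t by rewrite (lt_le_trans _ st)// divr_gt0.
  apply/eqP; rewrite eq_le scaled_derive_lim_ge0// andbT -Ds.
  apply: Dle => // n; rewrite /scaled ler_pM2r ?invr_gt0// hm ?divr_gt0//.
  by rewrite ler_pM2r ?invr_gt0.
apply: (cntr _ s0) => t /andP[st _].
have t0 : 0 < t by rewrite (lt_le_trans _ st).
apply/eqP; rewrite eq_le scaled_derive_lim_ge0// andbT -Ds.
apply: Dle => // n; rewrite /scaled ler_pM2r ?invr_gt0// hm ?divr_gt0//.
by rewrite ler_pM2r ?invr_gt0.
Qed.

(** The relation with [q] is the fundamental theorem of calculus for [x^a q(x)], whose derivative is
    [D] and whose value at [0+] is 0 since [q] is bounded and [a > 0]. *)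
Lemma asymp0_derive : exists q', [/\ logper r q',
  asymp0 h (fun s => s `^ (a - 1) * ell s^-1 * q' s) & eq_pos (opB a q') q].
Proof.
have [] := equilip_asymp0 r_gt1 ell_sv scaled_derive_lim_gt0 scaled_derive_limP scaled_derive_lip.
set q' := fun s => _; move=> q'r hq'; exists q'; split => // x x0.
rewrite /opB a_gt0 /Rintegral.
rewrite (_ : integral _ _ _ = (x `^ a * q x - 0)%:E); last first.
  rewrite (_ : integral _ _ _ = (\int[lebesgue_measure]_(y in `]0%R, x]) (D y)%:E)%E); last first.
    apply: eq_integral => y; rewrite inE/= in_itv/= => /andP[y0 _].
    by rewrite /q' mulrA -powRD ?(gt_eqF y0) ?implybT// subrr powRr0 mul1r.
  apply: (@integral_FTC_left _ (fun s => s `^ a * q s) D x 0) => //.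
  - exact: is_derive_scaled_lim.
  - by move=> y /scaled_derive_lim_gt0/ltW.
  - by apply: locally_lipschitz_continuous => A B A0; exact: scaled_derive_lim_lip.
  - have [k [K [k0 K0 HK]]] := logper_bounds r_gt1 qr.
    apply: (@squeeze_cvgr _ _ _ _ (fun=> 0) (fun y => y `^ a * K)).
    + near=> y; have y0 : 0 < y by near: y; exact: nbhs_right_gt.
      have /andP[ky yK] := HK y y0.
      by rewrite mulr_ge0 ?powR_ge0 ?(le_trans (ltW k0))//= ler_wpM2l ?powR_ge0.
    + exact: cvg_cst.
    + by rewrite -[X in _ --> X](mul0r K); apply: cvgM; [exact: powR_cvg0|exact: cvg_cst].
rewrite subr0/= mulrA -powRD ?(gt_eqF x0) ?implybT//.
by rewrite addNr powRr0 mul1r.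
Unshelve. all: by end_near. Qed.

End Derivative.
End MonotoneDensity.

(** * Sequences with convergent ratios: Potter bounds and the Stolz-Cesaro theorem *)

Section RatioSequences.
Context {R : realType}.
Implicit Types (c S : nat -> R) (rho theta J : R).

(* A discrete form of Potter's bounds. *)
Lemma ratio_bound c rho theta : (forall n, 0 < c n) ->
  c n.+1 / c n @[n --> \oo] --> rho -> rho < theta -> 0 < theta ->
  exists2 C : R, 0 < C & forall n k, c (n + k)%N <= C * theta ^+ k * c n.
Proof.
move=> c0 crho rt t0.
pose d n := c n / theta ^+ n.
have d0 n : 0 < d n by rewrite divr_gt0 ?exprn_gt0.
have [N _ HN] := cvgr_lt _ crho _ rt.
have dN n : (N <= n)%N -> d n.+1 <= d n.
  move=> Nn; have /= := HN n Nn; rewrite ltr_pdivrMr// => /ltW cc.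
  rewrite /d ler_pdivrMr ?exprn_gt0// exprS [theta * _]mulrC mulrA.
  by rewrite divfK ?gt_eqF ?exprn_gt0// mulrC.
have dNk n k : (N <= n)%N -> d (n + k)%N <= d n.
  move=> Nn; elim: k => [|k IH]; first by rewrite addn0.
  by rewrite addnS (le_trans _ IH)// dN// (leq_trans Nn)// leq_addr.
(* Sums over the indices up to [N] stand in for maxima: [M] bounds every [d n], as [d] decreases
   from [N] on, and [m] bounds the inverses of the first terms. *)
pose M := \sum_(i < N.+1) d i; pose m := \sum_(i < N.+1) (d i)^-1.
have M0 : 0 < M.
  by rewrite /M big_ord_recl ltr_wpDr// sumr_ge0// => i _; exact: ltW.
have dM n : d n <= M.
  wlog nN : n / (n <= N)%N.
    move=> H; have [nN|/ltnW Nn] := leqP n N; first exact: H.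
    by rewrite (le_trans _ (H N (leqnn N)))// -(subnKC Nn) dNk.
  rewrite /M (bigD1 (Ordinal (nN : (n < N.+1)%N)))//= lerDl sumr_ge0// => i _.
  exact: ltW.
have dm n : (n <= N)%N -> (d n)^-1 <= m.
  move=> nN; rewrite /m (bigD1 (Ordinal (nN : (n < N.+1)%N)))//= lerDl sumr_ge0// => i _.
  by rewrite invr_ge0 ltW.
have m0 : 0 < m by rewrite (lt_le_trans _ (dm 0%N _))// invr_gt0.
have C1 : 1 <= 1 + M * m by rewrite lerDl mulr_ge0// ltW.
exists (1 + M * m) => [|n k]; first exact: lt_le_trans ltr01 C1.
suff H : d (n + k)%N <= (1 + M * m) * d n.
  move: H; rewrite {1}/d ler_pdivrMr ?exprn_gt0// => H; rewrite (le_trans H)//.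
  rewrite /d exprD le_eqVlt; apply/orP; left; apply/eqP.
  by field; rewrite gt_eqF ?exprn_gt0.
have [Nn|/ltnW nN] := leqP N n.
  by rewrite (le_trans (dNk n k Nn))// ler_peMl// ltW.
rewrite (le_trans (dM _))// mulrDl mul1r ler_wpDl ?(ltW (d0 _))//.
rewrite -mulrA -[leLHS]mulr1 ler_pM2l//.
by rewrite -(@mulVf _ (d n)) ?gt_eqF// ler_pM2r// dm.
Qed.

Lemma ratio_cvg0 c rho : (forall n, 0 < c n) ->
  c n.+1 / c n @[n --> \oo] --> rho -> rho < 1 -> c @ \oo --> 0.
Proof.
move=> c0 crho r1.
pose theta := (Num.max rho 0 + 1) / 2.
have m1 : Num.max rho 0 < 1 by rewrite gt_max r1 ltr01.
have rm : rho <= Num.max rho 0 by rewrite le_max lexx.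
have om : 0 <= Num.max rho 0 by rewrite le_max lexx orbT.
have rt : rho < theta by rewrite /theta; lra.
have t0 : 0 < theta by rewrite /theta; lra.
have t1 : theta < 1 by rewrite /theta; lra.
have [C C0 HC] := ratio_bound c0 crho rt t0.
apply: (@squeeze_cvgr _ _ _ _ (fun=> 0) (fun n => C * theta ^+ n * c 0%N)).
- by near=> n; rewrite ltW//= -[n in X in X <= _]add0n HC.
- exact: cvg_cst.
- rewrite -[X in _ --> X](mul0r (c 0%N)); apply: cvgM; last exact: cvg_cst.
  rewrite -[X in _ --> X](mulr0 C); apply: cvgM; first exact: cvg_cst.
  by apply: cvg_expr; rewrite gtr0_norm.
Unshelve. all: by end_near. Qed.

(** The 0/0 form. The ratio limit [rho < 1] makes [c] tend to 0 and gives [(c n - c n.+1) / c n] the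
    positive limit [1 - rho], the denominator of the result. *)
Lemma stolz c S rho J : (forall n, 0 < c n) ->
  c n.+1 / c n @[n --> \oo] --> rho -> rho < 1 -> S @ \oo --> 0 ->
  (S n - S n.+1) / c n @[n --> \oo] --> J ->
  S n / c n @[n --> \oo] --> J / (1 - rho).
Proof.
move=> c0 crho r1 S0 SJ; set L := J / (1 - rho).
have cc0 := ratio_cvg0 c0 crho r1.
have JE : J = L * (1 - rho) by rewrite /L divfK// subr_eq0 gt_eqF.
(* the sequence [e * c n - (S n - L * c n)] and its mirror image decrease to 0 *)
have key (u : nat -> R) : u @ \oo --> 0 -> (\forall n \near \oo, u n.+1 <= u n) ->
    \forall n \near \oo, 0 <= u n.
  move=> u0 [N _ HN]; exists N => // n /= Nn.
  have uk k : u (n + k)%N <= u n.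
    elim: k => [|k IH]; first by rewrite addn0.
    by rewrite addnS (le_trans _ IH)// HN//= (leq_trans Nn)// leq_addr.
  have uk0 : (fun k => u (n + k)%N) @ \oo --> 0.
    have -> : (fun k => u (n + k)%N) = [sequence u (k + n)%N]_k.
      by apply/funext => k /=; rewrite addnC.
    by rewrite cvg_shiftn.
  by have /cvgr_to_le := uk0; apply; exact: nearW.
have cvgT : (S n - S n.+1) / c n - L * (1 - c n.+1 / c n) @[n --> \oo] --> 0.
  rewrite -[X in _ --> X](subrr J) {2}JE; apply: cvgB => //.
  by apply: cvgM; [exact: cvg_cst|apply: cvgB; [exact: cvg_cst|exact: crho]].
apply/cvgrPdist_le => e e0.
have e1 : 0 < e * ((1 - rho) / 2) by rewrite mulr_gt0// divr_gt0// subr_gt0.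
have rho2 : rho < (1 + rho) / 2 by lra.
have Hc : \forall n \near \oo, e * ((1 - rho) / 2) <= e * (1 - c n.+1 / c n).
  near=> n; rewrite ler_pM2l//.
  have : c n.+1 / c n < (1 + rho) / 2 by near: n; exact: (cvgr_lt _ crho _ rho2).
  by lra.
move/cvgrPdist_le: cvgT => /(_ _ e1) HT.
have sgn (b : R) : `|b| <= 1 -> \forall n \near \oo, 0 <= e * c n - b * (S n - L * c n).
  move=> b1; apply: key.
    have E : e * 0 - b * (0 - L * 0) = 0 by ring.
    rewrite -[X in _ --> X]E; apply: cvgB; apply: cvgM => //; try exact: cvg_cst.
    by apply: cvgB => //; apply: cvgM => //; exact: cvg_cst.
  near=> n.
  have : `|0 - ((S n - S n.+1) / c n - L * (1 - c n.+1 / c n))| <= e * ((1 - rho) / 2) by near: n.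
  have : e * ((1 - rho) / 2) <= e * (1 - c n.+1 / c n) by near: n.
  rewrite sub0r normrN => H1 H2; have {H1}H2 := le_trans H2 H1.
  set w := (S n - S n.+1) / c n - L * (1 - c n.+1 / c n) in H2.
  have bw : b * w <= e * (1 - c n.+1 / c n).
    by rewrite (le_trans (ler_norm _))// normrM (le_trans _ H2)// ler_piMl.
  rewrite -subr_ge0.
  have -> : e * c n - b * (S n - L * c n) - (e * c n.+1 - b * (S n.+1 - L * c n.+1)) =
     (e * (1 - c n.+1 / c n) - b * w) * c n.
    by rewrite /w; field; rewrite gt_eqF.
  by rewrite mulr_ge0 ?subr_ge0// ltW.
near=> n.
have H1 : 0 <= e * c n - 1 * (S n - L * c n) by near: n; apply: sgn; rewrite normr1.
have H2 : 0 <= e * c n - (-1) * (S n - L * c n) by near: n; apply: sgn; rewrite normrN1.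
have -> : L - S n / c n = (L * c n - S n) / c n by field; rewrite gt_eqF.
rewrite normrM normfV (gtr0_norm (c0 n)) ler_pdivrMr// ler_norml.
by apply/andP; split; lra.
Unshelve. all: by end_near. Qed.

End RatioSequences.

Section Primitive.
Context {R : realType} (r : R) (ell : R -> R).
Hypotheses (r_gt1 : 1 < r) (ell_sv : slowly_varying ell).
Local Notation scale := (scale r ell).
Local Notation scaled := (scaled r ell).

Lemma asymp0_primitive (a : R) (H h q' : R -> R) : 0 < a ->
  (forall s : R, 0 < s -> is_derive s 1 H (h s)) ->
  H y @[y --> 0^'+] --> 0 -> logper r q' ->
  asymp0 h (fun s => s `^ (a - 1) * ell s^-1 * q' s) ->
  exists q, logper r q /\ asymp0 H (fun s => s `^ a * ell s^-1 * q s).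
Proof.
move=> a0 Hh H0 q'r hq'.
have r0 : 0 < r by rewrite (lt_trans _ r_gt1).
have rX n : 0 < r ^+ n by rewrite exprn_gt0.
pose D s := s `^ (a - 1) * q' s.
have hD := asymp0_unif_scaled r_gt1 ell_sv q'r hq'.
have c0 n : 0 < scale a n by rewrite scale_gt0.
have rho1 : r `^ (- a) < 1.
  rewrite powRN invf_lt1 ?powR_gt0// -[ltLHS](congr1 (@^~ a) (powR1 R)).
  by apply: gt0_ltr_powR; rewrite ?nnegrE ?ltW.
pose J n s := scaled a H n s - scaled a H n (s / r).
have HS (s : R) : 0 < s -> H (s / r ^+ n) @[n --> \oo] --> 0.
  move=> s0; move/cvg_at_rightP : H0; apply; split=> [n|]; first by rewrite divr_gt0.
  rewrite -[X in _ --> X](mulr0 s); apply: cvgM; first exact: cvg_cst.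
  have -> : (fun n => (r ^+ n)^-1) = (fun n => r^-1 ^+ n).
    by apply/funext => n; rewrite exprVn.
  by apply: cvg_expr; rewrite gtr0_norm ?invr_gt0// invf_lt1.
(* J n is uniformly close to [int_(s/r)^s D], which is bounded away from 0 *)
have HJ (s : R) : 0 < s -> exists2 l : R, 0 < l & J n s @[n --> \oo] --> l.
  move=> s0; have sr0 : 0 < s / r by rewrite divr_gt0.
  have srs : s / r <= s by rewrite ler_pdivrMr// ler_peMr// ltW.
  have ss : s / r <= s <= s by rewrite srs lexx.
  have sr : s / r <= s / r <= s by rewrite srs lexx.
  have [k [K [k0 K0 HK]]] := logper_itv_bounds (a - 1) s r_gt1 q'r sr0.
  have wsr : 0 < s - s / r by rewrite subr_gt0 ltr_pdivrMr// ltr_pMr.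
  (* The mean value theorem is applied to the difference of the rescaled functions of indices [N]
     and [n]: its derivative is small because both rescaled derivatives are close to [D]. *)
  have cJ : cvgn (fun n => J n s).
    apply/cauchy_cvgP/cauchy_exP => e e0.
    have e1 : 0 < e / (2 * (s - s / r)) by rewrite divr_gt0// mulr_gt0.
    have [N HN] := hD _ s _ sr0 e1.
    exists (J N s), N => // n /= Nn; rewrite /ball/= /J.
    have dF (y : R) : 0 < y -> is_derive y 1 (fun s => scaled a H N s - scaled a H n s)
        (scaled (a - 1) h N y - scaled (a - 1) h n y).
      by move=> y0; apply: is_deriveB; exact: is_derive_scaled.
    have [y [yx _ _ E]] := MVT_pos sr0 dF sr ss.
    rewrite (_ : _ - _ - _ = scaled a H N s - scaled a H n s -
       (scaled a H N (s / r) - scaled a H n (s / r))); last by ring.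
    rewrite E normrM [X in _ * X]gtr0_norm// -ltr_pdivlMr//.
    rewrite (_ : _ - _ = (scaled (a - 1) h N y - D y) - (scaled (a - 1) h n y - D y)); last by ring.
    rewrite (le_lt_trans (ler_normB _ _))//.
    have -> : e / (s - s / r) = e / (2 * (s - s / r)) + e / (2 * (s - s / r)).
      by move: wsr; set w := s - s / r => w0; field; rewrite gt_eqF.
    by rewrite ltrD// HN.
  exists (limn (fun n => J n s)) => //.
  apply: (@lt_le_trans _ _ (k / 2 * (s - s / r))); first by rewrite mulr_gt0// divr_gt0.
  have [N HN] := hD _ s _ sr0 (divr_gt0 k0 (ltr0n _ 2)).
  apply: limr_ge => //; exists N => // n /= Nn; rewrite /J.
  have [y [yx _ _ ->]] := MVT_pos sr0 (is_derive_scaled r_gt1 ell_sv a n ^~ Hh) sr ss.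
  rewrite ler_pM2r//; have /andP[ky _] := HK y yx; have := HN n y Nn yx.
  by rewrite ltr_norml => /andP[+ _]; rewrite -/(D y) in ky *; lra.
have HG (s : R) : 0 < s -> exists2 l : R, 0 < l & scaled a H n s @[n --> \oo] --> l.
  move=> s0; have [l l0 Jl] := HJ s s0.
  exists (l / (1 - r `^ (- a))); first by rewrite divr_gt0// subr_gt0.
  apply: (@stolz _ (scale a) (fun n => H (s / r ^+ n))) => //.
  - exact: scale_ratio.
  - exact: HS.
  - rewrite (_ : (fun n => _) = (fun n => J n s)); first exact: Jl.
    by apply/funext => n; rewrite /J /scaled mulrBl exprS [(r * _)^-1]invfM [s * (_ * _)]mulrA.
have /choice[G HGG] : forall s : R, exists l : R, 0 < s -> 0 < l /\ scaled a H n s @[n --> \oo] --> l.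
  move=> s; have [s0|s0] := ltP 0 s; last by exists 0.
  by have [l l0 Hl] := HG s s0; exists l.
have [] := equilip_asymp0 r_gt1 ell_sv (a := a) (H := H) (G := G).
- by move=> s /HGG[].
- by move=> s /HGG[].
- move=> A B A0.
  have [k [K [k0 K0 HK]]] := logper_itv_bounds (a - 1) B r_gt1 q'r A0.
  have [N HN] := hD _ B _ A0 ltr01.
  exists (K + 1), N; split; first by rewrite addr_ge0// ltW.
  move=> n s t Nn sAB tAB.
  have [y [yx _ _ ->]] := MVT_pos A0 (is_derive_scaled r_gt1 ell_sv a n ^~ Hh) tAB sAB.
  rewrite normrM ler_wpM2r//; have /andP[ky yK] := HK y yx; have := HN n y Nn yx.
  by rewrite ltr_norml ler_norml => /andP[? ?]; apply/andP; split; lra.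
by set q := fun s => _; exists q.
Qed.

End Primitive.

(** * Remainders of the exponential series *)

Section ExpRemainder.
Context {R : realType}.
Implicit Types (x : R) (k : nat).

(* [(-1)^k] times the remainder of order [k] of the Taylor series of [exp (- x)] at 0; the
   derivative of [psi k.+1] is [psi k]. *)
Fixpoint psi k x : R :=
  if k is k'.+1 then x ^+ k' / k'`!%:R - psi k' x else expR (- x).

Lemma is_derive_monomial k x :
  is_derive x 1 (fun x => x ^+ k.+1 / k.+1`!%:R) (x ^+ k / k`!%:R).
Proof.
have -> : (fun x : R => x ^+ k.+1 / k.+1`!%:R) = (k.+1`!%:R)^-1 *: (id ^+ k.+1).
  by apply/funext => y; rewrite /GRing.scale/= mulrC fctE.
apply: is_derive_eq; rewrite /GRing.scale/= mulr1 factS natrM.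
by rewrite invfM mulrACA mulVf ?pnatr_eq0// mul1r mulrC.
Qed.

Lemma is_derive_expN x : is_derive x 1 (fun x => expR (- x)) (- expR (- x)).
Proof.
have D : is_derive x 1 (fun x : R => - x) (- 1) by exact: is_deriveN.
by have := is_derive1_comp (is_derive_expR (- x)) D; rewrite mulrN1.
Qed.

Lemma is_derive_psi k x : is_derive x 1 (psi k.+1) (psi k x).
Proof.
elim: k x => [|k IH] x.
  have -> : psi 1 = cst 1 - (fun x => expR (- x)).
    by apply/funext => y; rewrite /= expr0 fact0 divr1.
  by have D := is_derive_expN x; apply: is_derive_eq; rewrite sub0r opprK.
have -> : psi k.+2 = (fun x => x ^+ k.+1 / k.+1`!%:R) - psi k.+1 by [].
by have D := is_derive_monomial k x; have D' := IH x; apply: is_derive_eq.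
Qed.

Lemma psi0 k : psi k.+1 0 = 0.
Proof.
elim: k => [|k IH]; first by rewrite /= oppr0 expR0 fact0 expr0 divr1 subrr.
by rewrite -[LHS]/(0 ^+ k.+1 / _ - psi k.+1 0) IH expr0n mul0r subr0.
Qed.

Lemma nondecreasing_derive_ge0 (f df : R -> R) : (forall x, is_derive x 1 f (df x)) ->
  (forall x, 0 <= x -> 0 <= df x) -> forall x y, 0 <= x -> x <= y -> f x <= f y.
Proof.
move=> fdf df0 x y x0 xy; rewrite -subr_ge0.
have [|z zxy ->] := MVT_segment xy (fun z _ => fdf z).
  apply: continuous_subspaceT => z; apply/differentiable_continuous/derivable1_diffP.
  by have [] := fdf z.
move: zxy; rewrite in_itv/= => /andP[xz _].
by rewrite mulr_ge0 ?subr_ge0// df0// (le_trans x0).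
Qed.

Lemma psi_ge0 k x : 0 <= x -> 0 <= psi k x.
Proof.
elim: k x => [|k IH] x x0; first exact: expR_ge0.
by rewrite -(psi0 k); apply: nondecreasing_derive_ge0 (is_derive_psi k) IH _ _ _ _.
Qed.

Lemma psi_nd k x y : 0 <= x -> x <= y -> psi k.+1 x <= psi k.+1 y.
Proof. exact: nondecreasing_derive_ge0 (is_derive_psi k) (@psi_ge0 k) _ _. Qed.

Lemma psi_le k x : 0 <= x -> psi k.+1 x <= x ^+ k.
Proof.
move=> x0; rewrite /= (@le_trans _ _ (x ^+ k / k`!%:R))//.
  by rewrite gerBl psi_ge0.
rewrite ler_pdivrMr ?ltr0n ?fact_gt0// ler_peMr ?exprn_ge0//.
by rewrite ler1n fact_gt0.
Qed.

(** The difference of the two sides at order [k.+1] vanishes at 0 and has the difference at order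
    [k] as derivative; the base case is [(1 + x) exp (- x) <= 1]. *)
Lemma psi_deriv_le k x : 0 <= x -> x * psi k x <= k.+1%:R * psi k.+1 x.
Proof.
move=> x0; rewrite -subr_ge0.
elim: k x x0 => [|k IH] x x0.
  have : (1 + x) * expR (- x) <= 1.
    by rewrite -[leRHS](expRxMexpNx_1 x) ler_pM2r ?expR_gt0// expR_ge1Dx.
  by rewrite /= expr0 fact0 divr1; lra.
have D (y : R) : is_derive y 1 (fun x => k.+2%:R * psi k.+2 x - x * psi k.+1 x)
    (k.+1%:R * psi k.+1 y - y * psi k y).
  have -> : (fun x : R => k.+2%:R * psi k.+2 x - x * psi k.+1 x) =
    k.+2%:R *: psi k.+2 - (id * psi k.+1) by [].
  have D1 := is_derive_psi k.+1 y; have D2 := is_derive_psi k y.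
  apply: is_derive_eq; rewrite /GRing.scale/= mulr1.
  by rewrite -[k.+2%:R]natr1; ring.
have := nondecreasing_derive_ge0 D IH (lexx 0) x0.
by rewrite /= mul0r subr0 -/(psi k.+2 0) => H; apply: le_trans H; rewrite -[X in _ * X]/(psi k.+2 0) psi0 mulr0.
Qed.

(** With [u = exp (- x / 2)], the case [k = 0] of [psi_deriv_le] at [x / 2] reads
    [(x / 2) u <= 1 - u]; squaring gives at most [(1 - u)^2 <= 1 - u^2], and the two halvings of [x]
    give the factor 4. *)
Lemma sqr_expN_le x : 0 <= x -> x ^+ 2 * expR (- x) <= 4 * psi 1 x.
Proof.
move=> x0; rewrite /= expr0 fact0 divr1.
have x20 : 0 <= x / 2 by rewrite divr_ge0.
have := psi_deriv_le 0 x20; rewrite /= expr0 fact0 divr1 mul1r.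
have -> : expR (- x) = expR (- (x / 2)) ^+ 2.
  by rewrite expr2 -expRD -opprD -splitr.
set u := expR _ => xu.
have u0 : 0 < u := expR_gt0 _.
have xu0 : 0 <= x / 2 * u by rewrite mulr_ge0// ltW.
have -> : x ^+ 2 * u ^+ 2 = 4 * (x / 2 * u) ^+ 2 by field.
rewrite ler_pM2l//.
have : (x / 2 * u) ^+ 2 <= (1 - u) ^+ 2 by rewrite lerXn2r ?nnegrE// (le_trans xu0).
by nra.
Qed.

(** Half of the exponent absorbs the power, by [y^k <= k! exp y] at [y = u x / 2]; the other half
    remains as an integrable majorant. *)
Lemma expr_expN_le k (u x : R) : 0 < u -> 0 <= x ->
  x ^+ k * expR (- (u * x)) <= (k`!%:R / (u / 2) ^+ k) * expR (- (u / 2 * x)).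
Proof.
move=> u0 x0.
have -> : expR (- (u * x)) = expR (- (u / 2 * x)) * expR (- (u / 2 * x)).
  by rewrite -expRD -opprD -mulrDl -splitr.
rewrite mulrA ler_pM2r ?expR_gt0// expRN ler_pdivrMr ?expR_gt0//.
have ux : 0 <= u / 2 * x by rewrite mulr_ge0// divr_ge0// ltW.
have H : (u / 2 * x) ^+ k <= k`!%:R * expR (u / 2 * x).
  case: k => [|k].
    by rewrite expr0 fact0 mul1r (le_trans _ (expR_ge1Dx _))// lerDl.
  rewrite [leRHS]mulrC -ler_pdivrMr ?ltr0n ?fact_gt0//.
  by rewrite (le_trans _ (expR_ge1Dxn k ux))// lerDr.
rewrite exprMn in H.
by rewrite mulrAC ler_pdivlMr ?exprn_gt0 ?divr_gt0// mulrC.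
Qed.

End ExpRemainder.

(** * Laplace integrals *)

Section DerivativeUnderIntegral.
Context {R : realType} d (T : measurableType d) (mu : {measure set T -> \bar R}).

(** Domination is asked on the windows [u < s < 3 u]; [u = s / 2] puts [s] in the middle of one that
    stays away from 0. *)
Lemma is_derive_Rintegral (D : set T) (K K' : R -> T -> R) : measurable D ->
  (forall s : R, 0 < s -> mu.-integrable D (EFin \o K s)) ->
  (forall (s : R) x, 0 < s -> D x -> is_derive s 1 (K^~ x) (K' s x)) ->
  (forall u : R, 0 < u -> exists2 G : T -> R, mu.-integrable D (EFin \o G) &
    forall (s : R) x, u < s -> s < u * 3 -> D x -> `|K' s x| <= G x) ->
  forall s : R, 0 < s ->
  is_derive s 1 (fun s => \int[mu]_(x in D) K s x) (\int[mu]_(x in D) K' s x).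
Proof.
move=> mD intK dK domK s s0.
have s20 : 0 < s / 2 by rewrite divr_gt0.
have [G intG HG] := domK _ s20.
have Is : (`](s / 2), (s / 2 * 3)[ : set R)%classic s.
  by rewrite /= in_itv/=; apply/andP; split; lra.
have I0 x : (`](s / 2), (s / 2 * 3)[ : set R)%classic x -> 0 < x.
  by rewrite /= in_itv/= => /andP[/(lt_trans s20)].
have intK' x : (`](s / 2), (s / 2 * 3)[ : set R)%classic x -> mu.-integrable D (EFin \o K x).
  by move=> /I0; exact: intK.
have derK x y : (`](s / 2), (s / 2 * 3)[ : set R)%classic x -> D y -> derivable (K^~ y) x 1.
  by move=> /I0 x0 Dy; have [] := dK x y x0 Dy.
have dE x y : 0 < x -> D y -> partial1of2 K x y = K' x y.
  move=> x0 Dy; rewrite /partial1of2 derive1E; have H := dK x y x0 Dy; exact: derive_val.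
have G'0 y : 0 <= `|G y| by [].
have intG' : mu.-integrable D (EFin \o (fun y => `|G y|)).
  by have := integrable_abse intG.
have domG x y : (`](s / 2), (s / 2 * 3)[ : set R)%classic x -> D y -> `|partial1of2 K x y| <= `|G y|.
  move=> Ix Dy; rewrite dE ?I0// (le_trans _ (ler_norm _))//.
  by move: Ix; rewrite /= in_itv/= => /andP[? ?]; exact: HG.
apply: DeriveDef.
  by have := derivable_under_integral mD Is intK' derK G'0 intG' domG.
rewrite -derive1E (differentiation_under_integral mD Is intK' derK G'0 intG' domG).
by apply: eq_Rintegral => y; rewrite inE => Dy; rewrite dE.
Qed.

End DerivativeUnderIntegral.

Lemma derive1n_chain (R : realType) (F : nat -> R -> R) (N : nat) (f : R -> R) :
  (forall n (s : R), (n < N)%N -> 0 < s -> is_derive s 1 (F n) (F n.+1 s)) ->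
  (forall s : R, 0 < s -> f s = F 0%N s) ->
  forall n (s : R), (n <= N)%N -> 0 < s -> derive1n n f s = F n s.
Proof.
move=> FF fF; elim=> [|n IH] s nN s0; first exact: fF.
rewrite derive1nS derive1E.
have H := FF n s nN s0; rewrite -(@derive_val _ _ _ _ _ _ _ H).
apply: near_eq_derive; near=> t; apply: IH; first exact: ltnW.
by near: t; apply: lt_nbhsr.
Unshelve. all: by end_near. Qed.

Section LaplaceIntegral.
Context {R : realType}.
Implicit Types (s t u : R).
Context d (T : measurableType d) (mu : {measure set T -> \bar R}).
Variables (D : set T) (Y : T -> R).
Hypotheses (mD : measurable D) (mY : measurable_fun D Y)
  (Y0 : forall x, D x -> 0 <= Y x)
  (intE : forall s : R, 0 < s -> mu.-integrable D (fun x => (expR (- (s * Y x)))%:E)).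

(** Up to sign, the derivative of order [k] of the Laplace transform of [Y]. The measure is kept
    general, with integrability of the exponentials as hypothesis, because the same lemmas serve an
    infinite Stieltjes measure with [Y = id]. *)
Definition lap k s := \int[mu]_(x in D) (Y x ^+ k * expR (- (s * Y x))).

Lemma measurable_expN s : measurable_fun D (fun x => expR (- (s * Y x))).
Proof.
apply: measurableT_comp => //; apply: measurableT_comp => //.
by apply: measurable_funM => //; exact: measurable_cst.
Qed.

Lemma measurable_lap_kernel k s : measurable_fun D (fun x => Y x ^+ k * expR (- (s * Y x))).
Proof. by apply: measurable_funM; [exact: measurable_funX|exact: measurable_expN]. Qed.

Lemma lap_integrable k s : 0 < s ->
  mu.-integrable D (EFin \o (fun x => Y x ^+ k * expR (- (s * Y x)))).
Proof.
move=> s0; have s20 : 0 < s / 2 by rewrite divr_gt0.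
pose C := k`!%:R / (s / 2) ^+ k.
apply: (@le_integrable _ _ _ _ _ mD _ (fun x => C%:E * (expR (- (s / 2 * Y x)))%:E)%E).
- exact/measurable_EFinP/measurable_lap_kernel.
- move=> x Dx; have y0 := Y0 Dx.
  have H1 : 0 <= Y x ^+ k * expR (- (s * Y x)) by rewrite mulr_ge0 ?exprn_ge0 ?expR_ge0.
  rewrite -EFinM !abse_EFin lee_fin (ger0_norm H1) (le_trans _ (ler_norm _))//.
  exact: expr_expN_le.
- by apply: integrableZl => //; exact: intE.
Qed.

Lemma is_derive_lap k s : 0 < s -> is_derive s 1 (lap k) (- lap k.+1 s).
Proof.
move=> s0; rewrite /lap.
have -> : - (\int[mu]_(x in D) (Y x ^+ k.+1 * expR (- (s * Y x)))) =
    \int[mu]_(x in D) ((fun s x => - (Y x ^+ k.+1 * expR (- (s * Y x)))) s x).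
  rewrite -mulN1r -RintegralZl//; last exact: lap_integrable.
  by apply: eq_Rintegral => x _; rewrite mulN1r.
apply: (@is_derive_Rintegral _ _ _ mu D (fun s x => Y x ^+ k * expR (- (s * Y x)))
  (fun s x => - (Y x ^+ k.+1 * expR (- (s * Y x))))) => //.
- by move=> t; exact: lap_integrable.
- move=> t x t0 Dx.
  have D1 : is_derive t 1 (fun t : R => t * Y x) (Y x).
    have -> : (fun t : R => t * Y x) = Y x *: id.
      by apply/funext => z; rewrite /GRing.scale/= mulrC.
    by apply: is_derive_eq; rewrite /GRing.scale/= mulr1.
  have D2 := @is_derive1_comp _ (fun x => expR (- x)) (fun t => t * Y x) t _ _
    (is_derive_expN (t * Y x)) D1.
  have -> : (fun t => Y x ^+ k * expR (- (t * Y x))) = Y x ^+ k *: ((fun x => expR (- x)) \o (fun t : R => t * Y x)).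
    by apply/funext => z.
  by apply: is_derive_eq; rewrite /GRing.scale/= exprSr; ring.
- move=> u u0; exists (fun x => Y x ^+ k.+1 * expR (- (u * Y x))); first exact: lap_integrable.
  move=> t x ut _ Dx; have y0 := Y0 Dx.
  rewrite normrN ger0_norm; last by rewrite mulr_ge0 ?exprn_ge0 ?expR_ge0.
  by rewrite ler_wpM2l ?exprn_ge0// ler_expR lerN2 ler_wpM2r// ltW.
Qed.

Lemma lap_ge0 k s : 0 <= lap k s.
Proof. by apply: Rintegral_ge0 => x /Y0 y0; rewrite mulr_ge0 ?exprn_ge0 ?expR_ge0. Qed.

Lemma derive1n_lap n s f : (forall s : R, 0 < s -> f s = lap 0 s) -> 0 < s ->
  derive1n n f s = (-1) ^+ n * lap n s.
Proof.
move=> fE s0.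
apply: (@derive1n_chain _ (fun n s => (-1) ^+ n * lap n s) n) => //.
- move=> k t _ t0; have H := is_derive_lap k t0.
  have -> : (fun s => (-1) ^+ k * lap k s) = (-1) ^+ k *: lap k by [].
  by apply: is_derive_eq; rewrite /GRing.scale/= exprS; ring.
- by move=> t t0; rewrite expr0 mul1r fE.
Qed.

End LaplaceIntegral.

Section RemainderIntegral.
Context {R : realType}.
Implicit Types (s t u : R).
Context d (T : measurableType d) (mu : {measure set T -> \bar R}).
Variables (D : set T) (Y : T -> R) (m : nat).
Hypotheses (mD : measurable D) (mY : measurable_fun D Y)
  (Y0 : forall x, D x -> 0 <= Y x)
  (int1 : mu.-integrable D (EFin \o cst 1))
  (intYm : mu.-integrable D (EFin \o (fun x => Y x ^+ m))).

Lemma expN_integrable s : 0 < s -> mu.-integrable D (fun x => (expR (- (s * Y x)))%:E).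
Proof.
move=> s0; apply: le_integrable int1 => //.
  by apply/measurable_EFinP; exact: measurable_expN.
move=> x Dx; rewrite /= lee_fin normr1 ger0_norm ?expR_ge0//.
by rewrite expR_le1 oppr_le0 mulr_ge0 ?Y0// ltW.
Qed.

Definition rem k s := \int[mu]_(x in D) (Y x ^+ (m.+1 - k) * psi k (s * Y x)).

Lemma remE k s : rem k s = \int[mu]_(x in D) (Y x ^+ (m.+1 - k) * psi k (s * Y x)).
Proof. by []. Qed.

Lemma continuous_psi k : continuous (@psi R k).
Proof.
case: k => [|k] x; apply/differentiable_continuous/derivable1_diffP.
  by have [] := is_derive_expN x.
by have [] := is_derive_psi k x.
Qed.

Lemma measurable_rem_kernel k s :
  measurable_fun D (fun x => Y x ^+ (m.+1 - k) * psi k (s * Y x)).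
Proof.
apply: measurable_funM; first exact: measurable_funX.
have mpsi : measurable_fun setT (@psi R k) := continuous_measurable_fun (@continuous_psi k).
apply: (measurableT_comp mpsi).
by apply: measurable_funM => //; exact: measurable_cst.
Qed.

Lemma rem_kernel_le k s x : (k <= m)%N -> 0 < s -> D x ->
  Y x ^+ (m - k) * psi k.+1 (s * Y x) <= s ^+ k * Y x ^+ m.
Proof.
move=> km s0 Dx; have y0 := Y0 Dx.
apply: (@le_trans _ _ (Y x ^+ (m - k) * (s * Y x) ^+ k)).
  by rewrite ler_wpM2l ?exprn_ge0// psi_le// mulr_ge0// ltW.
by rewrite exprMn mulrCA -exprD subnK.
Qed.

Lemma rem_kernel_ge0 k s x : 0 < s -> D x -> 0 <= Y x ^+ (m.+1 - k) * psi k (s * Y x).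
Proof.
move=> s0 /Y0 y0; apply: mulr_ge0; first exact: exprn_ge0.
by apply: psi_ge0; apply: mulr_ge0 => //; exact: ltW.
Qed.

Lemma rem0E s : rem 0 s = lap mu D Y m.+1 s. Proof. by rewrite /rem subn0. Qed.

Lemma rem_integrable k s : (k <= m.+1)%N -> 0 < s ->
  mu.-integrable D (EFin \o (fun x => Y x ^+ (m.+1 - k) * psi k (s * Y x))).
Proof.
case: k => [|k] km s0.
  by rewrite subn0; apply: lap_integrable => //; exact: expN_integrable.
apply: (@le_integrable _ _ _ _ _ mD _ (fun x => (s ^+ k)%:E * (Y x ^+ m)%:E)%E).
- exact/measurable_EFinP/measurable_rem_kernel.
- move=> x Dx; rewrite -EFinM !abse_EFin lee_fin ger0_norm ?rem_kernel_ge0//.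
  by rewrite (le_trans _ (ler_norm _))// subSS rem_kernel_le.
- by apply: integrableZl.
Qed.

Lemma is_derive_rem k s : (k <= m)%N -> 0 < s -> is_derive s 1 (rem k.+1) (rem k s).
Proof.
move=> km s0.
apply: (@is_derive_Rintegral _ _ _ mu D (fun s x => Y x ^+ (m.+1 - k.+1) * psi k.+1 (s * Y x))
  (fun s x => Y x ^+ (m.+1 - k) * psi k (s * Y x))) => //.
- by move=> t; exact: rem_integrable.
- move=> t x t0 Dx.
  have D1 : is_derive t 1 (fun t : R => t * Y x) (Y x).
    have -> : (fun t : R => t * Y x) = Y x *: id.
      by apply/funext => z; rewrite /GRing.scale/= mulrC.
    by apply: is_derive_eq; rewrite /GRing.scale/= mulr1.
  have D2 := @is_derive1_comp _ (psi k.+1) (fun t => t * Y x) t _ _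
    (is_derive_psi k (t * Y x)) D1.
  have -> : (fun t => Y x ^+ (m.+1 - k.+1) * psi k.+1 (t * Y x)) =
    Y x ^+ (m.+1 - k.+1) *: (psi k.+1 \o (fun t : R => t * Y x)).
    by apply/funext => z.
  by apply: is_derive_eq; rewrite /GRing.scale/= subSS subSn// exprSr; ring.
(* For [k = 0] the derivative involves the power [m.+1], above the available moment, and the
   exponential at the left end of the window dominates; for [k > 0] the moment of order [m] does. *)
- move=> u u0; case: k km => [|k] km.
    exists (fun x => Y x ^+ m.+1 * expR (- (u * Y x))).
      by apply: lap_integrable => //; exact: expN_integrable.
    move=> t x ut _ Dx; have y0 := Y0 Dx.
    rewrite ger0_norm ?rem_kernel_ge0 ?(lt_trans u0)// subn0 ler_wpM2l ?exprn_ge0//.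
    by rewrite ler_expR lerN2 ler_wpM2r// ltW.
  exists (fun x => (u * 3) ^+ k * Y x ^+ m).
    exact: (integrableZl mD ((u * 3) ^+ k) intYm).
  move=> t x ut tu Dx; have y0 := Y0 Dx; have t0 := lt_trans u0 ut.
  rewrite ger0_norm ?rem_kernel_ge0// subSS (le_trans (rem_kernel_le _ t0 Dx)) ?(ltnW km)//.
  by rewrite ler_wpM2r ?exprn_ge0// lerXn2r ?nnegrE ?mulr_ge0 ?ltW.
Qed.

Lemma is_derive_rem0 s : 0 < s -> is_derive s 1 (rem 0) (- lap mu D Y m.+2 s).
Proof.
move=> s0; rewrite (_ : rem 0 = lap mu D Y m.+1); last by apply/funext => x; rewrite rem0E.
by apply: is_derive_lap => // t; exact: expN_integrable.
Qed.

Lemma rem_ge0 k s : 0 < s -> 0 <= rem k s.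
Proof. by move=> s0; apply: Rintegral_ge0 => x; exact: rem_kernel_ge0. Qed.

Lemma rem_nd k s t : (k <= m)%N -> 0 < s -> s <= t -> rem k.+1 s <= rem k.+1 t.
Proof.
move=> km s0 st; have t0 := lt_le_trans s0 st.
apply: le_Rintegral => //; [exact: rem_integrable|exact: rem_integrable|].
move=> x Dx; have y0 := Y0 Dx.
by rewrite ler_wpM2l ?exprn_ge0// psi_nd ?mulr_ge0 ?ler_wpM2r// ltW.
Qed.

Lemma rem0_ni s t : 0 < s -> s <= t -> rem 0 t <= rem 0 s.
Proof.
move=> s0 st; have t0 := lt_le_trans s0 st.
apply: le_Rintegral => //; [exact: rem_integrable|exact: rem_integrable|].
move=> x Dx; have y0 := Y0 Dx.
by rewrite ler_wpM2l ?exprn_ge0//= ler_expR lerN2 ler_wpM2r.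
Qed.

(** Dominated convergence along [1 / n.+1] is enough because [rem k.+1] is nondecreasing and
    nonnegative. *)
Lemma rem_cvg0 k : (k <= m)%N -> rem k.+1 s @[s --> 0^'+] --> 0.
Proof.
move=> km.
have H : (\int[mu]_(x in D) (Y x ^+ (m - k) * psi k.+1 (n.+1%:R^-1 * Y x))%:E)%E @[n --> \oo] -->
    (\int[mu]_(x in D) (cst 0%E x))%E.
  apply: (@dominated_cvg _ _ _ _ _ mD _ _ (EFin \o (fun x => Y x ^+ m))) => //.
  - move=> n; apply/measurable_EFinP.
    by have := measurable_rem_kernel k.+1 n.+1%:R^-1; rewrite subSS.
  - move=> x Dx; apply: cvg_EFin; first exact: nearW.
    rewrite -[X in _ --> X](mulr0 (Y x ^+ (m - k))); apply: cvgM; first exact: cvg_cst.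
    rewrite -(psi0 k); apply: continuous_cvg; first exact: continuous_psi.
    rewrite -[X in _ --> X](mul0r (Y x)); apply: cvgM; last exact: cvg_cst.
    exact: cvg_harmonic.
  - move=> n x Dx; have n0 : 0 < n.+1%:R^-1 :> R by rewrite invr_gt0.
    rewrite /= lee_fin ger0_norm; last by have := rem_kernel_ge0 k.+1 n0 Dx; rewrite subSS.
    rewrite (le_trans (rem_kernel_le km n0 Dx))// ler_piMl ?exprn_ge0 ?Y0//.
    by rewrite exprn_ile1// ?invr_ge0// invf_le1// ler1n.
rewrite integral0 in H.
have {}H : rem k.+1 n.+1%:R^-1 @[n --> \oo] --> 0.
  rewrite /rem subSS; exact: fine_cvg H.
apply/cvgrPdist_lt => e e0.
have /cvgrPdist_lt/(_ e e0)[n _ Hn] := H.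
exists n.+1%:R^-1 => /=; first by rewrite invr_gt0.
move=> t /= + t0; rewrite sub0r normrN gtr0_norm// => tn.
rewrite sub0r normrN ger0_norm ?rem_ge0//.
have := Hn n (leqnn n); rewrite /= sub0r normrN ger0_norm ?rem_ge0 ?invr_gt0//.
by apply: le_lt_trans; apply: rem_nd => //; exact: ltW.
Qed.

(** Two uses of [psi_deriv_le] under the integral. This is the second-derivative bound that
    [asymp0_derive] requires for [H = rem k.+2]. *)
Lemma rem_deriv2_le k s : (k < m)%N -> 0 < s ->
  s ^+ 2 * `|rem k s| <= (k.+1%:R * k.+2%:R) * rem k.+2 s.
Proof.
move=> km s0; rewrite ger0_norm ?rem_ge0//.
have ik : mu.-integrable D (EFin \o (fun x => Y x ^+ (m.+1 - k) * psi k (s * Y x))).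
  by apply: rem_integrable => //; exact: ltnW (ltnW _).
have ik2 : mu.-integrable D (EFin \o (fun x => Y x ^+ (m.+1 - k.+2) * psi k.+2 (s * Y x))).
  exact: rem_integrable.
rewrite /rem -!RintegralZl//; apply: le_Rintegral => //.
- exact: (integrableZl mD (s ^+ 2)) ik.
- exact: (integrableZl mD (k.+1%:R * k.+2%:R)) ik2.
move=> x Dx; have y0 := Y0 Dx.
have sy0 : 0 <= s * Y x by rewrite mulr_ge0// ltW.
have -> : (m.+1 - k = (m.+1 - k.+2) + 2)%N by lia.
have -> : s ^+ 2 * (Y x ^+ (m.+1 - k.+2 + 2) * psi k (s * Y x)) =
    Y x ^+ (m.+1 - k.+2) * (s * Y x * (s * Y x * psi k (s * Y x))).
  by rewrite exprD; ring.
rewrite [leRHS]mulrCA ler_wpM2l ?exprn_ge0//.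
have H1 := psi_deriv_le k sy0; have H2 := psi_deriv_le k.+1 sy0.
apply: (@le_trans _ _ (s * Y x * (k.+1%:R * psi k.+1 (s * Y x)))).
  by rewrite ler_wpM2l.
by rewrite mulrCA -[leRHS]mulrA ler_wpM2l.
Qed.

(** The same bound at the bottom of the chain, [H = rem 1] and [h = rem 0], where the second
    derivative has left the family [rem]. *)
Lemma rem1_deriv2_le s : 0 < s -> s ^+ 2 * `|- lap mu D Y m.+2 s| <= 4 * rem 1 s.
Proof.
move=> s0; rewrite normrN ger0_norm ?lap_ge0//.
have ik : mu.-integrable D (EFin \o (fun x => Y x ^+ m.+2 * expR (- (s * Y x)))).
  by apply: lap_integrable => //; exact: expN_integrable.
have ik2 : mu.-integrable D (EFin \o (fun x => Y x ^+ (m.+1 - 1) * psi 1 (s * Y x))).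
  exact: rem_integrable.
rewrite /rem /lap -!RintegralZl//; apply: le_Rintegral => //.
- exact: (integrableZl mD (s ^+ 2)) ik.
- exact: (integrableZl mD 4) ik2.
move=> x Dx; have y0 := Y0 Dx.
have sy0 : 0 <= s * Y x by rewrite mulr_ge0// ltW.
have -> : s ^+ 2 * (Y x ^+ m.+2 * expR (- (s * Y x))) =
    Y x ^+ m * ((s * Y x) ^+ 2 * expR (- (s * Y x))).
  by rewrite -(addn2 m) exprD; ring.
by rewrite subSS subn0 [leRHS]mulrCA ler_wpM2l ?exprn_ge0// sqr_expN_le.
Qed.

(** The extra power of [Y] is paid by halving the argument, through [expr_expN_le]; it yields the
    Lipschitz bounds for [rem 0] when [beta = 1]. *)
Lemma rem0_deriv_le s : 0 < s -> s * `|- lap mu D Y m.+2 s| <= 2 * rem 0 (s / 2).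
Proof.
move=> s0; rewrite normrN ger0_norm ?lap_ge0//.
have s20 : 0 < s / 2 by rewrite divr_gt0.
have ik : mu.-integrable D (EFin \o (fun x => Y x ^+ m.+2 * expR (- (s * Y x)))).
  by apply: lap_integrable => //; exact: expN_integrable.
have ik2 : mu.-integrable D (EFin \o (fun x => Y x ^+ m.+1 * expR (- (s / 2 * Y x)))).
  by apply: lap_integrable => //; exact: expN_integrable.
rewrite rem0E /lap -!RintegralZl//; apply: le_Rintegral => //.
- exact: (integrableZl mD s) ik.
- exact: (integrableZl mD 2) ik2.
move=> x Dx; have y0 := Y0 Dx.
have := expr_expN_le 1 s0 y0; rewrite (_ : 1`! = 1)%N// !expr1 => H.
have -> : s * (Y x ^+ m.+2 * expR (- (s * Y x))) =
    Y x ^+ m.+1 * (s * (Y x * expR (- (s * Y x)))) by rewrite exprSr; ring.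
rewrite [leRHS]mulrCA ler_wpM2l ?exprn_ge0// mulrC -ler_pdivlMr//.
by apply: le_trans H _; rewrite le_eqVlt; apply/orP; left; apply/eqP; field; rewrite gt_eqF.
Qed.

End RemainderIntegral.

(** * Right-continuous and monotone functions *)

Section RightContinuous.
Context {R : realType}.
Implicit Types (p q : R -> R) (x y z : R).

(** Let [E k] collect the points with oscillation above [1 / k.+1]. Right-continuity makes [p]
    nearly constant just to the right of such a point, so an interval on its right is free of [E k];
    a rational chosen in that interval determines the point. *)
Lemma countable_discontinuities p :
  (forall x : R, 0 < x -> p @ x^'+ --> p x) ->
  countable [set z | 0 < z /\ ~ {for z, continuous p}].
Proof.
move=> prc.
pose E k := [set z : R | 0 < z /\ forall d : R, 0 < d ->
  exists2 y, `|y - z| < d & k.+1%:R^-1 < `|p y - p z|].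
apply: (@sub_countable _ _ _ (\bigcup_k E k)).
  apply: subset_card_le => z [z0 nc].
  apply: contrapT => nE; apply: nc; apply/cvgrPdist_lt => e e0.
  have [k ke] : exists k, k.+1%:R^-1 < e.
    have /cvgrPdist_lt/(_ e e0)[k _ Hk] := @cvg_harmonic R.
    by exists k; have := Hk k (leqnn k); rewrite /= sub0r normrN gtr0_norm.
  have : ~ E k z by move=> Ekz; apply: nE; exists k.
  move=> /not_andP[//|/existsNP[d /not_implyP[d0 /forall2NP Hd]]].
  exists d => // y /= zy; have [|/negP] := Hd y; first by rewrite distrC.
  by rewrite -leNgt => H; rewrite distrC (le_lt_trans H).
apply: bigcup_countable => // k _.
have k20 : 0 < k.+1%:R^-1 / 2 :> R by rewrite divr_gt0.
have /choice[f fE] : forall z : R, exists f : rat, E k z ->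
    z < ratr f /\ forall y, z < y -> y <= ratr f -> ~ E k y.
  move=> z; have [Ekz|] := pselect (E k z); last by exists 0.
  have z0 : 0 < z by case: Ekz.
  have /cvgrPdist_lt/(_ _ k20)[d /= d0 Hd] := prc z z0.
  have /rat_in_itvoo[f] : z < z + d by rewrite ltrDl.
  rewrite in_itv/= => /andP[zf fd]; exists f => _; split => // y zy yf [y0 Ey].
  have [t tyd pty] : exists2 t, `|t - y| < Num.min (y - z) (z + d - y) & k.+1%:R^-1 < `|p t - p y|.
    by apply: Ey; rewrite lt_min !subr_gt0 zy (le_lt_trans yf).
  move: tyd; rewrite lt_min !ltr_norml => /andP[/andP[t1 _] /andP[_ t2]].
  have Hy : `|p z - p y| < k.+1%:R^-1 / 2.
    by apply: Hd => //=; rewrite distrC gtr0_norm ?subr_gt0// ltrBlDl (le_lt_trans yf).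
  have Ht : `|p z - p t| < k.+1%:R^-1 / 2.
    apply: Hd => /=; last by lra.
    by rewrite ltr_norml; apply/andP; split; lra.
  move: pty; apply/negP; rewrite -leNgt.
  rewrite (_ : p t - p y = (p z - p y) - (p z - p t)); last by ring.
  by rewrite (le_trans (ler_normB _ _))// [leRHS]splitr lerD// ltW.
have finj : {in E k &, injective f}.
  move=> x y; rewrite !inE => Ex Ey xy.
  have [xf Hx] := fE x Ex; have [yf Hy] := fE y Ey.
  have [xy'|yx|//] := ltgtP x y.
    by exfalso; apply: (Hx y xy') Ey; rewrite xy ltW.
  by exfalso; apply: (Hy x yx) Ex; rewrite -xy ltW.
rewrite (@eq_countable _ _ _ (f @` E k)); last by rewrite card_eq_sym; exact: inj_card_eq.
exact: countableP.
Qed.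

Lemma cocountable_right_dense (A : set R) x y : countable A -> x < y ->
  exists2 z, x < z < y & ~ A z.
Proof.
move=> cA xy; apply: contrapT => /forall2NP H.
have cI : countable (`]x, y[ : set R)%classic.
  apply: sub_countable cA; apply: subset_card_le => z; rewrite /= in_itv/= => xzy.
  by have [//|/contrapT] := H z.
have := countable_lebesgue_measure0 cI.
rewrite lebesgue_measure_itv/= lte_fin xy -EFinB => /eqP.
by rewrite eqe subr_eq0 gt_eqF.
Qed.

Lemma right_continuous_eq p q (A : set R) : countable A ->
  (forall x : R, 0 < x -> p @ x^'+ --> p x) -> (forall x : R, 0 < x -> q @ x^'+ --> q x) ->
  (forall x : R, 0 < x -> ~ A x -> p x = q x) -> forall x : R, 0 < x -> p x = q x.
Proof.
move=> cA pc qc pq x x0; apply/eqP; rewrite -subr_eq0 -normr_le0; apply/ler_addgt0Pr => e e0.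
have e20 : 0 < e / 2 by rewrite divr_gt0.
have /cvgrPdist_lt/(_ _ e20)[d1 /= d10 H1] := pc x x0.
have /cvgrPdist_lt/(_ _ e20)[d2 /= d20 H2] := qc x x0.
have xd : x < x + Num.min d1 d2 by rewrite ltrDl lt_min d10.
have [z /andP[xz zd] Az] := cocountable_right_dense cA xd.
have zx : `|x - z| < Num.min d1 d2 by rewrite distrC gtr0_norm ?subr_gt0// ltrBlDl.
move: zx; rewrite lt_min => /andP[zx1 zx2].
have K1 := H1 z zx1 xz; have := H2 z zx2 xz; rewrite -(pq z (lt_trans x0 xz) Az) => K2.
rewrite add0r (_ : p x - q x = (p x - p z) - (q x - p z)); last by ring.
by rewrite (le_trans (ler_normB _ _))// [leRHS]splitr lerD// ltW.
Qed.

Definition nonincreasing_pos (T : R -> R) := forall x y : R, 0 < x -> x <= y -> T y <= T x.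

(* The right-continuous version of the limit is [T z = sup {l z1 z2 | z < z1 < z2}]. *)
Lemma monotone_limit (G : nat -> R -> R) : (forall n, nonincreasing_pos (G n)) ->
  (forall z z' : R, 0 < z -> z < z' -> exists l : R, forall e : R, 0 < e ->
     \forall n \near \oo, G n z' <= l + e /\ l - e <= G n z) ->
  exists T : R -> R, [/\ nonincreasing_pos T,
    forall x : R, 0 < x -> T @ x^'+ --> T x &
    forall x : R, 0 < x -> {for x, continuous T} -> G n x @[n --> \oo] --> T x].
Proof.
move=> Gni Gl.
have /choice[l lP] : forall zz : R * R, exists l : R, 0 < zz.1 -> zz.1 < zz.2 ->
  forall e : R, 0 < e -> \forall n \near \oo, G n zz.2 <= l + e /\ l - e <= G n zz.1.
  move=> [z z']; have [z0|z0] := ltP 0 z; last by exists 0.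
  have [zz|zz] := ltP z z'; last by exists 0.
  by have [l Hl] := Gl z z' z0 zz; exists l.
(* The numbers [l] are arbitrary choices, yet [G n z1 <= G n y2] forces this order on them for a
   late [n]. *)
have lle z1 z2 y1 y2 : 0 < y1 -> y1 < y2 -> y2 <= z1 -> z1 < z2 -> l (z1, z2) <= l (y1, y2).
  move=> y10 y12 yz z12; have z10 : 0 < z1 by rewrite (lt_le_trans y10)// (le_trans (ltW y12)).
  apply/ler_addgt0Pr => e e0; have e20 : 0 < e / 2 by rewrite divr_gt0.
  near \oo => n.
  have [_ H1] : G n z2 <= l (z1, z2) + e / 2 /\ l (z1, z2) - e / 2 <= G n z1.
    by near: n; exact: (lP (z1, z2)).
  have [H2 _] : G n y2 <= l (y1, y2) + e / 2 /\ l (y1, y2) - e / 2 <= G n y1.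
    by near: n; exact: (lP (y1, y2)).
  have := Gni n y2 z1 (lt_trans y10 y12) yz.
  by lra.
pose S z := [set l zz | zz in [set zz : R * R | z < zz.1 /\ zz.1 < zz.2]].
have hS z : 0 < z -> has_sup (S z).
  move=> z0; split.
    by exists (l (z + 1, z + 2)); exists (z + 1, z + 2) => //=; split; lra.
  exists (l (z / 2, z)) => _ [[z1 z2] /= [zz1 z12] <-].
  by apply: lle; [rewrite divr_gt0|lra|exact: ltW|].
pose T z := sup (S z).
have TS z z1 z2 : 0 < z -> z < z1 -> z1 < z2 -> l (z1, z2) <= T z.
  by move=> z0 zz1 z12; apply: sup_upper_bound; [exact: hS|exists (z1, z2)].
have Tadh z e : 0 < z -> 0 < e -> exists z1 z2, [/\ z < z1, z1 < z2 & T z - e < l (z1, z2)].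
  move=> z0 e0; have [_ [[z1 z2] /= [zz1 z12] <-] H] := sup_adherent e0 (hS z z0).
  by exists z1, z2.
have Tni : nonincreasing_pos T.
  move=> x y x0 xy; apply: ge_sup; first by have [] := hS y (lt_le_trans x0 xy).
  by move=> _ [[z1 z2] /= [yz1 z12] <-]; apply: TS => //; exact: le_lt_trans yz1.
exists T; split => //.
  move=> x x0; apply/cvgrPdist_lt => e e0.
  have [z1 [z2 [xz1 z12 H]]] := Tadh x e x0 e0.
  exists (z1 - x) => /=; first by rewrite subr_gt0.
  move=> y /= + xy; rewrite distrC gtr0_norm ?subr_gt0// ltrD2r => yz1.
  have y0 := lt_trans x0 xy.
  have := TS y z1 z2 y0 yz1 z12; have := Tni x y x0 (ltW xy).
  by rewrite ltr_norml => ? ?; apply/andP; split; lra.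
move=> x x0 Tc; apply/cvgrPdist_le => e e0; have e20 : 0 < e / 2 by rewrite divr_gt0.
have [z1 [z2 [xz1 z12 H]]] := Tadh x _ x0 e20.
have /cvgrPdist_lt/(_ _ e20)[d /= d0 Hd] := Tc.
(* A positive point to the left of [x] and within [d] of it. The pair [((y + x) / 2, x)] then bounds
   [G n x] from above by about [T y], which is close to [T x] by continuity; the pair [(z1, z2)]
   gives the lower bound. *)
pose y := Num.max (x / 2) (x - d / 2).
have y0 : 0 < y by rewrite lt_max divr_gt0.
have yx : y < x by rewrite gt_max; apply/andP; split; lra.
have yd : x - d < y by rewrite lt_max; apply/orP; right; lra.
have Ty : T y < T x + e / 2.
  have := Hd y; rewrite /= gtr0_norm ?subr_gt0// ltrBlDl -ltrBlDr => /(_ yd).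
  by rewrite ltr_norml => /andP[]; lra.
have yx' : y < (y + x) / 2 by lra.
have yx'' : (y + x) / 2 < x by lra.
have H2 := TS y _ _ y0 yx' yx''.
near=> n.
have [_ K1] : G n z2 <= l (z1, z2) + e / 2 /\ l (z1, z2) - e / 2 <= G n z1.
  by near: n; apply: (lP (z1, z2)) => //=; exact: lt_trans xz1.
have [K2 _] : G n x <= l ((y + x) / 2, x) + e / 2 /\ l ((y + x) / 2, x) - e / 2 <= G n ((y + x) / 2).
  by near: n; apply: (lP ((y + x) / 2, x)) => //=; lra.
have := Gni n x z1 x0 (ltW xz1).
by rewrite ler_norml => ?; apply/andP; split; lra.
Unshelve. all: by end_near. Qed.

End RightContinuous.

(** * Karamata's Tauberian argument *)

Lemma cvg_sum_ord {R : realType} {T : Type} (F : set_system T) {FF : Filter F} (N : nat)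
  (f : nat -> T -> R) (l : nat -> R) : (forall i, f i @ F --> l i) ->
  (fun x => \sum_(i < N) f i x) @ F --> \sum_(i < N) l i.
Proof.
move=> fl; elim: N => [|N IH].
  by rewrite big_ord0; under eq_fun do rewrite big_ord0; exact: cvg_cst.
rewrite big_ord_recr/=; under eq_fun do rewrite big_ord_recr/=.
exact: cvgD.
Qed.

Section Karamata.
Context {R : realType} d (T : measurableType d) (mu : {measure set T -> \bar R}).
Variables (D : set T) (u k : nat -> T -> R) (L : nat -> R).
Hypotheses (mD : measurable D)
  (mu_ : forall n, measurable_fun D (u n))
  (u01 : forall n x, D x -> 0 <= u n x <= 1)
  (k0 : forall n x, D x -> 0 <= k n x)
  (intk : forall n, mu.-integrable D (EFin \o k n))
  (cvgL : forall i, \int[mu]_(x in D) (u n x ^+ i * k n x) @[n --> \oo] --> L i).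

Lemma karamata_integrable (h : R -> R) n : continuous h ->
  mu.-integrable D (EFin \o (fun x => h (u n x) * k n x)).
Proof.
move=> ch.
have [M HM] : exists M : R, forall t, 0 <= t <= 1 -> `|h t| <= M.
  have : compact (h @` `[0, 1]).
    by apply: continuous_compact; [exact: continuous_subspaceT|exact: segment_compact].
  move/compact_bounded => [M [_ HM]]; exists (`|M| + 1) => x x01.
  apply: HM; first by rewrite (le_lt_trans (ler_norm _))// ltrDl.
  by exists x => //=; rewrite in_itv.
have mk : measurable_fun D (k n) by apply/measurable_EFinP; exact: (measurable_int mu (intk n)).
apply: (@le_integrable _ _ _ _ _ mD _ (fun x => M%:E * (k n x)%:E)%E).
- apply/measurable_EFinP; apply: measurable_funM => //.
  have mh : measurable_fun setT h := continuous_measurable_fun ch.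
  exact: (measurableT_comp mh).
- move=> x Dx; rewrite -EFinM !abse_EFin lee_fin !normrM (ger0_norm (k0 n Dx)).
  by rewrite ler_wpM2r ?k0// (le_trans (HM _ (u01 n Dx)))// ler_norm.
- exact: (integrableZl mD M (intk n)).
Qed.

Lemma karamata_poly (p : {poly R}) :
  \int[mu]_(x in D) (p.[u n x] * k n x) @[n --> \oo] --> \sum_(i < size p) p`_i * L i.
Proof.
have E n : \int[mu]_(x in D) (p.[u n x] * k n x) =
    \sum_(i < size p) p`_i * \int[mu]_(x in D) (u n x ^+ i * k n x).
  under eq_Rintegral do rewrite horner_coef.
  elim: (size p) => [|N IH].
    rewrite big_ord0; under eq_Rintegral do rewrite big_ord0 mul0r.
    by rewrite /Rintegral integral0.
  rewrite big_ord_recr/= -IH -RintegralZl//; last first.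
    by apply: (@karamata_integrable (fun t => t ^+ N)); exact: exprn_continuous.
  rewrite -RintegralD//; last 2 first.
  - apply: (@karamata_integrable (fun t => \sum_(i < N) p`_i * t ^+ i)) => t.
    apply: (@cvg_sum_ord _ _ _ _ N (fun i t => p`_i * t ^+ i) (fun i => p`_i * t ^+ i)) => i.
    by apply: cvgM; [exact: cvg_cst|exact: exprn_continuous].
  - rewrite (_ : (fun x => _) = (fun x => (fun t => p`_N * t ^+ N) (u n x) * k n x)); last first.
      by apply/funext => x; rewrite mulrA.
    apply: (@karamata_integrable (fun t => p`_N * t ^+ N) n) => t.
    by apply: cvgM; [exact: cvg_cst|exact: exprn_continuous].
  by apply: eq_Rintegral => x _; rewrite big_ord_recr/= mulrDl mulrA.
rewrite (_ : (fun n => _) = fun n => \sum_(i < size p) p`_i *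
    \int[mu]_(x in D) (u n x ^+ i * k n x)); last by apply/funext => n; exact: E.
apply: (@cvg_sum_ord _ _ _ _ _ (fun i n => p`_i * \int[mu]_(x in D) (u n x ^+ i * k n x))
  (fun i => p`_i * L i)) => i.
by apply: cvgM; [exact: cvg_cst|exact: cvgL].
Qed.

(** For polynomials the limit is a combination of the [L i]. A uniform approximation of [h] within
    [e1] changes the integrals by at most [e1] times the mass of [k n], which is eventually below
    [|L 0| + 1]; hence the choice of [e1]. *)
Lemma karamata_cvg (h : R -> R) : continuous h ->
  exists l : R, \int[mu]_(x in D) (h (u n x) * k n x) @[n --> \oo] --> l.
Proof.
move=> ch; apply/cvg_ex; apply/cauchy_cvgP/cauchy_exP => e e0.
pose e1 := e / (2 * (`|L 0%N| + 1)).
have L1 : 0 < `|L 0%N| + 1 by rewrite ltr_wpDl.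
have e10 : 0 < e1 by rewrite divr_gt0// mulr_gt0.
have [p Hp] := weierstrass ch e10.
exists (\sum_(i < size p) p`_i * L i).
have e20 : 0 < e / 2 by rewrite divr_gt0.
have /cvgrPdist_lt/(_ _ e20) Kp := @karamata_poly p.
have /cvgrPdist_lt/(_ _ ltr01) K0 := @cvgL 0%N.
suff : \forall n \near \oo, `|\sum_(i < size p) p`_i * L i -
    \int[mu]_(x in D) (h (u n x) * k n x)| < e by [].
near=> n.
have H1 : `|\sum_(i < size p) p`_i * L i - \int[mu]_(x in D) (p.[u n x] * k n x)| < e / 2.
  by near: n; exact: Kp.
have H2 : `|L 0 - \int[mu]_(x in D) (u n x ^+ 0 * k n x)| < 1 by near: n; exact: K0.
have ip : mu.-integrable D (EFin \o (fun x => p.[u n x] * k n x)).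
  apply: (@karamata_integrable (fun t => p.[t])); exact: continuous_horner.
have ih := karamata_integrable n ch.
set a := \sum_(i < size p) _ in H1 *; set b := \int[mu]_(x in D) (p.[u n x] * _) in H1 *.
set c := \int[mu]_(x in D) (h _ * _).
have H3 : `|b - c| <= e / 2.
  rewrite /b /c -RintegralB//.
  apply: (le_trans (le_normr_Rintegral mD _)).
    by have := integrableB mD ip ih.
  apply: (@le_trans _ _ (\int[mu]_(x in D) (e1 * k n x))).
    apply: le_Rintegral => //.
    - by have := integrable_abse (integrableB mD ip ih).
    - exact: (integrableZl mD e1) (intk n).
    move=> x Dx; rewrite -mulrBl normrM (ger0_norm (k0 n Dx)) ler_wpM2r ?k0//.
    by rewrite distrC Hp// u01.
  rewrite RintegralZl//.
  have : \int[mu]_(x in D) k n x <= `|L 0%N| + 1.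
    move: H2; under eq_Rintegral do rewrite expr0 mul1r.
    by rewrite ltr_norml => /andP[+ _]; have := ler_norm (L 0%N); lra.
  have -> : e / 2 = e1 * (`|L 0%N| + 1) by rewrite /e1; field; rewrite gt_eqF.
  by move=> ?; rewrite ler_pM2l.
rewrite (_ : a - c = (a - b) + (b - c)); last by ring.
by rewrite (le_lt_trans (ler_normD _ _))// [ltRHS]splitr ltr_leD.
Unshelve. all: by end_near. Qed.

End Karamata.

(** * Continuous functions of exp(-y) that separate two levels z < z' *)

Section TestFunctions.
Context {R : realType}.
Implicit Types (a b t x y z : R).

Definition clip01 t := Num.max 0 (Num.min 1 t).

Lemma clip01_itv t : 0 <= clip01 t <= 1.
Proof. by rewrite le_max lexx/= ge_max ler01 ge_min lexx. Qed.

Lemma clip01_0 t : t <= 0 -> clip01 t = 0.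
Proof. by move=> t0; rewrite /clip01 min_r ?max_l// (le_trans t0). Qed.

Lemma clip01_1 t : 1 <= t -> clip01 t = 1.
Proof. by move=> t1; rewrite /clip01 min_l// max_r. Qed.

Lemma continuous_clip01 (f : R -> R) : continuous f -> continuous (clip01 \o f).
Proof.
move=> cf x; apply: (@continuous_max _ _ (cst 0) (fun x => Num.min 1 (f x))).
  exact: cst_continuous.
by apply: (@continuous_min _ _ (cst 1) f); [exact: cst_continuous|exact: cf].
Qed.

(* [t |-> (max (- ln t) z)^-1], continuous at 0. *)
Definition invlog z t := if t <= 0 then 0 else (Num.max (- ln t) z)^-1.

Lemma continuous_invlog z : 0 < z -> continuous (invlog z).
Proof.
move=> z0 t; have [t0|t0|->] := ltgtP t 0.
- apply/cvgrPdist_lt => e e0; near=> s.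
  have s0 : s < 0 by near: s; exact: lt_nbhsl.
  by rewrite /invlog (ltW t0) (ltW s0) subrr normr0.
- have C : {for t, continuous (fun t => (Num.max (- ln t) z)^-1)}.
    apply: continuousV; first by rewrite gt_eqF// lt_max z0 orbT.
    apply: (@continuous_max _ _ (fun t => - ln t) (cst z)); last exact: cst_continuous.
    by apply: continuousN; exact: continuous_ln.
  rewrite /continuous_at /invlog leNgt t0/=; apply: cvg_trans C.
  apply: near_eq_cvg; near=> s.
  by have s0 : 0 < s; [near: s; exact: lt_nbhsr|rewrite leNgt s0].
apply/cvgrPdist_lt => e e0; near=> s.
rewrite /invlog lexx sub0r normrN; case: ifPn => s0; first by rewrite normr0.
rewrite -ltNge in s0.
have se : s < expR (- e^-1) by near: s; exact/lt_nbhsl/expR_gt0.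
have ls : e^-1 < - ln s by rewrite ltrNr -[ltRHS](expRK (- e^-1)) ltr_ln ?posrE ?expR_gt0.
have eV0 : 0 < e^-1 by rewrite invr_gt0.
rewrite ger0_norm; last by rewrite invr_ge0 le_max (ltW (lt_trans eV0 ls)).
by rewrite -[ltRHS]invrK ltf_pV2 ?posrE// lt_max ?ls// z0 orbT.
Unshelve. all: by end_near. Qed.

(** At [t = exp (- y)] this interpolates between 0 for [y <= z] and [y^(-j) / (1 - t)] for
    [y >= z']; the denominator cancels the factor [1 - t] of the weight coming from [rem 1]. The
    minimum keeps it away from 0 near [t = 1], where the clipped factor vanishes. *)
Definition upper_test j z z' t := clip01 ((expR (- z) - t) / (expR (- z) - expR (- z'))) *
  (invlog z t ^+ j / (1 - Num.min t (expR (- z)))).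

Lemma continuous_upper_test j z z' : 0 < z -> continuous (upper_test j z z').
Proof.
move=> z0 t; apply: cvgM.
  apply: (@continuous_clip01 (fun t => (expR (- z) - t) / (expR (- z) - expR (- z')))) => {}t.
  by apply: cvgM; [apply: cvgB; [exact: cvg_cst|exact: cvg_id]|exact: cvg_cst].
apply: cvgM.
  apply: (@continuous_comp _ _ _ (invlog z) (fun x => x ^+ j)); first exact: continuous_invlog.
  exact: exprn_continuous.
apply: cvgV.
  rewrite subr_eq0 gt_eqF// gt_min; apply/orP; right.
  by rewrite expR_lt1 oppr_lt0.
apply: cvgB; first exact: cvg_cst.
by apply: (@continuous_min _ _ id (cst (expR (- z)))); [|exact: cst_continuous].
Qed.

Lemma upper_test_le j z z' y : 0 < z -> z < z' -> 0 <= y ->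
  upper_test j z z' (expR (- y)) * (1 - expR (- y)) <= (if z < y then y^-1 ^+ j else 0).
Proof.
move=> z0 zz' y0; have dz : 0 < expR (- z) - expR (- z') by rewrite subr_gt0 ltr_expR ltrN2.
have [zy|yz] := ltP z y.
  have y00 := lt_trans z0 zy.
  have yz1 : expR (- y) < expR (- z) by rewrite ltr_expR ltrN2.
  have y1 : 0 < 1 - expR (- y) by rewrite subr_gt0 expR_lt1 oppr_lt0.
  rewrite /upper_test /invlog (lt_geF (expR_gt0 (- y))) expRK opprK max_l ?(ltW zy)// min_l ?(ltW yz1)//.
  rewrite -mulrA divfK ?gt_eqF// ler_piMl ?exprn_ge0 ?invr_ge0//.
  by case/andP: (clip01_itv ((expR (- z) - expR (- y)) / (expR (- z) - expR (- z')))).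
rewrite /upper_test clip01_0 ?mul0r//.
by rewrite ler_pdivrMr// mul0r subr_le0 ler_expR lerN2.
Qed.

Lemma upper_test_ge j z z' y : 0 < z -> z < z' -> 0 <= y ->
  (if z' < y then y^-1 ^+ j else 0) <= upper_test j z z' (expR (- y)) * (1 - expR (- y)).
Proof.
move=> z0 zz' y0; have dz : 0 < expR (- z) - expR (- z') by rewrite subr_gt0 ltr_expR ltrN2.
have [zy|yz] := ltP z' y; last first.
  rewrite mulr_ge0// ?subr_ge0 ?expR_le1 ?oppr_le0//.
  rewrite mulr_ge0//; first by case/andP: (clip01_itv ((expR (- z) - expR (- y)) / (expR (- z) - expR (- z')))).
  rewrite divr_ge0 ?exprn_ge0//.
    rewrite /invlog; case: ifP => // _; rewrite invr_ge0 le_max (ltW z0) orbT//.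
  by rewrite subr_ge0 ge_min expR_le1 oppr_le0 y0.
have zy' := lt_trans zz' zy.
have y00 := lt_trans z0 zy'.
have yz1 : expR (- y) < expR (- z) by rewrite ltr_expR ltrN2.
have y1 : 0 < 1 - expR (- y) by rewrite subr_gt0 expR_lt1 oppr_lt0.
rewrite /upper_test /invlog (lt_geF (expR_gt0 (- y))) expRK opprK max_l ?(ltW zy')// min_l ?(ltW yz1)//.
rewrite clip01_1; last first.
  by rewrite ler_pdivlMr// mul1r lerD2l lerN2 ler_expR lerN2 ltW.
by rewrite mul1r divfK ?gt_eqF.
Qed.

(** Here the division cancels the factor [t = exp (- y)] of the weight coming from [rem 0]; the
    maximum plays the same protective part at [t = 0]. *)
Definition lower_test z z' t := clip01 ((t - expR (- z')) / (expR (- z) - expR (- z'))) /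
  Num.max t (expR (- z')).

Lemma continuous_lower_test z z' : continuous (lower_test z z').
Proof.
move=> t; apply: cvgM.
  apply: (@continuous_clip01 (fun t => (t - expR (- z')) / (expR (- z) - expR (- z')))) => {}t.
  by apply: cvgM; [apply: cvgB; [exact: cvg_id|exact: cvg_cst]|exact: cvg_cst].
apply: cvgV; first by rewrite gt_eqF// lt_max expR_gt0 orbT.
by apply: (@continuous_max _ _ id (cst (expR (- z')))); [|exact: cst_continuous].
Qed.

Lemma lower_test_itv z z' y : z < z' ->
  (y <= z)%R%:R <= lower_test z z' (expR (- y)) * expR (- y) <= (y <= z')%R%:R.
Proof.
move=> zz'; have dz : 0 < expR (- z) - expR (- z') by rewrite subr_gt0 ltr_expR ltrN2.
rewrite /lower_test; set c := clip01 _.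
have /andP[c0 c1] : 0 <= c <= 1 by exact: clip01_itv.
have [yz'|yz'] := leP y z'; last first.
  rewrite (leNgt y) (lt_trans zz' yz')/=.
  rewrite /c clip01_0 ?mul0r ?lexx//.
  by rewrite ler_pdivrMr// mul0r subr_le0 ler_expR lerN2 ltW.
rewrite max_l ?ler_expR ?lerN2// divfK ?gt_eqF ?expR_gt0// c1 andbT.
have [yz|//] := leP y z.
by rewrite /c clip01_1// ler_pdivlMr// mul1r lerD2r ler_expR lerN2.
Qed.

End TestFunctions.

(** * From Laplace asymptotics to truncated moments and tails *)

Section Tauberian.
Context {R : realType} (r : R) (ell : R -> R).
Hypotheses (r_gt1 : 1 < r) (ell_sv : slowly_varying ell).
Context d (T : measurableType d) (mu : {finite_measure set T -> \bar R}).
Variables (Y : T -> R) (m : nat).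
Hypotheses (mY : measurable_fun setT Y) (Y0 : forall x, 0 <= Y x)
  (intYm : mu.-integrable setT (EFin \o (fun x => Y x ^+ m))).
Implicit Types (beta s z : R) (j n : nat).
Local Notation scale := (scale r ell).
Local Notation scaled := (scaled r ell).
Local Notation rem := (rem mu setT Y m).

Let r_gt0 : 0 < r. Proof. by rewrite (lt_trans _ r_gt1). Qed.
Let rX_gt0 n : 0 < r ^+ n. Proof. by rewrite exprn_gt0. Qed.
Let YT x : setT x -> 0 <= Y x. Proof. by move=> _; exact: Y0. Qed.
Let int1 : mu.-integrable setT (EFin \o cst 1).
Proof. exact: finite_measure_integrable_cst. Qed.

(** [j = 0] gives the truncated moment of order [m], [j = m] the tail of the law of [Y]. Keeping [j]
    free treats both in one argument. *)
Definition tail j (x : R) := \int[mu]_t ((x < Y t)%R%:R * Y t ^+ (m - j)).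
Definition low (x : R) := \int[mu]_t ((Y t <= x)%R%:R * Y t ^+ m.+1).

Lemma integrable_pow i : (i <= m)%N -> mu.-integrable setT (EFin \o (fun x => Y x ^+ i)).
Proof.
move=> im; apply: (@le_integrable _ _ _ _ _ measurableT _ (EFin \o (fun x => 1 + Y x ^+ m))).
- by apply/measurable_EFinP; exact: measurable_funX.
- move=> x _; rewrite /= lee_fin !ger0_norm ?addr_ge0 ?exprn_ge0//.
  have [Y1|Y1] := leP (Y x) 1.
    by rewrite (le_trans (exprn_ile1 _ _ _))// lerDl exprn_ge0.
  by rewrite (@le_trans _ _ (Y x ^+ m))// ?lerDr// ler_eXn2l.
- exact: (integrableD measurableT int1 intYm).
Qed.

Lemma measurable_ltY x : measurable_fun setT (fun t => (x < Y t)%R%:R : R).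
Proof.
have -> : (fun t => (x < Y t)%R%:R : R) = \1_(Y @^-1` `]x, +oo[).
  apply/funext => t; rewrite indicE; have [xY|Yx] := ltP x (Y t).
    by rewrite mem_set//= in_itv/= xY.
  by rewrite memNset//= in_itv/= ltNge Yx.
apply: measurable_indic; rewrite -[X in measurable X]setTI.
by apply: mY => //; exact: measurable_itv.
Qed.

Lemma measurable_leY x : measurable_fun setT (fun t => (Y t <= x)%R%:R : R).
Proof.
have -> : (fun t => (Y t <= x)%R%:R : R) = \1_(Y @^-1` `]-oo, x]).
  apply/funext => t; rewrite indicE; have [xY|Yx] := leP (Y t) x.
    by rewrite mem_set//= in_itv/= xY.
  by rewrite memNset//= in_itv/= leNgt Yx.
apply: measurable_indic; rewrite -[X in measurable X]setTI.
by apply: mY => //; exact: measurable_itv.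
Qed.

Lemma integrable_tail j x :
  mu.-integrable setT (EFin \o (fun t => (x < Y t)%R%:R * Y t ^+ (m - j))).
Proof.
apply: le_integrable (integrable_pow (leq_subr j m)) => //.
  apply/measurable_EFinP; apply: measurable_funM; first exact: measurable_ltY.
  exact: measurable_funX.
move=> t _; rewrite /= lee_fin normrM ler_piMl//.
by case: (x < Y t); rewrite ?normr1 ?normr0.
Qed.

Lemma integrable_low x :
  mu.-integrable setT (EFin \o (fun t => (Y t <= x)%R%:R * Y t ^+ m.+1)).
Proof.
have H : mu.-integrable setT (EFin \o cst (`|x| ^+ m.+1)) by exact: finite_measure_integrable_cst.
apply: le_integrable H => //.
  apply/measurable_EFinP; apply: measurable_funM; first exact: measurable_leY.
  exact: measurable_funX.
move=> t _; rewrite /= lee_fin normrM.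
have [Yx|_] := leP (Y t) x; last by rewrite normr0 mul0r.
rewrite normr1 mul1r ger0_norm ?exprn_ge0// (le_trans _ (ler_norm _))// lerXn2r ?nnegrE//.
by rewrite (le_trans Yx)// ler_norm.
Qed.

Lemma tail_ni j x y : x <= y -> tail j y <= tail j x.
Proof.
move=> xy; apply: le_Rintegral => //; try exact: integrable_tail.
move=> t _; rewrite ler_wpM2r ?exprn_ge0// ler_nat.
by have [yY|//] := ltP y (Y t); rewrite (le_lt_trans xy yY).
Qed.

Lemma low_nd x y : x <= y -> low x <= low y.
Proof.
move=> xy; apply: le_Rintegral => //; try exact: integrable_low.
move=> t _; rewrite ler_wpM2r ?exprn_ge0// ler_nat.
by have [Yx|//] := leP (Y t) x; rewrite (le_trans Yx xy).
Qed.

Lemma tail_ge0 j x : 0 <= tail j x.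
Proof. by apply: Rintegral_ge0 => t _; rewrite mulr_ge0 ?exprn_ge0. Qed.

Lemma low_ge0 x : 0 <= low x.
Proof. by apply: Rintegral_ge0 => t _; rewrite mulr_ge0 ?exprn_ge0. Qed.

Lemma scaleDn j beta n : scale (j%:R + beta) n = scale beta n / (r ^+ n) ^+ j.
Proof.
rewrite /scale opprD powRD ?(gt_eqF (rX_gt0 n)) ?implybT// [_ `^ (- j%:R)]powRN powR_mulrn ?ltW//.
by rewrite -mulrA mulrC.
Qed.

Lemma tauber_tail j beta q : (j <= m)%N -> logper r q ->
  asymp0 (rem 1) (fun s => s `^ beta * ell s^-1 * q s) ->
  exists F : R -> R, [/\ nonincreasing_pos F,
    forall x, 0 < x -> F @ x^'+ --> F x &
    forall x, 0 < x -> {for x, continuous F} ->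
      tail j (r ^+ n * x) / scale (j%:R + beta) n @[n --> \oo] --> F x].
Proof.
move=> jm qr gq.
have c0 n : 0 < scale beta n by rewrite scale_gt0.
pose u n x := expR (- (Y x / r ^+ n)).
pose k n x := (1 - u n x) * Y x ^+ m / scale beta n.
have u1 n x : u n x <= 1 by rewrite expR_le1 oppr_le0 divr_ge0// ltW.
have mu_ n : measurable_fun setT (u n).
  rewrite (_ : u n = fun x => expR (- ((r ^+ n)^-1 * Y x))); first exact: measurable_expN.
  by apply/funext => x; rewrite /u mulrC.
have k0 n x : 0 <= k n x.
  by rewrite divr_ge0 ?(ltW (c0 _))// mulr_ge0 ?exprn_ge0// subr_ge0.
have intk n : mu.-integrable setT (EFin \o k n).
  apply: (@le_integrable _ _ _ _ _ measurableT _ (fun x => (scale beta n)^-1%:E * (Y x ^+ m)%:E)%E).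
  - apply/measurable_EFinP; apply: measurable_funM => //.
    apply: measurable_funM; last exact: measurable_funX.
    by apply: measurable_funB.
  - move=> x _; rewrite -EFinM !abse_EFin lee_fin ger0_norm//.
    rewrite (le_trans _ (ler_norm _))// /k mulrC ler_pM2l ?invr_gt0//.
    by rewrite ler_piMl ?exprn_ge0// gerBl expR_ge0.
  - exact: (integrableZl measurableT (scale beta n)^-1 intYm).
pose G s := s `^ beta * q s.
(* [u^i (1 - u) = (1 - u^(i+1)) - (1 - u^i)], so this moment is the difference of the rescaled
   [rem 1] at [i.+1] and at [i]. For [i = 0] the second term is 0, since [rem 1] vanishes there. *)
have cvgL i : \int[mu]_(x in setT) (u n x ^+ i * k n x) @[n --> \oo] -->
    G i.+1%:R - (if i == 0%N then 0 else G i%:R).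
  have E n : \int[mu]_(x in setT) (u n x ^+ i * k n x) =
      scaled beta (rem 1) n i.+1%:R - (if i == 0%N then 0 else scaled beta (rem 1) n i%:R).
    have i1 : mu.-integrable setT (EFin \o (fun x => Y x ^+ (m.+1 - 1) * psi 1 (i.+1%:R / r ^+ n * Y x))).
      by apply: rem_integrable => //; rewrite divr_gt0.
    have i2 : mu.-integrable setT (EFin \o (fun x => Y x ^+ (m.+1 - 1) * psi 1 (i%:R / r ^+ n * Y x))).
      case: (posnP i) => [->|i0]; last by apply: rem_integrable => //; rewrite divr_gt0 ?ltr0n.
      under eq_fun do rewrite mul0r mul0r psi0 mulr0.
      exact: integrable0.
    have -> : (if i == 0%N then 0 else scaled beta (rem 1) n i%:R) = scaled beta (rem 1) n i%:R.
      case: eqP => // ->; rewrite /scaled !remE mul0r.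
      under eq_Rintegral do rewrite mul0r psi0 mulr0.
      by rewrite /Rintegral integral0 mul0r.
    rewrite /scaled -mulrBl !remE -RintegralB// -RintegralZr//; last first.
      by have := integrableB measurableT i1 i2.
    apply: eq_Rintegral => x _; rewrite subSS subn0 /k /u /= expr0 fact0 divr1.
    rewrite -expRM_natl.
    have -> : expR (- (i.+1%:R / r ^+ n * Y x)) =
        expR (i%:R * - (Y x / r ^+ n)) * expR (- (Y x / r ^+ n)).
      by rewrite -expRD; congr expR; rewrite -natr1; ring.
    rewrite (_ : - (i%:R / r ^+ n * Y x) = i%:R * - (Y x / r ^+ n)); last by ring.
    ring.
  rewrite (_ : (fun n => _) = fun n => scaled beta (rem 1) n i.+1%:R -
    (if i == 0%N then 0 else scaled beta (rem 1) n i%:R)); last by apply/funext.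
  apply: cvgB; first by apply: asymp0_scaled.
  by case: i {E} => [|i] /=; [exact: cvg_cst|apply: asymp0_scaled].
have u01 n x : setT x -> 0 <= u n x <= 1 by move=> _; rewrite expR_ge0 u1.
have kcvg := @karamata_cvg R _ T mu setT u k _ measurableT mu_ u01 (fun n x _ => k0 n x) intk cvgL.
apply: (@monotone_limit _ (fun n x => tail j (r ^+ n * x) / scale (j%:R + beta) n)).
  move=> n x y x0 xy; rewrite ler_pM2r ?invr_gt0 ?scale_gt0//.
  by rewrite tail_ni// ler_pM2l.
move=> z z' z0 zz'.
have ch := continuous_upper_test (j := j) (z' := z') z0.
have [l Hl] := kcvg _ ch.
have ih n := karamata_integrable measurableT mu_ u01 (fun n x _ => k0 n x) intk n ch.
have rY n x c : (r ^+ n * c < Y x) = (c < Y x / r ^+ n) by rewrite ltr_pdivlMr// mulrC.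
(* Passing from [scale beta] to [scale (j%:R + beta)] trades [Y^(m-j)] for [Y^m] times
   [(Y / r ^+ n)^(-j)], the factor built into [upper_test]; the weight itself is the same for all
   [j]. *)
have key n x c : 0 < c -> (c < Y x / r ^+ n)%R%:R * Y x ^+ (m - j) / scale (j%:R + beta) n =
    (if c < Y x / r ^+ n then (Y x / r ^+ n)^-1 ^+ j else 0) * (Y x ^+ m / scale beta n).
  move=> c0'; case: ifPn => [cY|_]; last by rewrite !mul0r.
  have Yx : Y x != 0.
    by apply: contraTneq cY => ->; rewrite mul0r -leNgt ltW.
  rewrite -{2}(subnK jm) exprD scaleDn !invf_div expr_div_n mul1r.
  by field; rewrite gt_eqF// expf_neq0.
have kE n x c : c * k n x = (c * (1 - u n x)) * (Y x ^+ m / scale beta n).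
  by rewrite /k !mulrA.
have w0 n x : 0 <= Y x ^+ m / scale beta n by rewrite divr_ge0 ?exprn_ge0// ltW.
exists l => e e0; move/cvgrPdist_le: Hl => /(_ e e0) Hl.
near=> n.
have : `|l - \int[mu]_(x in setT) (upper_test j z z' (u n x) * k n x)| <= e by near: n.
rewrite ler_norml => /andP[H1 H2].
have it x : mu.-integrable setT (EFin \o (fun t => ((x < Y t)%R%:R * Y t ^+ (m - j)) / scale (j%:R + beta) n)).
  exact: (integrableZr measurableT (scale (j%:R + beta) n)^-1 (integrable_tail j x)).
have Yn x : 0 <= Y x / r ^+ n by rewrite divr_ge0// ltW.
split.
  have : tail j (r ^+ n * z') / scale (j%:R + beta) n <=
      \int[mu]_(x in setT) (upper_test j z z' (u n x) * k n x).
    rewrite /tail -RintegralZr//; last exact: integrable_tail.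
    apply: le_Rintegral => //.
    move=> x _; rewrite rY key ?(lt_trans z0)// kE ler_wpM2r//.
    exact: upper_test_ge z0 zz' (Yn x).
  by move: H2; lra.
have : \int[mu]_(x in setT) (upper_test j z z' (u n x) * k n x) <=
    tail j (r ^+ n * z) / scale (j%:R + beta) n.
  rewrite /tail -RintegralZr//; last exact: integrable_tail.
  apply: le_Rintegral => //.
  move=> x _; rewrite rY key// kE ler_wpM2r//.
  exact: upper_test_le z0 zz' (Yn x).
by move: H1; lra.
Unshelve. all: by end_near. Qed.

(** The minus sign makes the nondecreasing [low] fit [monotone_limit]. The moments are now simply
    the rescaled [rem 0] at the integers [i.+1]. *)
Lemma tauber_low beta q : logper r q ->
  asymp0 (rem 0) (fun s => s `^ (beta - 1) * ell s^-1 * q s) ->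
  exists F : R -> R, [/\ nonincreasing_pos F,
    forall x, 0 < x -> F @ x^'+ --> F x &
    forall x, 0 < x -> {for x, continuous F} ->
      - (low (r ^+ n * x) / scale (beta - 1) n) @[n --> \oo] --> F x].
Proof.
move=> qr gq.
have c0 n : 0 < scale (beta - 1) n by rewrite scale_gt0.
pose u n x := expR (- (Y x / r ^+ n)).
pose k n x := u n x * Y x ^+ m.+1 / scale (beta - 1) n.
have uE n x : u n x = expR (- ((r ^+ n)^-1 * Y x)) by rewrite /u mulrC.
have mu_ n : measurable_fun setT (u n).
  rewrite (_ : u n = fun x => expR (- ((r ^+ n)^-1 * Y x))); first exact: measurable_expN.
  by apply/funext => x; rewrite uE.
have u01 n x : setT x -> 0 <= u n x <= 1.
  by move=> _; rewrite expR_ge0 expR_le1 oppr_le0 divr_ge0// ltW.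
have k0 n x : 0 <= k n x.
  by rewrite divr_ge0 ?(ltW (c0 _))// mulr_ge0 ?exprn_ge0// expR_ge0.
have intE s : 0 < s -> mu.-integrable setT (fun x => (expR (- (s * Y x)))%:E).
  exact: expN_integrable.
have il s : 0 < s -> mu.-integrable setT (EFin \o (fun x => Y x ^+ m.+1 * expR (- (s * Y x)))).
  by move=> s0; exact: lap_integrable.
have intk n : mu.-integrable setT (EFin \o k n).
  have rn : 0 < (r ^+ n)^-1 by rewrite invr_gt0.
  have := integrableZr measurableT (scale (beta - 1) n)^-1 (il _ rn).
  rewrite (_ : (fun x => _) = EFin \o k n)//; apply/funext => x.
  by rewrite /= -EFinM /k uE [_ ^+ _ * _]mulrC.
pose G s := s `^ (beta - 1) * q s.
have cvgL i : \int[mu]_(x in setT) (u n x ^+ i * k n x) @[n --> \oo] --> G i.+1%:R.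
  have E n : \int[mu]_(x in setT) (u n x ^+ i * k n x) = scaled (beta - 1) (rem 0) n i.+1%:R.
    rewrite /scaled !remE subn0 -RintegralZr//; last by apply: il; rewrite divr_gt0.
    apply: eq_Rintegral => x _; rewrite /k /u -expRM_natl.
    have -> : psi 0 (i.+1%:R / r ^+ n * Y x) =
        expR (i%:R * - (Y x / r ^+ n)) * expR (- (Y x / r ^+ n)).
      by rewrite -expRD; congr expR; rewrite -natr1; ring.
    ring.
  rewrite (_ : (fun n => _) = fun n => scaled (beta - 1) (rem 0) n i.+1%:R).
    by apply: asymp0_scaled.
  exact/funext.
have kcvg := @karamata_cvg R _ T mu setT u k _ measurableT mu_ u01 (fun n x _ => k0 n x) intk cvgL.
apply: (@monotone_limit _ (fun n x => - (low (r ^+ n * x) / scale (beta - 1) n))).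
  move=> n x y x0 xy; rewrite lerN2 ler_pM2r ?invr_gt0//.
  by rewrite low_nd// ler_pM2l.
move=> z z' z0 zz'.
have ch := @continuous_lower_test R z z'.
have [l Hl] := kcvg _ ch.
have ih n := karamata_integrable measurableT mu_ u01 (fun n x _ => k0 n x) intk n ch.
have rY n x c : (Y x <= r ^+ n * c) = (Y x / r ^+ n <= c) by rewrite ler_pdivrMr// mulrC.
have kE n x c : c * k n x = (c * u n x) * (Y x ^+ m.+1 / scale (beta - 1) n).
  by rewrite /k !mulrA.
have w0 n x : 0 <= Y x ^+ m.+1 / scale (beta - 1) n by rewrite divr_ge0 ?exprn_ge0// ltW.
exists (- l) => e e0; move/cvgrPdist_le: Hl => /(_ e e0) Hl.
near=> n.
have : `|l - \int[mu]_(x in setT) (lower_test z z' (u n x) * k n x)| <= e by near: n.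
rewrite ler_norml => /andP[H1 H2].
have it x : mu.-integrable setT (EFin \o (fun t => ((Y t <= x)%R%:R * Y t ^+ m.+1) / scale (beta - 1) n)).
  exact: (integrableZr measurableT (scale (beta - 1) n)^-1 (integrable_low x)).
split.
  have : \int[mu]_(x in setT) (lower_test z z' (u n x) * k n x) <=
      low (r ^+ n * z') / scale (beta - 1) n.
    rewrite /low -RintegralZr//; last exact: integrable_low.
    apply: le_Rintegral => //.
    move=> x _; rewrite rY kE -[leRHS]mulrA ler_wpM2r//.
    by have /andP[] := lower_test_itv (Y x / r ^+ n) zz'.
  by move: H1 H2; lra.
have : low (r ^+ n * z) / scale (beta - 1) n <=
   \int[mu]_(x in setT) (lower_test z z' (u n x) * k n x).
  rewrite /low -RintegralZr//; last exact: integrable_low.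
  apply: le_Rintegral => //.
  move=> x _; rewrite rY kE -[leLHS]mulrA ler_wpM2r//.
  by have /andP[] := lower_test_itv (Y x / r ^+ n) zz'.
by move: H1 H2; lra.
Unshelve. all: by end_near. Qed.

End Tauberian.

(** * Abelian direction *)

Section PowerIntegrals.
Context {R : realType}.
Local Notation mu := (@lebesgue_measure R).
Implicit Types (a b t : R).

Lemma is_derive_powR a t : 0 < t -> a != 0 ->
  is_derive t 1 (fun t => a^-1 * t `^ a) (t `^ (a - 1)).
Proof.
move=> t0 a0.
have D := is_derive1_powR a t0.
have -> : (fun t => a^-1 * t `^ a) = a^-1 *: (fun t => t `^ a) by [].
by apply: is_derive_eq; rewrite /GRing.scale/= mulrA mulVf// mul1r.
Qed.

Lemma integrable_powR_le1 a : - 1 < a ->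
  mu.-integrable `]0, 1]%classic (EFin \o (fun t => t `^ a)).
Proof.
move=> a1; apply/integrableP; split.
  by apply/measurable_EFinP; apply: measurable_funTS; exact: measurable_powR.
have a10 : 0 < a + 1 by rewrite -ltrBlDr sub0r.
under eq_integral do rewrite /= ger0_norm ?powR_ge0//.
rewrite (_ : integral _ _ _ = ((a + 1)^-1 * 1 `^ (a + 1) - 0)%:E) ?ltry//.
apply: (@integral_FTC_left R (fun t => (a + 1)^-1 * t `^ (a + 1)) (fun t => t `^ a) 1 0 ltr01).
- by move=> y y0; have := is_derive_powR y0 (lt0r_neq0 a10); rewrite addrK.
- by move=> y _; exact: powR_ge0.
- by move=> y; exact: continuous_powR.
- rewrite -[X in _ --> X](mulr0 (a + 1)^-1); apply: cvgM; first exact: cvg_cst.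
  exact: powR_cvg0.
Qed.

Lemma powR_cvgN a : a < 0 -> t `^ a @[t --> +oo] --> 0.
Proof.
move=> a0; apply/cvgrPdist_lt => e e0.
have a0' : 0 < - a^-1 by rewrite oppr_gt0 invr_lt0.
exists (e `^ a^-1); split => [|t et]; first exact: num_real.
have t0 : 0 < t by rewrite (lt_trans _ et)// powR_gt0.
rewrite sub0r normrN ger0_norm ?powR_ge0//.
have : t `^ a < (e `^ a^-1) `^ a.
  have E x : 0 < x -> x `^ a = (x `^ (- a))^-1 by move=> x0; rewrite powRN invrK.
  rewrite !E ?powR_gt0// ltf_pV2 ?posrE ?powR_gt0//.
  by apply: gt0_ltr_powR; rewrite ?oppr_gt0// nnegrE ltW// powR_gt0.
by rewrite -powRrM mulVf ?lt_eqF// powRr1// ltW.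
Qed.

Lemma integrable_powR_gt1 a : a < - 1 ->
  mu.-integrable `]1, +oo[%classic (EFin \o (fun t => t `^ a)).
Proof.
move=> a1; apply/integrableP; split.
  by apply/measurable_EFinP; apply: measurable_funTS; exact: measurable_powR.
have a10 : a + 1 < 0 by rewrite -ltrBrDr sub0r.
under eq_integral do rewrite /= ger0_norm ?powR_ge0//.
rewrite (_ : integral _ _ _ = (0 - (a + 1)^-1 * 1 `^ (a + 1))%:E) ?ltry//.
apply: (@integral_FTC_right R (fun t => (a + 1)^-1 * t `^ (a + 1)) (fun t => t `^ a) 1 0 ltr01).
- by move=> y y0; have := is_derive_powR y0 (ltr0_neq0 a10); rewrite addrK.
- by move=> y _; exact: powR_ge0.
- by move=> y; exact: continuous_powR.
- rewrite -[X in _ --> X](mulr0 (a + 1)^-1); apply: cvgM; first exact: cvg_cst.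
  exact: powR_cvgN.
Qed.

Definition pow_glue a b t := if t <= 1 then t `^ a else t `^ b.

Lemma integrable_pow_glue a b : - 1 < a -> b < - 1 ->
  mu.-integrable `]0, +oo[%classic (EFin \o pow_glue a b).
Proof.
move=> a1 b1.
have E : `]0, +oo[%classic = `]0%R, 1%R]%classic `|` `]1%R, +oo[%classic :> set R.
  by rewrite -itv_bndbnd_setU ?bnd_simp.
have i1 : mu.-integrable `]0%R, 1%R]%classic (EFin \o pow_glue a b).
  apply: eq_integrable (integrable_powR_le1 a1) => // t.
  by rewrite inE/= in_itv/= /pow_glue => /andP[_ ->].
have i2 : mu.-integrable `]1%R, +oo[%classic (EFin \o pow_glue a b).
  apply: eq_integrable (integrable_powR_gt1 b1) => // t.
  by rewrite inE/= in_itv/= andbT /pow_glue leNgt => ->.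
have /integrableP[m1 f1] := i1; have /integrableP[m2 f2] := i2.
have m12 : measurable_fun ((`]0%R, 1%R]%classic : set R) `|` `]1%R, +oo[%classic) (EFin \o pow_glue a b).
  by apply/measurable_funU.
rewrite E; apply/integrableP; split => //.
rewrite ge0_integral_setU//=.
- by rewrite lte_add_pinfty.
- apply/measurable_EFinP; apply: measurableT_comp => //; exact/measurable_EFinP.
- apply/disj_setPS => t; rewrite /= !in_itv/= andbT => -[/andP[_ t1]].
  by rewrite ltNge t1.
Qed.

End PowerIntegrals.

Section Potter.
Context {R : realType} (r : R) (ell : R -> R).
Hypotheses (r_gt1 : 1 < r) (ell_sv : slowly_varying ell).
Local Notation scale := (scale r ell).

(** The natural exponent [- g] is relaxed by [e] on either side of 1, in exchange for a bound
    uniform in [n]. [ratio_bound] for [scale g] moves to later blocks when [t > 1], and for its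
    inverse to earlier blocks when [t <= 1]. *)
Lemma potter_bound (g e : R) (f : R -> R) (C0 C1 : R) : 0 <= g -> 0 < e ->
  (forall x, 0 <= f x) ->
  (forall k x, r ^+ k <= x <= r ^+ k.+1 -> f x <= C0 * scale g k) ->
  (forall x, 0 < x -> x <= 1 -> f x <= C1) ->
  exists2 C : R, 0 < C & forall n t, 0 < t ->
    f (r ^+ n * t) / scale g n <= C * pow_glue (- (g + e)) (e - g) t.
Proof.
move=> g0 e0 f0 f1 f2.
have r0 : 0 < r by rewrite (lt_trans _ r_gt1).
have rX n : 0 < r ^+ n by rewrite exprn_gt0.
have c0 n : 0 < scale g n by rewrite scale_gt0.
have C00 : 0 <= C0.
  have : 0 <= C0 * scale g 0.
    by rewrite (le_trans (f0 1))// f1// expr0 lexx expr1 ltW.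
  by rewrite pmulr_lge0.
have C10 : 0 <= C1 by rewrite (le_trans (f0 1))// f2.
have [K [K1 [K0 K10 HK]]] := powR_itv_bounds (e - g) r (@ltr01 R).
have [M [M1 [M0 M10 HM]]] := powR_itv_bounds (g + e) r (@ltr01 R).
have rVr : 0 < r^-1 by rewrite invr_gt0.
have [K' [K2 [K'0 K20 HK']]] := powR_itv_bounds (e - g) 1 rVr.
have re1 : 1 < r `^ e by exact: powR_gt1.
have rr : r != 0 by rewrite gt_eqF.
have rho1 : r `^ (- g) < r `^ (e - g).
  by rewrite powRD ?rr ?implybT// ltr_pMl ?powR_gt0.
have rho2 : (r `^ (- g))^-1 < r `^ (g + e).
  by rewrite powRN invrK powRD ?rr ?implybT// ltr_pMr ?powR_gt0.
have [D1 D10 HD1] := ratio_bound c0 (@scale_ratio _ _ _ r_gt1 ell_sv g) rho1 (powR_gt0 _ r0).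
have cV0 n : 0 < (scale g n)^-1 by rewrite invr_gt0.
have cVr : (scale g n.+1)^-1 / (scale g n)^-1 @[n --> \oo] --> (r `^ (- g))^-1.
  rewrite (_ : (fun n => _) = fun n => (scale g n.+1 / scale g n)^-1); last first.
    by apply/funext => n; rewrite [RHS]invfM.
  by apply: cvgV; [rewrite gt_eqF ?powR_gt0|exact: scale_ratio].
have [D2 D20 HD2] := ratio_bound cV0 cVr rho2 (powR_gt0 _ r0).
have D2E n k : scale g n <= D2 * (r `^ (g + e)) ^+ k * scale g (n + k)%N.
  by have := HD2 n k; rewrite ler_pdivlMr// [_^-1 * _]mulrC ler_pdivrMr.
have pX a k : (r `^ a) ^+ k = (r ^+ k) `^ a.
  rewrite -(powR_mulrn k (ltW r0)) -(powR_mulrn k (powR_ge0 r a)); exact: powRAC.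
have s00 : 0 < scale g 0 by [].
pose C := C0 * D1 * K2 + C0 * D2 * M1 + C1 / scale g 0 * D2 * M1 + 1.
have P1 : 0 <= C0 * D1 * K2 by do 2 (apply: mulr_ge0 => //; try exact: ltW).
have P2 : 0 <= C0 * D2 * M1 by do 2 (apply: mulr_ge0 => //; try exact: ltW).
have P3' : 0 <= C1 / scale g 0 by rewrite divr_ge0// ltW.
have P3 : 0 <= C1 / scale g 0 * D2 * M1 by do 2 (apply: mulr_ge0 => //; try exact: ltW).
exists C => [|n t t0]; first by rewrite /C; lra.
suff [B BC H] : exists2 B, B <= C & f (r ^+ n * t) / scale g n <= B * pow_glue (- (g + e)) (e - g) t.
  rewrite (le_trans H)// ler_wpM2r//.
  by rewrite /pow_glue; case: ifP => _; exact: powR_ge0.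
rewrite /pow_glue; have [t1|t1] := leP t 1; last first.
  have [k /andP[kt tk]] := exprn_floor r_gt1 (ltW t1).
  exists (C0 * D1 * K2); first by rewrite /C; lra.
  have Hf : f (r ^+ n * t) <= C0 * scale g (n + k).
    apply: f1; rewrite exprD ler_pM2l// kt/= -addnS exprD ler_pM2l// ltW//.
  rewrite ler_pdivrMr// (le_trans Hf)//.
  apply: (@le_trans _ _ (C0 * (D1 * (r `^ (e - g)) ^+ k * scale g n))).
    by rewrite ler_wpM2l.
  rewrite pX.
  have /andP[_ H] : K' <= (r ^+ k / t) `^ (e - g) <= K2.
    apply: HK'; rewrite ler_pdivrMr// mul1r kt andbT ler_pdivlMr// mulrC ler_pdivrMr//.
    by rewrite -exprSr ltW.
  have {}H : (r ^+ k) `^ (e - g) <= K2 * t `^ (e - g).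
    have := ler_wpM2r (powR_ge0 t (e - g)) H.
    by rewrite -powRM ?divr_ge0 ?(ltW t0) ?(ltW (rX k))// divfK ?gt_eqF.
  rewrite -!mulrA ler_wpM2l// ler_pM2l// mulrA ler_pM2r//.
have tV : 1 <= t^-1 by rewrite invf_ge1.
have [k /andP[kt tk]] := exprn_floor r_gt1 tV.
have tk1 : 1 <= r ^+ k.+1 * t by rewrite -ler_pdivrMr// mul1r ltW.
have tkr : r ^+ k.+1 * t <= r by rewrite exprS -mulrA ger_pMr// -ler_pdivlMr// mul1r.
have Hp : (r ^+ k.+1) `^ (g + e) <= M1 * t `^ (- (g + e)).
  have /andP[_ H] : M <= (r ^+ k.+1 * t) `^ (g + e) <= M1 by apply: HM; rewrite tk1.
  by rewrite powRN ler_pdivlMr ?powR_gt0// -powRM// ltW.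
have [kn|nk] := ltnP k n.
  exists (C0 * D2 * M1); first by rewrite /C; lra.
  have nE : n = (n - k.+1 + k.+1)%N by rewrite subnK.
  have Hf : f (r ^+ n * t) <= C0 * scale g (n - k.+1).
    have rE : r ^+ n * t = r ^+ (n - k.+1) * (r ^+ k.+1 * t) by rewrite mulrA -exprD subnK.
    apply: f1; rewrite rE [r ^+ (n - k.+1).+1]exprSr; apply/andP; split; last by rewrite ler_pM2l.
    by rewrite ler_peMr// ltW.
  rewrite ler_pdivrMr// (le_trans Hf)//.
  apply: (@le_trans _ _ (C0 * (D2 * (r `^ (g + e)) ^+ k.+1 * scale g n))).
    by rewrite ler_wpM2l// [in leRHS]nE D2E.
  by rewrite pX -!mulrA ler_wpM2l// ler_pM2l// mulrA ler_pM2r.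
(* Here [r ^+ n * t <= 1] lies below all the blocks and only [C1] is available; it is compared with
   [scale g n] through [scale g 0], the loss of [n] steps being covered by [k.+1 > n] steps of
   [t]. *)
exists (C1 / scale g 0 * D2 * M1); first by rewrite /C; lra.
have Hf : f (r ^+ n * t) <= C1.
  apply: f2; first by rewrite mulr_gt0.
  apply: (@le_trans _ _ (r ^+ k * t)); first by rewrite ler_pM2r// ler_weXn2l// ltW.
  by rewrite -ler_pdivlMr// mul1r.
rewrite ler_pdivrMr// (le_trans Hf)//.
have H : scale g 0 <= D2 * (r `^ (g + e)) ^+ k.+1 * scale g n.
  rewrite (le_trans (D2E 0%N n))// add0n ler_pM2r// ler_pM2l// ler_weXn2l//.
    by rewrite ltW// powR_gt1// ltr_wpDl.
  exact: leqW.
rewrite -[leLHS](divfK (_ : scale g 0 != 0)) ?gt_eqF//.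
apply: (@le_trans _ _ (C1 / scale g 0 * (D2 * (r `^ (g + e)) ^+ k.+1 * scale g n))).
  exact: ler_wpM2l.
rewrite pX -!mulrA ler_wpM2l// ler_wpM2l ?invr_ge0 ?(ltW s00)// ler_pM2l// mulrA ler_pM2r//.
Qed.

End Potter.

Section TonelliKernel.
Context {R : realType} d (T : measurableType d).
Variable mu : {sigma_finite_measure set T -> \bar R}.
Local Notation leb := (@lebesgue_measure R).
Local Notation pos := (`]0%R, +oo[%classic : set R).

(** A layer-cake formula with an arbitrary region [E]: it is used with [t < Y] for tails and with
    [Y <= t] for [low]. Sigma-finiteness lets it apply to Lebesgue and Stieltjes measures as
    well. *)
Lemma tonelli_kernel (E : T -> R -> bool) (k : R -> R) (w : T -> R) :
  measurable_fun setT (fun xt : T * measurableTypeR R => E xt.1 xt.2) ->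
  measurable_fun pos k -> (forall t, 0 < t -> 0 <= k t) ->
  measurable_fun setT w -> (forall x, 0 <= w x) ->
  (\int[mu]_x ((w x)%:E * \int[leb]_(t in `]0%R, +oo[) ((E x t)%:R * k t)%:E) =
   \int[leb]_(t in `]0%R, +oo[) ((k t)%:E * \int[mu]_x ((E x t)%:R * w x)%:E))%E.
Proof.
move=> mE mk k0 mw w0.
pose k' : measurableTypeR R -> R := k \_ pos.
have mk' : measurable_fun setT k' by exact/(measurable_restrictT _ _).1.
have k'0 t : 0 <= k' t.
  rewrite /k' patchE; case: ifP => //; rewrite inE/= in_itv/= andbT; exact: k0.
have mEf : measurable_fun setT (fun xt : T * measurableTypeR R => (E xt.1 xt.2)%:R : R).
  rewrite (_ : (fun xt => _) = fun xt => if E xt.1 xt.2 then 1 else 0 : R).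
    exact: measurable_fun_ifT.
  by apply/funext => xt; case: (E _ _).
pose f (xt : T * measurableTypeR R) := ((E xt.1 xt.2)%:R * k' xt.2 * w xt.1)%:E.
have mf : measurable_fun setT f.
  apply/measurable_EFinP; apply: measurable_funM; first apply: measurable_funM => //.
    exact: (measurableT_comp mk').
  exact: (measurableT_comp mw).
have f0 xt : (0 <= f xt)%E by rewrite lee_fin !mulr_ge0.
have mE1 x : measurable_fun setT (fun t : measurableTypeR R => (E x t)%:R : R).
  exact: (measurableT_comp mEf (pair1_measurable x)).
have mE2 t : measurable_fun setT (fun x => (E x t)%:R : R).
  exact: (measurableT_comp mEf (pair2_measurable t)).
have := @fubini_tonelli _ _ _ _ _ mu leb f mf f0.
rewrite (_ : (\int[mu]_x \int[leb]_y f (x, y))%E =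
  (\int[mu]_x ((w x)%:E * \int[leb]_(t in `]0%R, +oo[) ((E x t)%:R * k t)%:E))%E); last first.
  apply: eq_integral => x _.
  rewrite [in RHS]integral_mkcond -ge0_integralZl//=; last 3 first.
  - apply/(measurable_restrictT _ _).1 => //; apply/measurable_EFinP.
    by apply: measurable_funM => //; exact: measurable_funTS.
  - move=> t _; rewrite patchE; case: ifPn => // t0; rewrite lee_fin mulr_ge0// k0//.
    by move: t0; rewrite inE/= in_itv/= andbT.
  - by rewrite lee_fin.
  apply: eq_integral => t _; rewrite /f/= /k' !patchE.
  by case: ifP => _; rewrite ?mule0 ?mulr0 ?mul0r// -EFinM; congr EFin; rewrite mulrC.
move=> ->; rewrite [RHS]integral_mkcond; apply: eq_integral => t _.
rewrite patchE /f/= /k' patchE; case: ifPn => [t0|_]; last first.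
  by rewrite integral0_eq// => x _; rewrite mulr0 mul0r.
rewrite -ge0_integralZl//=.
- by apply: eq_integral => x _; rewrite -EFinM; congr EFin; rewrite mulrCA mulrA.
- by apply/measurable_EFinP; exact: measurable_funM.
- by move=> x _; rewrite lee_fin mulr_ge0.
- by rewrite lee_fin k0//; move: t0; rewrite inE/= in_itv/= andbT.
Qed.

End TonelliKernel.

Section AbelianLimit.
Context {R : realType} (r : R) (ell : R -> R).
Hypotheses (r_gt1 : 1 < r) (ell_sv : slowly_varying ell).
Local Notation scale := (scale r ell).
Local Notation leb := (@lebesgue_measure R).
Local Notation pos := (`]0%R, +oo[%classic : set R).

(** The majorant is the envelope of the kernel times the Potter envelope of [f]; the two conditions
    on exponents are its integrability at 0 and at infinity. The countable set [A] is negligible. *)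
Lemma abelian_dct (g e K p p' C0 C1 : R) (k f F : R -> R) (A : set R) :
  0 <= g -> 0 < e -> (forall x, 0 <= f x) -> measurable_fun setT f ->
  (forall k x, r ^+ k <= x <= r ^+ k.+1 -> f x <= C0 * scale g k) ->
  (forall x, 0 < x -> x <= 1 -> f x <= C1) ->
  measurable_fun pos k -> (forall t, 0 < t -> 0 <= k t) ->
  (forall t, 0 < t -> k t <= K * pow_glue p p' t) ->
  - 1 < p - (g + e) -> p' + (e - g) < - 1 ->
  countable A ->
  (forall t, 0 < t -> ~ A t -> f (r ^+ n * t) / scale g n @[n --> \oo] --> F t) ->
  measurable_fun pos F ->
  leb.-integrable pos (fun t => (k t * F t)%:E) /\
  (\int[leb]_(t in `]0%R, +oo[) (k t * (f (r ^+ n * t) / scale g n))%:E)%E @[n --> \oo] -->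
    (\int[leb]_(t in `]0%R, +oo[) (k t * F t)%:E)%E.
Proof.
move=> g0 e0 f0 mf f1 f2 mk k0 kK pge p'ge cA fF mF.
have [C C_gt0 HC] := potter_bound r_gt1 ell_sv g0 e0 f0 f1 f2.
have mf' n : measurable_fun pos (fun t => k t * (f (r ^+ n * t) / scale g n)).
  apply: measurable_funM => //; apply: measurable_funTS; apply: measurable_funM => //.
  apply: measurableT_comp => //; exact: measurable_funM.
have Ig : leb.-integrable pos (fun t => ((K * C) * pow_glue (p - (g + e)) (p' + (e - g)) t)%:E).
  by apply: eq_integrable (integrableZl _ (K * C) (integrable_pow_glue pge p'ge)) => //.
have [| | | | |I1 _ I2] := @dominated_convergence _ _ _ leb _ (measurable_itv `]0%R, +oo[)
  (fun n t => (k t * (f (r ^+ n * t) / scale g n))%:E) (fun t => (k t * F t)%:E)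
  (fun t => ((K * C) * pow_glue (p - (g + e)) (p' + (e - g)) t)%:E) => //.
- by move=> n; apply/measurable_EFinP; exact: mf'.
- by apply/measurable_EFinP; exact: measurable_funM.
- exists A; split.
  + exact: countable_measurable.
  + exact: countable_lebesgue_measure0.
  + move=> t /= /not_implyP[]; rewrite in_itv/= andbT => t0 H; apply: contrapT => At.
    apply: H; apply: cvg_EFin; first exact: nearW.
    by apply: cvgM; [exact: cvg_cst|exact: fF].
- apply: aeW => t n; rewrite /= in_itv/= andbT => t0.
  have fn0 : 0 <= f (r ^+ n * t) / scale g n by rewrite divr_ge0// ltW ?scale_gt0.
  have kf0 := mulr_ge0 (k0 t t0) fn0.
  rewrite lee_fin (ger0_norm kf0).
  have := ler_pM (k0 t t0) fn0 (kK t t0) (HC n t t0).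
  rewrite mulrACA /pow_glue; case: ifP => _; rewrite -powRD// (gt_eqF t0) implybT//.
Qed.

End AbelianLimit.

Section Kernels.
Context {R : realType}.
Local Notation leb := (@lebesgue_measure R).
Local Notation pos := (`]0%R, +oo[%classic : set R).
Implicit Types (s t u : R) (j : nat).

Lemma nonincreasing_pos_measurable (F : R -> R) : nonincreasing_pos F -> measurable_fun pos F.
Proof.
move=> Fni.
have mFe : measurable_fun setT (F \o expR).
  apply: nonincreasing_measurable => // x y xy; apply: Fni; first exact: expR_gt0.
  by rewrite ler_expR.
have : measurable_fun pos ((F \o expR) \o (@ln R)).
  apply: (measurableT_comp mFe); apply: measurable_funTS; exact: measurable_ln.
apply: eq_measurable_fun => t; rewrite inE/= in_itv/= andbT => t0.
by rewrite /= lnK.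
Qed.

Lemma integral_kernel_lt (K k : R -> R) u : 0 <= u -> K 0 = 0 ->
  (forall y : R, 0 < y -> is_derive y 1 K (k y)) ->
  (forall y : R, 0 < y -> 0 <= k y) ->
  (forall y : R, 0 < y -> {for y, continuous k}) ->
  K y @[y --> 0^'+] --> 0 ->
  (\int[leb]_(t in pos) ((t < u)%R%:R * k t)%:E = (K u)%:E)%E.
Proof.
move=> u0 K0 Kk k0 kc Kl.
have [->|uN0] := eqVneq u 0.
  rewrite K0 integral0_eq// => t; rewrite /= in_itv/= andbT => t0.
  by rewrite ltNge ltW// mul0r.
have {}u0 : 0 < u by rewrite lt_neqAle eq_sym uN0.
have mk : measurable_fun (`]0, u[%classic : set R) (fun t => (k t)%:E).
  apply/measurable_EFinP; apply: (@measurable_funS _ _ _ _ pos) => //.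
    by move=> t; rewrite /= !in_itv/= andbT => /andP[].
  apply: open_continuous_measurable_fun; first exact: interval_open.
  by move=> y; rewrite inE/= in_itv/= andbT; exact: kc.
have := integral_FTC_left u0 Kk k0 kc Kl.
rewrite subr0 (@integral_itv_bndoo R 0 u (fun t => (k t)%:E) false false mk) => <-.
have -> : `]0, u[%classic = pos `&` [set t | t < u].
  by apply/seteqP; split => t /=; rewrite !in_itv/= andbT => /andP.
rewrite integral_mkcondr; apply: eq_integral => t _; rewrite patchE.
have [tu|ut] := ltP t u; first by rewrite mem_set// mul1r.
by rewrite memNset ?mul0r//= => /lt_geF; rewrite ut.
Qed.

Lemma integral_kernel_ge s u : 0 < s -> 0 <= u ->
  (\int[leb]_(t in pos) ((u <= t)%R%:R * (s * expR (- (s * t))))%:E = (expR (- (s * u)))%:E)%E.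
Proof.
move=> s0 u0.
have E t : is_derive t 1 (fun t => - expR (- (s * t))) (s * expR (- (s * t))).
  have D1 : is_derive t 1 (fun t : R => s * t) s.
    have -> : (fun t : R => s * t) = s *: id by [].
    by apply: is_derive_eq; rewrite /GRing.scale/= mulr1.
  have D2 := @is_derive1_comp _ (fun x => expR (- x)) (fun t => s * t) t _ _
    (is_derive_expN (s * t)) D1.
  have -> : (fun t => - expR (- (s * t))) = - ((fun x => expR (- x)) \o (fun t : R => s * t)).
    by apply/funext => z.
  by apply: is_derive_eq; rewrite mulNr opprK mulrC.
have ck : continuous (fun t => s * expR (- (s * t))).
  move=> t; apply: cvgM; first exact: cvg_cst.
  apply: (@continuous_comp _ _ _ (fun t => - (s * t)) expR); last exact: continuous_expR.
  by apply: continuousN; exact: mulrl_continuous.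
have cl : - expR (- (s * t)) @[t --> +oo] --> 0.
  rewrite -[X in _ --> X]oppr0; apply: cvgN.
  have sy : s * t @[t --> +oo] --> +oo.
    apply/cvgryPge => A; exists (A / s); split => [|t At]; first exact: num_real.
    by rewrite /= mulrC -ler_pdivrMr// ltW.
  exact: (cvg_comp (fun t => s * t) (fun x => expR (- x)) sy (@cvgr_expR R)).
have mk : measurable_fun setT (fun t => (s * expR (- (s * t)))%:E).
  by apply/measurable_EFinP; exact: continuous_measurable_fun.
have FTC : (\int[leb]_(t in `[u, +oo[) (s * expR (- (s * t)))%:E = (expR (- (s * u)))%:E)%E.
  rewrite (@ge0_continuous_FTC2y R _ (fun t => - expR (- (s * t))) u 0).
  - by rewrite EFinN oppeK add0e.
  - by move=> t _; rewrite mulr_ge0 ?expR_ge0// ltW.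
  - exact: continuous_subspaceT.
  - exact: cl.
  - by move=> t _; have [] := E t.
  - by apply: cvg_at_right_filter; exact: is_derive_continuous (E u).
  - by move=> t _; rewrite derive1E; exact: derive_val.
rewrite -FTC.
transitivity (\int[leb]_(t in pos `&` [set t | (u <= t)%R]) (s * expR (- (s * t)))%:E)%E.
  rewrite [RHS]integral_mkcondr; apply: eq_integral => t _; rewrite patchE.
  have [tu|ut] := leP u t; first by rewrite mem_set// mul1r.
  by rewrite memNset ?mul0r//= => /le_gtF; rewrite ut.
have [u00|uN0] := eqVneq u 0.
  rewrite u00 -integral_itv_obnd_cbnd; last exact: measurable_funTS.
  congr integral; apply/seteqP; split => t /=; rewrite in_itv/= andbT; first by case.
  by move=> t0; split => //; exact: ltW.
congr integral; apply/seteqP; split => t /=; rewrite !in_itv/= !andbT; first by case.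
by move=> ut; split => //; rewrite (lt_le_trans _ ut)// lt_neqAle eq_sym uN0.
Unshelve. all: by end_near. Qed.

Definition kern j s t := j%:R * t ^+ j.-1 * psi 1 (s * t) + t ^+ j * (s * expR (- (s * t))).

Lemma is_derive_kern j s t : is_derive t 1 (fun t => t ^+ j * psi 1 (s * t)) (kern j s t).
Proof.
have D1 : is_derive t 1 (fun t : R => s * t) s.
  have -> : (fun t : R => s * t) = s *: id by [].
  by apply: is_derive_eq; rewrite /GRing.scale/= mulr1.
have D2 := @is_derive1_comp _ (psi 1) (fun t => s * t) t _ _ (is_derive_psi 0 (s * t)) D1.
have -> : (fun t => t ^+ j * psi 1 (s * t)) = (id ^+ j) * (psi 1 \o (fun t => s * t)).
  by apply/funext => x; rewrite mulrfctE exprfctE.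
apply: is_derive_eq; rewrite /GRing.scale/= ?exprfctE mulr1.
rewrite /kern /=; ring.
Qed.

Lemma kern_ge0 j s t : 0 < s -> 0 < t -> 0 <= kern j s t.
Proof.
move=> s0 t0; have st : 0 <= s * t by rewrite mulr_ge0// ltW.
by rewrite addr_ge0 ?mulr_ge0 ?psi_ge0 ?exprn_ge0 ?expR_ge0// ltW.
Qed.

Lemma continuous_kern j s t : {for t, continuous (kern j s)}.
Proof.
have c1 k : continuous (fun t : R => t ^+ k) by exact: exprn_continuous.
have c2 k : continuous (fun t => psi k (s * t)).
  move=> x; apply: (@continuous_comp _ _ _ (fun t => s * t) (psi k)); last exact: continuous_psi.
  exact: mulrl_continuous.
apply: cvgD; apply: cvgM.
- by apply: cvgM; [exact: cvg_cst|exact: c1].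
- exact: c2.
- exact: c1.
- by apply: cvgM; [exact: cvg_cst|exact: (c2 0%N)].
Qed.

Lemma kern_cvg0 j s : (fun t => t ^+ j * psi 1 (s * t)) t @[t --> 0^'+] --> 0.
Proof.
have D := is_derive_kern j s 0.
have E : 0 ^+ j * psi 1 (s * 0) = 0 :> R by rewrite mulr0 psi0 mulr0.
rewrite -[X in _ --> X]E; apply: cvg_at_right_filter; exact: is_derive_continuous D.
Qed.

Lemma kern_le j s t : 0 < s -> 0 < t ->
  kern j s t <= (j.+1%:R * (s + 1)) * pow_glue j%:R (j%:R - 1) t.
Proof.
move=> s0 t0; have st : 0 <= s * t by rewrite mulr_ge0// ltW.
have H1 : s * t * expR (- (s * t)) <= psi 1 (s * t).
  by have := psi_deriv_le 0 st; rewrite mul1r.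
have kt : kern j s t * t <= j.+1%:R * (t ^+ j * psi 1 (s * t)).
  have -> : kern j s t * t = j%:R * (t ^+ j * psi 1 (s * t)) + t ^+ j * (s * t * expR (- (s * t))).
    rewrite /kern mulrDl; case: j {H1} => [|j]; first by rewrite !mul0r !add0r; ring.
    by rewrite /= exprS; ring.
  rewrite -natr1 mulrDl mul1r lerD2l ler_wpM2l ?exprn_ge0// ltW//.
rewrite -(ler_pM2r t0) (le_trans kt)// -!mulrA ler_wpM2l// /pow_glue.
have s1 : 0 < s + 1 by rewrite addr_gt0.
have [t1|t1] := leP t 1.
  rewrite powR_mulrn ?(ltW t0)// [leRHS]mulrCA ler_wpM2l ?exprn_ge0 ?(ltW t0)//.
  rewrite (@le_trans _ _ (s * t))//; last by rewrite ler_pM2r// lerDl.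
  by rewrite /= expr0 fact0 divr1; have := expR_ge1Dx (- (s * t)); lra.
rewrite powRB; last by rewrite (gt_eqF t0) implybT.
rewrite powR_mulrn ?(ltW t0)// powRr1 ?(ltW t0)// divfK ?(gt_eqF t0)//.
rewrite [leRHS]mulrC ler_wpM2l ?exprn_ge0 ?(ltW t0)//.
by rewrite (le_trans (psi_le 0 st))// expr0 lerDr ltW.
Qed.

(** For [j = 0] the general bound [kern_le] only gives the exponent -1 at infinity, which leaves no
    room when [beta = 0]; the exponent -2 does. *)
Lemma exp_kern_le s t : 0 < s -> 0 < t ->
  s * expR (- (s * t)) <= (s + 4 / s) * pow_glue 0 (- 2) t.
Proof.
move=> s0 t0; have st : 0 <= s * t by rewrite mulr_ge0// ltW.
rewrite /pow_glue; have [t1|t1] := leP t 1.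
  rewrite powRr0 mulr1 (@le_trans _ _ s)//; last by rewrite lerDl divr_ge0// ltW.
  by rewrite ler_piMr ?(ltW s0)// expR_le1 oppr_le0.
have := sqr_expN_le st; have := psi_le 0 st; rewrite expr0 => H1 H2.
have -> : t `^ (- 2) = (t ^+ 2)^-1 by rewrite powRN powR_mulrn ?(ltW t0).
rewrite ler_pdivlMr ?exprn_gt0// (@le_trans _ _ (4 / s))//; last by rewrite lerDr ltW.
rewrite ler_pdivlMr// (le_trans _ (_ : 4 * psi 1 (s * t) <= _))//; last first.
  by rewrite -[leRHS]mulr1 ler_pM2l.
by apply: le_trans H2; rewrite exprMn le_eqVlt; apply/orP; left; apply/eqP; ring.
Qed.

End Kernels.

Section Abelian.
Context {R : realType} (r : R) (ell : R -> R).
Hypotheses (r_gt1 : 1 < r) (ell_sv : slowly_varying ell).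
Context d (T : measurableType d) (mu : {finite_measure set T -> \bar R}).
Variables (Y : T -> R) (m : nat).
Hypotheses (mY : measurable_fun setT Y) (Y0 : forall x, 0 <= Y x)
  (intYm : mu.-integrable setT (EFin \o (fun x => Y x ^+ m))).
Implicit Types (beta s t z : R) (j n : nat) (F : R -> R) (A : set R).
Local Notation scale := (scale r ell).
Local Notation scaled := (scaled r ell).
Local Notation rem := (rem mu setT Y m).
Local Notation tail := (tail mu Y m).
Local Notation low := (low mu Y m).
Local Notation leb := (@lebesgue_measure R).
Local Notation pos := (`]0%R, +oo[%classic : set R).

Let r_gt0 : 0 < r. Proof. by rewrite (lt_trans _ r_gt1). Qed.
Let rX_gt0 n : 0 < r ^+ n. Proof. by rewrite exprn_gt0. Qed.
Let YT x : setT x -> 0 <= Y x. Proof. by move=> _; exact: Y0. Qed.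
Let int1 : mu.-integrable setT (EFin \o cst 1).
Proof. exact: finite_measure_integrable_cst. Qed.

Let measurable_Yn n : measurable_fun setT (fun xt : T * measurableTypeR R => Y xt.1 / r ^+ n).
Proof.
apply: measurable_funM => //.
exact: (measurableT_comp mY).
Qed.

(** [Y^m psi_1(s Y)] is split as [Y^(m-j)] times [Y^j psi_1(s Y)], and the second factor is the
    integral of [kern j s] over []0, Y[]. *)
Lemma rem1_repr j beta s n : (j <= m)%N -> 0 < s ->
  ((scaled beta (rem 1) n s)%:E = \int[leb]_(t in pos)
    (kern j s t * (tail j (r ^+ n * t) / scale (j%:R + beta) n))%:E)%E.
Proof.
move=> jm s0.
have c0 : 0 < scale (j%:R + beta) n by rewrite scale_gt0.
have sn0 : 0 < s / r ^+ n by rewrite divr_gt0.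
have ir : mu.-integrable setT (EFin \o (fun x => Y x ^+ (m.+1 - 1) * psi 1 (s / r ^+ n * Y x))).
  exact: rem_integrable.
have ir' : mu.-integrable setT
    (EFin \o (fun x => Y x ^+ (m.+1 - 1) * psi 1 (s / r ^+ n * Y x) / scale beta n)).
  exact: (integrableZr measurableT (scale beta n)^-1 ir).
pose w x := Y x ^+ (m - j) / scale (j%:R + beta) n.
have w0 x : 0 <= w x by rewrite divr_ge0 ?exprn_ge0// ltW.
have mw : measurable_fun setT w.
  by apply: measurable_funM => //; exact: measurable_funX.
have mk : measurable_fun pos (kern j s).
  apply: measurable_funTS; apply: continuous_measurable_fun => t; exact: continuous_kern.
have k0 t : 0 < t -> 0 <= kern j s t by exact: kern_ge0.
have mE : measurable_fun setT (fun xt : T * measurableTypeR R => xt.2 < Y xt.1 / r ^+ n).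
  by apply: measurable_fun_ltr => //; exact: measurable_Yn.
have := @tonelli_kernel R _ T mu (fun x t => t < Y x / r ^+ n) (kern j s) w mE mk k0 mw w0.
rewrite (_ : (\int[mu]_x _)%E = (scaled beta (rem 1) n s)%:E); last first.
  rewrite /scaled !remE -RintegralZr// /Rintegral fineK; last exact: integrable_fin_num.
  apply: eq_integral => x _.
  rewrite (_ : (\int[leb]_(t in pos) _)%E =
      ((Y x / r ^+ n) ^+ j * psi 1 (s * (Y x / r ^+ n)))%:E); last first.
    apply: (@integral_kernel_lt R (fun t => t ^+ j * psi 1 (s * t))).
    - by rewrite divr_ge0// ltW.
    - by rewrite mulr0 psi0 mulr0.
    - by move=> y _; exact: is_derive_kern.
    - by move=> y; exact: kern_ge0.
    - by move=> y _; exact: continuous_kern.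
    - exact: kern_cvg0.
  rewrite -EFinM; congr EFin.
  rewrite subSS subn0 -{1}(subnK jm) exprD /w scaleDn// expr_div_n [s / _ * _]mulrAC -[s * _ / _]mulrA.
  by field; rewrite !expf_neq0 ?gt_eqF ?scale_gt0.
move=> ->; apply: eq_integral => t _.
rewrite [RHS]EFinM; congr (_ * _)%E.
rewrite /tail -RintegralZr//; last exact: integrable_tail.
rewrite /Rintegral fineK; last first.
  apply: integrable_fin_num => //.
  exact: (integrableZr measurableT (scale (j%:R + beta) n)^-1 (integrable_tail mY Y0 intYm j (r ^+ n * t))).
by apply: eq_integral => x _; rewrite ltr_pdivlMr// [t * _]mulrC /w mulrA.
Qed.

Lemma rem0_repr a s n : 0 < s ->
  ((scaled a (rem 0) n s)%:E = \int[leb]_(t in pos)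
    (s * expR (- (s * t)) * (low (r ^+ n * t) / scale a n))%:E)%E.
Proof.
move=> s0.
have c0 : 0 < scale a n by rewrite scale_gt0.
have sn0 : 0 < s / r ^+ n by rewrite divr_gt0.
have ir : mu.-integrable setT (EFin \o (fun x => Y x ^+ (m.+1 - 0) * psi 0 (s / r ^+ n * Y x))).
  exact: rem_integrable.
have ir' : mu.-integrable setT
    (EFin \o (fun x => Y x ^+ (m.+1 - 0) * psi 0 (s / r ^+ n * Y x) / scale a n)).
  exact: (integrableZr measurableT (scale a n)^-1 ir).
pose w x := Y x ^+ m.+1 / scale a n.
have w0 x : 0 <= w x by rewrite divr_ge0 ?exprn_ge0// ltW.
have mw : measurable_fun setT w.
  by apply: measurable_funM => //; exact: measurable_funX.
have mk : measurable_fun pos (fun t => s * expR (- (s * t))).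
  apply: measurable_funM => //; apply: measurable_funTS.
  exact: (@measurable_expN _ _ _ setT id).
have k0 t : 0 < t -> 0 <= s * expR (- (s * t)) by move=> _; rewrite mulr_ge0 ?expR_ge0// ltW.
have mE : measurable_fun setT (fun xt : T * measurableTypeR R => Y xt.1 / r ^+ n <= xt.2).
  by apply: measurable_fun_ler => //; exact: measurable_Yn.
have := @tonelli_kernel R _ T mu (fun x t => Y x / r ^+ n <= t) _ w mE mk k0 mw w0.
rewrite (_ : (\int[mu]_x _)%E = (scaled a (rem 0) n s)%:E); last first.
  rewrite /scaled !remE -RintegralZr// /Rintegral fineK; last exact: integrable_fin_num.
  apply: eq_integral => x _.
  rewrite integral_kernel_ge//; last by rewrite divr_ge0// ltW.
  rewrite -EFinM; congr EFin; rewrite subn0 /w /= [s * _]mulrCA -!mulrA.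
  by rewrite [(scale a n)^-1 * _]mulrC [_ * Y x]mulrC mulrCA.
move=> ->; apply: eq_integral => t _.
rewrite [RHS]EFinM; congr (_ * _)%E.
rewrite /low -RintegralZr//; last exact: integrable_low.
rewrite /Rintegral fineK; last first.
  apply: integrable_fin_num => //.
  exact: (integrableZr measurableT (scale a n)^-1 (integrable_low mu m mY Y0 (r ^+ n * t))).
by apply: eq_integral => x _; rewrite ler_pdivrMr// [t * _]mulrC /w mulrA.
Qed.

Lemma cvg_seq_ubound (u : nat -> R) (l : R) : u n @[n --> \oo] --> l -> exists C, forall n, u n <= C.
Proof.
move=> ul; have /cvg_seq_bounded : cvgn u by apply/cvg_ex; exists l.
move=> [M [_ HM]]; exists (M + 1) => n.
by rewrite (le_trans (ler_norm _))//; apply: HM => //; rewrite ltrDl.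
Qed.

(** Monotonicity turns convergence at one point [t] of []0, 1[] outside [A] into the bound on whole
    blocks that [potter_bound] asks for. For [low], which increases, the point is taken beyond [r]
    instead. *)
Lemma tail_bound j (g : R) F A : countable A ->
  (forall t, 0 < t -> ~ A t -> tail j (r ^+ n * t) / scale g n @[n --> \oo] --> F t) ->
  exists C0, forall k x, r ^+ k <= x <= r ^+ k.+1 -> tail j x <= C0 * scale g k.
Proof.
move=> cA HF.
have [t /andP[t0 t1] At] := cocountable_right_dense cA (@ltr01 R).
have [C HC] := cvg_seq_ubound (HF t t0 At).
exists C => k x /andP[kx _].
rewrite -ler_pdivrMr ?scale_gt0// (le_trans _ (HC k))// ler_pM2r ?invr_gt0 ?scale_gt0//.
by apply: tail_ni => //; rewrite (le_trans _ kx)// ler_piMr ?ltW.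
Qed.

Lemma low_bound (g : R) F A : countable A ->
  (forall t, 0 < t -> ~ A t -> low (r ^+ n * t) / scale g n @[n --> \oo] --> F t) ->
  exists C0, forall k x, r ^+ k <= x <= r ^+ k.+1 -> low x <= C0 * scale g k.
Proof.
move=> cA HF.
have rr : r < r + 1 by rewrite ltrDl.
have [t /andP[t0 t1] At] := cocountable_right_dense cA rr.
have t00 : 0 < t by rewrite (lt_trans _ t0).
have [C HC] := cvg_seq_ubound (HF t t00 At).
exists C => k x /andP[_ xk].
rewrite -ler_pdivrMr ?scale_gt0// (le_trans _ (HC k))// ler_pM2r ?invr_gt0 ?scale_gt0//.
by apply: low_nd => //; rewrite (le_trans xk)// exprSr ler_pM2l// ltW.
Qed.

Lemma abelian_tail j beta F A s : (j <= m)%N -> 0 <= beta < 1 -> (beta = 0 -> j = 0%N) ->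
  nonincreasing_pos F -> countable A ->
  (forall t, 0 < t -> ~ A t -> tail j (r ^+ n * t) / scale (j%:R + beta) n @[n --> \oo] --> F t) ->
  0 < s ->
  leb.-integrable pos (fun t => (kern j s t * F t)%:E) /\
  scaled beta (rem 1) n s @[n --> \oo] --> \int[leb]_(t in pos) (kern j s t * F t).
Proof.
move=> jm /andP[b0 b1] bj Fni cA HF s0.
have [C0 HC0] := tail_bound cA HF.
have [K [p [p' [e [e0 kK pe p'e]]]]] : exists K p p' e, [/\ 0 < e,
    forall t, 0 < t -> kern j s t <= K * pow_glue p p' t,
    - 1 < p - (j%:R + beta + e) & p' + (e - (j%:R + beta)) < - 1].
  have [b00|bN0] := eqVneq beta 0.
    exists (s + 4 / s), 0, (- 2), (1 / 2); rewrite b00 (bj b00) addr0.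
    split; [by rewrite divr_gt0| |by lra|by lra].
    by move=> t t0; rewrite /kern mul0r mul0r add0r expr0 mul1r exp_kern_le.
  have {}b0 : 0 < beta by rewrite lt_neqAle eq_sym bN0.
  (* The two integrability conditions reduce to [beta + e < 1] at 0 and [e < beta] at infinity. *)
  pose e := Num.min (beta / 2) ((1 - beta) / 2).
  have eb : e <= beta / 2 by rewrite ge_min lexx.
  have eb' : e <= (1 - beta) / 2 by rewrite ge_min lexx orbT.
  exists (j.+1%:R * (s + 1)), j%:R, (j%:R - 1), e; split; [|by move=> t; exact: kern_le|by lra|by lra].
  by rewrite lt_min; apply/andP; split; lra.
have g0 : 0 <= j%:R + beta by rewrite addr_ge0.
have mt : measurable_fun setT (tail j).
  by apply: nonincreasing_measurable => // x y; exact: tail_ni.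
have mk : measurable_fun pos (kern j s).
  apply: measurable_funTS; apply: continuous_measurable_fun => t; exact: continuous_kern.
have k0 t : 0 < t -> 0 <= kern j s t by exact: kern_ge0.
have f2 x : 0 < x -> x <= 1 -> tail j x <= tail j 0 by move=> x0 _; apply: tail_ni => //; exact: ltW.
have [I1 I2] := abelian_dct r_gt1 ell_sv g0 e0 (tail_ge0 mu m Y0 j) mt HC0 f2 mk k0 kK pe p'e cA HF
  (nonincreasing_pos_measurable Fni).
split => //; apply: (fine_cvg (f := fun n => (scaled beta (rem 1) n s)%:E)).
rewrite /Rintegral fineK; last exact: integrable_fin_num.
move: I2; under eq_fun do rewrite -rem1_repr//.
exact.
Qed.

Lemma abelian_low F A s : nonincreasing_pos (fun x => - F x) -> countable A ->
  (forall t, 0 < t -> ~ A t -> low (r ^+ n * t) / scale 0 n @[n --> \oo] --> F t) ->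
  0 < s ->
  scaled 0 (rem 0) n s @[n --> \oo] --> \int[leb]_(t in pos) (s * expR (- (s * t)) * F t).
Proof.
move=> Fni cA HF s0.
have [C0 HC0] := low_bound cA HF.
have mt : measurable_fun setT low.
  by apply: nondecreasing_measurable => // x y; exact: low_nd.
have mk : measurable_fun pos (fun t => s * expR (- (s * t))).
  apply: measurable_funM => //; apply: measurable_funTS.
  exact: (@measurable_expN _ _ _ setT id).
have k0 t : 0 < t -> 0 <= s * expR (- (s * t)) by move=> _; rewrite mulr_ge0 ?expR_ge0// ltW.
have kK t : 0 < t -> s * expR (- (s * t)) <= (s + 4 / s) * pow_glue 0 (- 2) t.
  exact: exp_kern_le.
have e0 : 0 < 1 / 2 :> R by rewrite divr_gt0.
have pe : - 1 < 0 - (0 + 1 / 2) :> R by lra.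
have p'e : - 2 + (1 / 2 - 0) < - 1 :> R by lra.
have f2 x : 0 < x -> x <= 1 -> low x <= low 1 by move=> _ x1; exact: low_nd.
have mF : measurable_fun pos F.
  have := measurable_funN (nonincreasing_pos_measurable Fni).
  by apply: eq_measurable_fun => t _; rewrite /= opprK.
have [I1 I2] := abelian_dct r_gt1 ell_sv (lexx 0) e0 (low_ge0 mu m Y0) mt HC0 f2 mk k0 kK pe p'e cA HF mF.
apply: (fine_cvg (f := fun n => (scaled 0 (rem 0) n s)%:E)).
rewrite /Rintegral fineK; last exact: integrable_fin_num.
move: I2; under eq_fun do rewrite -rem0_repr//.
exact.
Qed.

End Abelian.

(** * Relations between the limit functions *)

Section Dilation.
Context {R : realType}.
Local Notation leb := (@lebesgue_measure R).
Local Notation pos := (`]0%R, +oo[%classic : set R).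
Implicit Types (f : R -> R) (c x : R).

Lemma lebesgue_measure_dilation c (A : set R) : 0 < c -> measurable A ->
  (leb A = c%:E * leb ((fun x => c * x)%R @^-1` A))%E.
Proof.
move=> c0 mA.
have mc : measurable_fun setT (fun x : measurableTypeR R => (c * x)%R : measurableTypeR R).
  exact: measurable_funM.
pose phi (x : measurableTypeR R) : measurableTypeR R := c * x.
pose pf' := pushforward leb phi : {measure set (measurableTypeR R) -> \bar R}.
pose pf := pf' mc.
pose nu : {measure set (measurableTypeR R) -> \bar R} := mscale (NngNum (ltW c0)) pf.
rewrite (@lebesgue_measure_unique R nu)// => X [[a b] /= _ <-].
have E : (fun x : R => c * x)%R @^-1` `]a, b]%classic = `]a / c, b / c]%classic.
  by apply/seteqP; split => t /=; rewrite !in_itv/= ltr_pdivrMr// ler_pdivlMr// mulrC.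
rewrite /nu /mscale /= /pushforward E !lebesgue_measure_itv /= !lte_fin.
rewrite ltr_pM2r ?invr_gt0//; case: ifP => _; last by rewrite mule0.
rewrite -!EFinD -EFinM; congr EFin; field; exact: lt0r_neq0.
Qed.

Lemma integral_dilation f c x : 0 < c -> measurable_fun pos f -> (forall t, 0 < t -> 0 <= f t) ->
  (\int[leb]_(t in `]0%R, (x * c)%R]) (f t)%:E =
   c%:E * \int[leb]_(t in `]0%R, x]) (f (c * t)%R)%:E)%E.
Proof.
move=> c0 mf f0.
have mc : measurable_fun setT (fun x : measurableTypeR R => (c * x)%R : measurableTypeR R).
  exact: measurable_funM.
pose phi (x : measurableTypeR R) : measurableTypeR R := c * x.
pose pf' := pushforward leb phi : {measure set (measurableTypeR R) -> \bar R}.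
pose pf := pf' mc.
pose nu : {measure set (measurableTypeR R) -> \bar R} := mscale (NngNum (ltW c0)) pf.
have mD : measurable (`]0%R, x * c]%classic : set (measurableTypeR R)) by exact: measurable_itv.
have mfD : measurable_fun (`]0%R, x * c]%classic : set (measurableTypeR R)) (fun t => (f t)%:E).
  apply/measurable_EFinP; apply: (@measurable_funS _ _ _ _ pos) => //.
  by move=> t /=; rewrite !in_itv/= andbT => /andP[].
have f0D t : (`]0%R, x * c]%classic : set R) t -> (0 <= (f t)%:E)%E.
  by rewrite /= in_itv/= => /andP[t0 _]; rewrite lee_fin f0.
transitivity (\int[nu]_(t in `]0%R, (x * c)%R]) (f t)%:E)%E.
  apply: eq_measure_integral => // A mA _; exact: lebesgue_measure_dilation.
rewrite (@ge0_integral_mscale _ _ _ pf)//= ge0_integral_pushforward//=; last first.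
  by move=> t; rewrite inE; exact: f0D.
congr (_ * integral _ _ _)%E.
by apply/seteqP; split => t /=; rewrite /phi !in_itv/= pmulr_rgt0// [(c * _)%R]mulrC ler_pM2r.
Qed.

Lemma integral_pos_gt f x : 0 <= x ->
  (\int[leb]_(t in pos) ((x < t)%R%:R * f t)%:E = \int[leb]_(t in `]x, +oo[) (f t)%:E)%E.
Proof.
move=> x0; rewrite [RHS](_ : _ = \int[leb]_(t in pos `&` `]x, +oo[) (f t)%:E)%E; last first.
  congr integral; apply/seteqP; split => t /=; rewrite !in_itv/= !andbT; last by case.
  by move=> xt; split => //; exact: le_lt_trans xt.
rewrite [RHS]integral_mkcondr; apply: eq_integral => t _; rewrite patchE.
have [xt|tx] := ltP x t; first by rewrite mem_set ?mul1r//= in_itv/= xt.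
by rewrite memNset ?mul0r//= in_itv/= andbT => /lt_geF; rewrite tx.
Qed.

Lemma integral_pos_le f x :
  (\int[leb]_(t in pos) ((t <= x)%R%:R * f t)%:E = \int[leb]_(t in `]0%R, x]) (f t)%:E)%E.
Proof.
rewrite [RHS](_ : _ = \int[leb]_(t in pos `&` [set t | (t <= x)%R]) (f t)%:E)%E; last first.
  by congr integral; apply/seteqP; split => t /=; rewrite !in_itv/= ?andbT => /andP.
rewrite [RHS]integral_mkcondr; apply: eq_integral => t _; rewrite patchE.
have [xt|tx] := leP t x; first by rewrite mem_set ?mul1r.
by rewrite memNset ?mul0r//= => /le_gtF; rewrite tx.
Qed.

Lemma Rintegral_itv_lip f (A B C s t : R) :
  leb.-integrable (`]s, t]%classic : set R) (EFin \o f) ->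
  (forall x, A <= x <= B -> `|f x| <= C) -> A <= s -> s <= t -> t <= B ->
  `|\int[leb]_(x in `]s, t]) f x| <= C * (t - s).
Proof.
move=> If fC As st tB.
apply: (le_trans (le_normr_Rintegral _ If)) => //.
have Ic : leb.-integrable (`]s, t]%classic : set R) (EFin \o cst C).
  apply: (@integrableS _ _ _ leb `[s, t]%classic) => //.
    by apply: subset_itv; rewrite bnd_simp.
  apply: continuous_compact_integrable; first exact: segment_compact.
  by apply: continuous_subspaceT => x; exact: cvg_cst.
apply: (@le_trans _ _ (\int[leb]_(x in `]s, t]) cst C x)).
  apply: le_Rintegral => //; first exact: integrable_norm.
  move=> x; rewrite /= in_itv/= => /andP[sx xt]; apply: fC.
  by rewrite (le_trans As (ltW sx)) (le_trans xt tB).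
rewrite (_ : Rintegral _ _ _ = C * fine (leb `]s, t]%classic)); last exact: Rintegral_cst.
rewrite lebesgue_measure_itv/= lte_fin.
have [->|sNt] := eqVneq s t; first by rewrite ltxx subrr.
by rewrite lt_neqAle sNt st.
Qed.

End Dilation.

Section LipschitzIntegral.
Context {R : realType}.
Local Notation leb := (@lebesgue_measure R).
Local Notation pos := (`]0%R, +oo[%classic : set R).
Implicit Types (h : R -> R) (s t x : R).

Lemma continuous_integral_gt h :
  (forall x : R, 0 < x -> leb.-integrable (`]x, +oo[%classic : set R) (EFin \o h)) ->
  (forall A B : R, 0 < A -> exists C, forall x, A <= x <= B -> `|h x| <= C) ->
  forall x : R, 0 < x -> {for x, continuous (fun x => \int[leb]_(t in `]x, +oo[) h t)}.
Proof.
move=> ih bh; apply: locally_lipschitz_continuous => A B A0.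
have [C HC] := bh A B A0.
exists `|C|; split => //.
have W s t : A <= s -> s <= t -> t <= B ->
    `|\int[leb]_(t in `]s, +oo[) h t - \int[leb]_(t in `]t, +oo[) h t| <= `|C| * `|s - t|.
  move=> As st tB; have s0 := lt_le_trans A0 As.
  rewrite -(@Rintegral_itvB R h (BRight s) +oo%O t) ?bnd_simp//; last exact: ih.
  rewrite subKr distrC (ger0_norm (_ : 0 <= t - s)) ?subr_ge0//.
  apply: (@Rintegral_itv_lip _ _ A B) => //.
    apply: integrableS (ih s s0) => //.
    by apply: subset_itvl; rewrite bnd_simp.
  by move=> x /HC xC; rewrite (le_trans xC)// ler_norm.
move=> s t /andP[As sB] /andP[At tB]; have [st|/ltW ts] := leP s t; first exact: W.
by rewrite distrC [`|s - t|]distrC; exact: W.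
Qed.

Lemma continuous_integral_le h :
  (forall x : R, 0 < x -> leb.-integrable (`]0%R, x]%classic : set R) (EFin \o h)) ->
  (forall A B : R, 0 < A -> exists C, forall x, A <= x <= B -> `|h x| <= C) ->
  forall x : R, 0 < x -> {for x, continuous (fun x => \int[leb]_(t in `]0, x]) h t)}.
Proof.
move=> ih bh; apply: locally_lipschitz_continuous => A B A0.
have [C HC] := bh A B A0.
exists `|C|; split => //.
have W s t : A <= s -> s <= t -> t <= B ->
    `|\int[leb]_(t in `]0, t]) h t - \int[leb]_(t in `]0, s]) h t| <= `|C| * `|s - t|.
  move=> As st tB; have s0 := lt_le_trans A0 As.
  have t0 := lt_le_trans s0 st.
  rewrite (@Rintegral_itvB R h (BRight 0) (BRight t) s) ?bnd_simp//; last 2 first.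
  - exact: ih.
  - exact: ltW.
  rewrite distrC (ger0_norm (_ : 0 <= t - s)) ?subr_ge0//.
  apply: (@Rintegral_itv_lip _ _ A B) => //.
    apply: integrableS (ih t t0) => //.
    by apply: subset_itvr; rewrite bnd_simp ltW.
  by move=> x /HC xC; rewrite (le_trans xC)// ler_norm.
move=> s t /andP[As sB] /andP[At tB]; have [st|/ltW ts] := leP s t.
  by rewrite distrC; exact: W.
by rewrite [`|s - t|]distrC; exact: W.
Qed.

Lemma nonincreasing_pos_ge0 (F : R -> R) (A : set R) : countable A -> nonincreasing_pos F ->
  (forall t, 0 < t -> ~ A t -> 0 <= F t) -> forall t, 0 < t -> 0 <= F t.
Proof.
move=> cA Fni F0 t t0; have t1 : t < t + 1 by rewrite ltrDl.
have [u /andP[tu _] Au] := cocountable_right_dense cA t1.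
by rewrite (le_trans (F0 u (lt_trans t0 tu) Au))// Fni// ltW.
Qed.

Lemma integral_FTC_gt_lt (K k : R -> R) x u : 0 < x ->
  (forall y : R, 0 < y -> is_derive y 1 K (k y)) ->
  (forall y : R, 0 < y -> {for y, continuous k}) ->
  (\int[leb]_(t in pos) ((t < u)%R%:R * ((x < t)%R%:R * k t))%:E =
    ((x < u)%R%:R * (K u - K x))%:E)%E.
Proof.
move=> x0 Kk kc; have [xu|ux] := ltP x u; last first.
  rewrite mul0r integral0_eq// => t _; have [tu|_] := ltP t u; last by rewrite mul0r.
  by rewrite ltNge (ltW (lt_le_trans tu ux)) mul0r mulr0.
rewrite mul1r; transitivity (\int[leb]_(t in pos `&` `]x, u[) (k t)%:E)%E.
  rewrite [RHS]integral_mkcondr; apply: eq_integral => t _; rewrite patchE.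
  have [tu|ut] := ltP t u; last first.
    by rewrite mul0r memNset//= in_itv/= => /andP[_ /lt_geF]; rewrite ut.
  have [xt|tx] := ltP x t; first by rewrite !mul1r mem_set//= in_itv/= xt tu.
  by rewrite mul0r mulr0 memNset//= in_itv/= => /andP[/lt_geF]; rewrite tx.
have -> : pos `&` `]x, u[%classic = `]x, u[%classic.
  apply/seteqP; split => t /=; rewrite !in_itv/= andbT; first by case.
  by move=> /[dup] xtu /andP[xt _]; split => //; exact: lt_trans xt.
have Pxu t : x <= t -> 0 < t by exact: lt_le_trans.
have cxu : {within `[x, u], continuous k}.
  by apply: continuous_in_subspaceT => y; rewrite inE/= in_itv/= => /andP[/Pxu y0 _]; exact: kc.
rewrite -(@integral_itv_bndoo R x u (EFin \o k) true false); last first.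
  apply/measurable_EFinP; apply: open_continuous_measurable_fun; first exact: interval_open.
  by move=> y; rewrite inE/= in_itv/= => /andP[/ltW/Pxu y0 _]; exact: kc.
rewrite EFinB; apply: continuous_FTC2 => //.
  split.
  - by move=> y; rewrite in_itv/= => /andP[/ltW/Pxu y0 _]; have [] := Kk y y0.
  - by apply: cvg_at_right_filter; exact: is_derive_continuous (Kk x x0).
  - by apply: cvg_at_left_filter; exact: is_derive_continuous (Kk u (lt_trans x0 xu)).
move=> y; rewrite in_itv/= => /andP[/ltW/Pxu y0 _].
by rewrite derive1E; apply: derive_val; exact: Kk.
Qed.

End LipschitzIntegral.

(** * Integral relations between tails weighted by different powers *)

Section TailAverage.
Context {R : realType} (r : R) (ell : R -> R).
Hypotheses (r_gt1 : 1 < r) (ell_sv : slowly_varying ell).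
Context d (T : measurableType d) (mu : {finite_measure set T -> \bar R}).
Variables (Y : T -> R) (m : nat).
Hypotheses (mY : measurable_fun setT Y) (Y0 : forall x, 0 <= Y x)
  (intYm : mu.-integrable setT (EFin \o (fun x => Y x ^+ m))).
Implicit Types (beta s t z : R) (j n : nat) (F L : R -> R) (A : set R).
Local Notation scale := (scale r ell).
Local Notation tail := (tail mu Y m).
Local Notation leb := (@lebesgue_measure R).
Local Notation pos := (`]0%R, +oo[%classic : set R).

Let r_gt0 : 0 < r. Proof. by rewrite (lt_trans _ r_gt1). Qed.
Let rX_gt0 n : 0 < r ^+ n. Proof. by rewrite exprn_gt0. Qed.

Definition tail_weighted j (b x : R) n :=
  (\int[mu]_y ((r ^+ n * x < Y y)%R%:R * (Y y / r ^+ n) `^ b * Y y ^+ (m - j))).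

(** Tonelli's theorem applied to the integral of [b t^(b-1)] from [x] to [Y / r ^+ n], that is the
    increment of [t^b]. [sg] is a sign that keeps the kernel nonnegative, as [b] is used with both
    signs. *)
Lemma tail_average_repr j beta (b sg x : R) n : 0 < x -> 0 <= sg * b ->
  mu.-integrable setT (fun y => ((r ^+ n * x < Y y)%R%:R * (Y y / r ^+ n) `^ b * Y y ^+ (m - j))%:E) ->
  ((sg * (tail_weighted j b x n / scale (j%:R + beta) n
      - x `^ b * (tail j (r ^+ n * x) / scale (j%:R + beta) n)))%:E =
   \int[leb]_(t in pos) (((x < t)%R%:R * (sg * b * t `^ (b - 1))) *
      (tail j (r ^+ n * t) / scale (j%:R + beta) n))%:E)%E.
Proof.
move=> x0 sb iw.
set c := scale _ _; have c0 : 0 < c by rewrite /c scale_gt0.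
pose w y := Y y ^+ (m - j) / c.
have w0 y : 0 <= w y by rewrite divr_ge0 ?exprn_ge0// ltW.
have mw : measurable_fun setT w by apply: measurable_funM => //; exact: measurable_funX.
pose k t := (x < t)%R%:R * (sg * b * t `^ (b - 1)).
have mk : measurable_fun pos k.
  apply: measurable_funTS; apply: measurable_funM.
    rewrite (_ : (fun t => _) = \1_(`]x, +oo[%classic)); first exact: measurable_indic.
    apply/funext => t; rewrite indicE; have [xt|tx] := ltP x t.
      by rewrite mem_set//= in_itv/= xt.
    by rewrite memNset//= in_itv/= andbT => /lt_geF; rewrite tx.
  by apply: measurable_funM => //; exact: measurable_powR.
have k0 t : 0 < t -> 0 <= k t by move=> _; rewrite mulr_ge0// mulr_ge0 ?powR_ge0.
have mE : measurable_fun setT (fun xt : T * measurableTypeR R => xt.2 < Y xt.1 / r ^+ n).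
  apply: measurable_fun_ltr => //; apply: measurable_funM => //.
  exact: (measurableT_comp mY).
have := @tonelli_kernel R _ T mu (fun y t => t < Y y / r ^+ n) k w mE mk k0 mw w0.
rewrite [X in X = _ -> _](_ : _ = (sg * (tail_weighted j b x n / c
      - x `^ b * (tail j (r ^+ n * x) / c)))%:E); last first.
  have it := integrable_tail mY Y0 intYm j (r ^+ n * x).
  have -> : sg * (tail_weighted j b x n / c - x `^ b * (tail j (r ^+ n * x) / c)) =
      (tail_weighted j b x n - tail j (r ^+ n * x) * x `^ b) * (sg / c) by ring.
  rewrite /tail_weighted /tail -RintegralZr// -RintegralB//; last first.
    exact: (integrableZr measurableT (x `^ b) it).
  have iB : mu.-integrable setT (EFin \o (fun y =>
      (r ^+ n * x < Y y)%R%:R * (Y y / r ^+ n) `^ b * Y y ^+ (m - j) -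
      (r ^+ n * x < Y y)%R%:R * Y y ^+ (m - j) * x `^ b)).
    exact: (integrableB measurableT iw (integrableZr measurableT (x `^ b) it)).
  rewrite -RintegralZr// /Rintegral fineK; last first.
    apply: integrable_fin_num => //.
    exact: (integrableZr measurableT (sg / c) iB).
  apply: eq_integral => y _.
  rewrite (_ : (\int[leb]_(t in pos) _)%E =
      ((x < Y y / r ^+ n)%R%:R * (sg * (Y y / r ^+ n) `^ b - sg * x `^ b))%:E); last first.
    apply: (@integral_FTC_gt_lt _ (fun t => sg * t `^ b) (fun t => sg * b * t `^ (b - 1))) => //.
    - move=> t t0; have D := is_derive1_powR b t0.
      have -> : (fun t => sg * t `^ b) = sg *: (fun t => t `^ b) by [].
      by apply: is_derive_eq; rewrite /GRing.scale/= mulrA.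
    - by move=> t t0; apply: cvgM; [exact: cvg_cst|exact: continuous_powR].
  rewrite -EFinM; congr EFin; rewrite ltr_pdivlMr// [x * _]mulrC /w; ring.
move=> ->; apply: eq_integral => t _.
rewrite [RHS]EFinM; congr (_ * _)%E.
rewrite /tail -RintegralZr//; last exact: integrable_tail.
rewrite /Rintegral fineK; last first.
  apply: integrable_fin_num => //.
  exact: (integrableZr measurableT c^-1 (integrable_tail mY Y0 intYm j (r ^+ n * t))).
by apply: eq_integral => y _; rewrite ltr_pdivlMr// [t * _]mulrC /w mulrA.
Qed.

(** The identity of [tail_average_repr] passes to the limit at the points outside [A]. Both sides
    are right-continuous in [x], so it extends to all [x > 0]. The condition on [b] is convergence
    at infinity. *)
Lemma tail_average j beta (b sg : R) F L A : 0 <= beta -> 0 <= sg * b -> b < j%:R + beta ->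
  (forall x n, 0 < x -> mu.-integrable setT (fun y => ((r ^+ n * x < Y y)%R%:R * (Y y / r ^+ n) `^ b * Y y ^+ (m - j))%:E)) ->
  nonincreasing_pos F -> (forall x : R, 0 < x -> F @ x^'+ --> F x) ->
  (forall x : R, 0 < x -> L @ x^'+ --> L x) -> countable A ->
  (forall t, 0 < t -> ~ A t -> tail j (r ^+ n * t) / scale (j%:R + beta) n @[n --> \oo] --> F t) ->
  (forall t, 0 < t -> ~ A t -> tail_weighted j b t n / scale (j%:R + beta) n @[n --> \oo] --> L t) ->
  forall x : R, 0 < x ->
    leb.-integrable (`]x, +oo[%classic : set R) (EFin \o (fun t => sg * b * t `^ (b - 1) * F t)) /\
    \int[leb]_(t in `]x, +oo[) (sg * b * t `^ (b - 1) * F t) = sg * (L x - x `^ b * F x).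
Proof.
move=> b0 sb bj iw Fni Frc Lrc cA HF HL.
have [C0 HC0] := tail_bound r_gt1 ell_sv mY Y0 intYm cA HF.
have F0 : forall t, 0 < t -> 0 <= F t.
  apply: nonincreasing_pos_ge0 cA Fni _ => t t0 At.
  have /cvgr_to_ge := HF t t0 At; apply; apply: nearW => n.
  by rewrite divr_ge0 ?tail_ge0// ltW// scale_gt0.
set g := j%:R + beta; have g0 : 0 <= g by rewrite addr_ge0.
pose e := (g - b) / 2; have e0 : 0 < e by rewrite divr_gt0// subr_gt0.
have mt : measurable_fun setT (tail j).
  by apply: nonincreasing_measurable => // x y; exact: tail_ni.
have f2 x : 0 < x -> x <= 1 -> tail j x <= tail j 0 by move=> x0 _; apply: tail_ni => //; exact: ltW.
have main x : 0 < x ->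
    leb.-integrable (`]x, +oo[%classic : set R) (EFin \o (fun t => sg * b * t `^ (b - 1) * F t)) /\
    (~ A x -> \int[leb]_(t in `]x, +oo[) (sg * b * t `^ (b - 1) * F t) = sg * (L x - x `^ b * F x)).
  move=> x0.
  pose k t := (x < t)%R%:R * (sg * b * t `^ (b - 1)).
  have mk : measurable_fun pos k.
    apply: measurable_funTS; apply: measurable_funM.
      rewrite (_ : (fun t => _) = \1_(`]x, +oo[%classic)); first exact: measurable_indic.
      apply/funext => t; rewrite indicE; have [xt|tx] := ltP x t.
        by rewrite mem_set//= in_itv/= xt.
      by rewrite memNset//= in_itv/= andbT => /lt_geF; rewrite tx.
    by apply: measurable_funM => //; exact: measurable_powR.
  have k0 t : 0 < t -> 0 <= k t by move=> _; rewrite mulr_ge0// mulr_ge0 ?powR_ge0.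
  (* The kernel vanishes below [x], so its envelope may have any exponent near 0; [g + e] is the one
     that cancels the Potter exponent, at the price of the constant [K]. *)
  have [K1 [K [_ K0 HK]]] := powR_itv_bounds (b - 1 - (g + e)) 1 x0.
  have kK t : 0 < t -> k t <= (sg * b * (1 + K)) * pow_glue (g + e) (b - 1) t.
    move=> t0; rewrite /k -[leRHS]mulrA mulrCA ler_wpM2l// /pow_glue.
    have [xt|tx] := ltP x t; last first.
      rewrite mul0r; apply: mulr_ge0; first by rewrite addr_ge0// ltW.
      by case: ifP => _; exact: powR_ge0.
    rewrite mul1r; case: (leP t 1) => t1; last by rewrite ler_peMl ?powR_ge0// lerDl ltW.
    have -> : t `^ (b - 1) = t `^ (b - 1 - (g + e)) * t `^ (g + e).
      by rewrite -powRD ?subrK// (gt_eqF t0) implybT.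
    rewrite ler_wpM2r ?powR_ge0// (@le_trans _ _ K)//; last by rewrite lerDr.
    by have /andP[] := HK t (introT andP (conj (ltW xt) t1)).
  have pe : - 1 < g + e - (g + e) by rewrite subrr oppr_lt0.
  have p'e : b - 1 + (e - g) < - 1 by move: bj; rewrite /e -/g; lra.
  have [I1 I2] := abelian_dct r_gt1 ell_sv g0 e0 (tail_ge0 mu m Y0 j) mt HC0 f2 mk k0 kK pe p'e cA HF
    (nonincreasing_pos_measurable Fni).
  have kE t : k t * F t = (x < t)%R%:R * (sg * b * t `^ (b - 1) * F t) by rewrite /k -mulrA.
  have If : leb.-integrable (`]x, +oo[%classic : set R) (EFin \o (fun t => sg * b * t `^ (b - 1) * F t)).
    have : leb.-integrable (`]x, +oo[%classic : set R) (fun t => (k t * F t)%:E).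
      by apply: integrableS I1 => //; apply: subset_itvr; rewrite bnd_simp ltW.
    apply: eq_integrable => // t; rewrite inE/= in_itv/= andbT => xt.
    by rewrite kE xt mul1r.
  split => // Ax; apply: EFin_inj.
  rewrite {1}/Rintegral fineK; last exact: integrable_fin_num.
  rewrite -integral_pos_gt ?(ltW x0)//.
  under eq_integral => t _ do rewrite -kE.
  have H : (sg * (tail_weighted j b x n / scale g n - x `^ b * (tail j (r ^+ n * x) / scale g n)))%:E
      @[n --> \oo] --> (sg * (L x - x `^ b * F x))%:E.
    apply: cvg_EFin; first exact: nearW.
    apply: cvgM; first exact: cvg_cst.
    apply: cvgB; first exact: HL.
    by apply: cvgM; [exact: cvg_cst|exact: HF].
  have {}I2 : (sg * (tail_weighted j b x n / scale g n - x `^ b * (tail j (r ^+ n * x) / scale g n)))%:E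
      @[n --> \oo] --> (\int[leb]_(t in pos) (k t * F t)%:E)%E.
    apply: cvg_trans I2; apply: near_eq_cvg; apply: nearW => n /=.
    by rewrite tail_average_repr//; exact: iw.
  exact: (cvg_unique _ I2 H).
have cI : forall x : R, 0 < x -> {for x, continuous
    (fun x => \int[leb]_(t in `]x, +oo[) (sg * b * t `^ (b - 1) * F t))}.
  apply: continuous_integral_gt; first by move=> x x0; have [] := main x x0.
  move=> B1 B2 B10; have [K1 [K [_ K0 HK]]] := powR_itv_bounds (b - 1) B2 B10.
  exists (sg * b * K * F B1) => x /[dup] xB /andP[Bx _]; have x0 := lt_le_trans B10 Bx.
  rewrite ger0_norm; last by rewrite mulr_ge0 ?F0// mulr_ge0 ?powR_ge0.
  apply: ler_pM => //; [by rewrite mulr_ge0 ?powR_ge0|exact: F0| |exact: Fni].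
  by rewrite ler_wpM2l//; have /andP[] := HK x xB.
move=> x x0; split; first by have [] := main x x0.
move: x x0; apply: (right_continuous_eq cA).
- by move=> x x0; apply: cvg_at_right_filter; exact: cI.
- move=> x x0; apply: cvgM; first exact: cvg_cst.
  apply: cvgB; first exact: Lrc.
  apply: cvgM; last exact: Frc.
  by apply: cvg_at_right_filter; exact: continuous_powR.
- by move=> x x0 Ax; have [_] := main x x0; exact.
Qed.

End TailAverage.

(** * The inverse of the Laplace-Stieltjes operator A *)

Section StieltjesMeasure.
Context {R : realType}.

Lemma lebesgue_stieltjes_itvoc (G : R -> R) (GP : nondecreasing G /\ right_continuous G) (x y : R) :
  x < y -> lebesgue_stieltjes_measure (cumulative_of GP) (`]x, y]%classic : set R) = (G y - G x)%:E.
Proof.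
move=> xy; rewrite /lebesgue_stieltjes_measure/= /measure_extension/=.
rewrite measurable_mu_extE//; last exact: is_ocitv.
exact: (@wlength_itv_bnd _ (cumulative_of GP) _ _ _ _ (ltW xy)).
Qed.

End StieltjesMeasure.

Lemma logper_powR_mul {R : realType} (r g : R) (F : R -> R) : 1 < r -> 0 <= g ->
  (forall x : R, 0 < x -> 0 < F x) -> nonincreasing_pos F ->
  (forall x : R, 0 < x -> F @ x^'+ --> F x) ->
  (forall x : R, 0 < x -> F (x * r) = r `^ (- g) * F x) ->
  logper r (fun x => x `^ g * F x).
Proof.
move=> r1 g0 F0 Fni Frc Fr; have r0 : 0 < r by rewrite (lt_trans _ r1).
have per x : 0 < x -> (x * r) `^ g * F (x * r) = x `^ g * F x.
  move=> x0; rewrite Fr// powRM ?(ltW x0) ?(ltW r0)// mulrACA -mulrA; congr (_ * _).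
  rewrite mulrA -powRD ?addNr ?powRr0 ?mul1r// (gt_eqF r0) implybT//.
have bd x : 1 <= x <= r -> F r <= x `^ g * F x <= r `^ g * F 1.
  move=> /andP[x1 xr]; have x0 : 0 < x by rewrite (lt_le_trans ltr01).
  apply/andP; split.
    rewrite (le_trans (Fni x r x0 xr))// ler_peMl ?(ltW (F0 x x0))//.
    by rewrite -[leLHS](powRr0 x) ler_powR.
  apply: ler_pM; rewrite ?powR_ge0 ?(ltW (F0 x x0))//; last exact: Fni.
  by rewrite ge0_ler_powR// nnegrE ltW.
split => //.
- by move=> x x0; rewrite mulr_gt0 ?powR_gt0 ?F0.
- exists (r `^ g * F 1) => x x0.
  have [s s1r ->] := @logper_domain R r (fun x => x `^ g * F x) r1 per x x0.
  by have /andP[] := bd s s1r.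
- move=> x x0; apply: cvgM; last exact: Frc.
  by apply: cvg_at_right_filter; exact: continuous_powR.
- apply: (@lt_le_trans _ _ (F r)); first exact: F0.
  apply: lb_le_inf; first by exists (1 `^ g * F 1), 1 => //=; rewrite in_itv/= lexx ltW.
  by move=> _ [x /= x1r <-]; have /andP[] := bd x x1r.
Qed.

Section LaplaceStieltjes.
Context {R : realType} (r beta : R) (F : R -> R).
Hypotheses (r_gt1 : 1 < r) (beta01 : 0 < beta < 1)
  (F_gt0 : forall x : R, 0 < x -> 0 < F x) (Fni : nonincreasing_pos F)
  (Frc : forall x : R, 0 < x -> F @ x^'+ --> F x)
  (Fper : forall x : R, 0 < x -> F (x * r) = r `^ (- beta) * F x).
Local Notation leb := (@lebesgue_measure R).
Local Notation pos := (`]0%R, +oo[%classic : set R).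
Hypothesis Fint : forall s : R, 0 < s ->
  leb.-integrable pos (fun t => (s * expR (- (s * t)) * F t)%:E).
Implicit Types (s t x : R).

Let rho := 1 - beta.
Let r_gt0 : 0 < r. Proof. by rewrite (lt_trans _ r_gt1). Qed.
Let rho_gt0 : 0 < rho. Proof. by rewrite subr_gt0; case/andP: beta01. Qed.
Let beta_ge0 : 0 <= beta. Proof. by case/andP: beta01 => /ltW. Qed.
Let mF : measurable_fun pos F. Proof. exact: nonincreasing_pos_measurable. Qed.
Let F_ge0 x : 0 < x -> 0 <= F x. Proof. by move=> x0; exact/ltW/F_gt0. Qed.

(** [x^rho a(x) = U x], so the Stieltjes measure attached to [a] is [F(t) dt], and its Laplace
    transform multiplied by [s^rho] is the [q] of [inverse_operators]. This is how [a] is found. *)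
Let U x := \int[leb]_(t in `]0, x]) F t.
Let a x := x `^ (- rho) * U x.

Let intF x : 0 < x -> leb.-integrable (`]0%R, x]%classic : set R) (EFin \o F).
Proof.
move=> x0.
have S : (`]0%R, x]%classic : set R) `<=` pos by apply: subset_itvl; rewrite bnd_simp.
have I : leb.-integrable (`]0%R, x]%classic : set R) (EFin \o (fun t => expR x * (1 * expR (- (1 * t)) * F t))).
  have I0 : leb.-integrable (`]0%R, x]%classic : set R) (fun t => (1 * expR (- (1 * t)) * F t)%:E).
    by apply: integrableS (Fint ltr01).
  by apply: eq_integrable (integrableZl _ (expR x) I0).
apply: le_integrable I => //.
  by apply/measurable_EFinP; exact: measurable_funS mF.
move=> t; rewrite /= in_itv/= => /andP[t0 tx]; rewrite lee_fin.
rewrite !ger0_norm ?F_ge0 ?mulr_ge0 ?expR_ge0 ?F_ge0// !mul1r mulrA -expRD.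
by rewrite ler_peMl ?F_ge0// -[leLHS]expR0 ler_expR subr_ge0.
Qed.

Let UE x : 0 < x -> (U x)%:E = (\int[leb]_(t in `]0%R, x]) (F t)%:E)%E.
Proof. by move=> x0; rewrite /U /Rintegral fineK//; apply: integrable_fin_num => //; exact: intF. Qed.

Let U_gt0 x : 0 < x -> 0 < U x.
Proof.
move=> x0; apply: (@lt_le_trans _ _ (\int[leb]_(t in `]0, x]) cst (F x) t)).
  rewrite (_ : Rintegral _ _ _ = F x * fine (leb `]0%R, x]%classic)); last exact: Rintegral_cst.
  by rewrite lebesgue_measure_itv/= lte_fin x0 -EFinB/= subr0 mulr_gt0 ?F_gt0.
have Ic : leb.-integrable (`]0%R, x]%classic : set R) (EFin \o cst (F x)).
  apply: le_integrable (intF x0) => //; first exact/measurable_EFinP/measurable_cst.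
  move=> t; rewrite /= in_itv/= => /andP[t0 tx]; rewrite lee_fin.
  by rewrite !ger0_norm ?F_ge0//; exact: Fni.
apply: (le_Rintegral _ Ic (intF x0)) => //.
by move=> t; rewrite /= in_itv/= => /andP[t0 tx]; exact: Fni.
Qed.

Let U_nd x y : 0 < x -> x <= y -> U x <= U y.
Proof.
move=> x0 xy; rewrite -subr_ge0 /U (@Rintegral_itvB R F (BRight 0) (BRight y) x) ?bnd_simp//; last 2 first.
- exact: intF (lt_le_trans x0 xy).
- exact: ltW.
by apply: Rintegral_ge0 => t; rewrite /= in_itv/= => /andP[xt _]; rewrite F_ge0// (lt_trans x0).
Qed.

Let U_cont x : 0 < x -> {for x, continuous U}.
Proof.
apply: continuous_integral_le; first exact: intF.
move=> A B A0; exists (F A) => t /andP[At _]; have t0 := lt_le_trans A0 At.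
by rewrite ger0_norm ?F_ge0//; exact: Fni.
Qed.

Let U_per x : 0 < x -> U (x * r) = r `^ rho * U x.
Proof.
move=> x0; apply: EFin_inj; rewrite UE ?mulr_gt0// (integral_dilation _ r_gt0 mF F_ge0).
have -> : r `^ rho = r * r `^ (- beta).
  by rewrite /rho powRD ?(gt_eqF r_gt0) ?implybT// powRr1// ltW.
rewrite EFinM EFinM -muleA UE//; congr (_ * _)%E.
rewrite -ge0_integralZl//.
- apply: eq_integral => t; rewrite inE/= in_itv/= => /andP[t0 _].
  by rewrite mulrC Fper.
- by apply/measurable_EFinP; apply: measurable_funS mF => //; apply: subset_itvl; rewrite bnd_simp.
- by move=> t; rewrite /= in_itv/= => /andP[t0 _]; rewrite lee_fin F_ge0.
- by rewrite lee_fin powR_ge0.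
Qed.

Lemma logper_mono_average : logper_mono r rho a.
Proof.
have aE x : 0 < x -> x `^ rho * a x = U x.
  move=> x0; rewrite /a mulrA -powRD ?subrr ?powRr0 ?mul1r//.
  by rewrite (gt_eqF x0) implybT.
split; last by move=> x y x0 xy; rewrite !aE ?(lt_le_trans x0 xy)//; exact: U_nd.
apply: continuous_logper => //.
- by move=> x x0; rewrite mulr_gt0 ?powR_gt0 ?U_gt0.
- move=> x x0; apply: cvgM; last exact: U_cont.
  exact: continuous_powR.
- move=> x x0; rewrite /a U_per// powRM ?(ltW x0) ?(ltW r_gt0)// mulrACA -mulrA; congr (_ * _).
  by rewrite mulrA -powRD ?subrr ?powRr0 ?mul1r// (gt_eqF r_gt0) implybT.
Qed.

Lemma logper_powR_tail : logper r (fun x => x `^ beta * F x).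
Proof. exact: logper_powR_mul. Qed.

Lemma opB_powR_tail : eq_pos (opB rho (fun x => x `^ beta * F x)) a.
Proof.
move=> x x0; rewrite /opB rho_gt0 /a; congr (_ * _).
apply: eq_Rintegral => t; rewrite inE/= in_itv/= => /andP[t0 _].
rewrite mulrA -powRD; last by rewrite (gt_eqF t0) implybT.
by rewrite (_ : rho - 1 + beta = 0) ?powRr0 ?mul1r// /rho; lra.
Qed.

Let GP : nondecreasing (powmul rho a) /\ right_continuous (powmul rho a).
Proof. exact: powmul_cumulative rho_gt0 logper_mono_average. Qed.

Let nu := lebesgue_stieltjes_measure (cumulative_of GP).

Let stieltjesE : stieltjes (powmul rho a) = nu.
Proof.
rewrite /stieltjes; case: pselect => [GP'|/(_ GP)//].
by rewrite /nu (Prop_irrelevance GP' GP).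
Qed.

Let powmulE x : 0 < x -> powmul rho a x = U x.
Proof.
move=> x0; rewrite /powmul x0 /a mulrA -powRD ?subrr ?powRr0 ?mul1r//.
by rewrite (gt_eqF x0) implybT.
Qed.

(** [opA] integrates over an interval closed at 0, so a mass at 0 must be ruled out: [[0, x]] lies
    between []0, x]] and []-1, x]], which have equal mass because [powmul] is 0 up to 0. *)
Let nuE x : 0 < x -> nu (`[0%R, x]%classic : set R) = (U x)%:E.
Proof.
move=> x0; apply/eqP; rewrite eq_le; apply/andP; split.
- have -> : U x = powmul rho a x - powmul rho a (- 1).
    by rewrite powmulE// /powmul ltr0N1 subr0.
  rewrite -(lebesgue_stieltjes_itvoc GP); last by rewrite (lt_trans _ x0).
  apply: le_measure; rewrite ?inE//.
  by apply: subset_itvr; rewrite bnd_simp.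
- have -> : U x = powmul rho a x - powmul rho a 0.
    by rewrite powmulE// /powmul ltxx subr0.
  rewrite -(lebesgue_stieltjes_itvoc GP)//.
  by apply: le_measure; rewrite ?inE//; apply: subset_itvr; rewrite bnd_simp.
Qed.

Let mk s : measurable_fun pos (fun t => s * expR (- (s * t))).
Proof.
apply: measurable_funM => //; apply: measurable_funTS.
exact: (@measurable_expN _ _ _ setT id).
Qed.

Let k0 s t : 0 < s -> 0 < t -> 0 <= s * expR (- (s * t)).
Proof. by move=> s0 _; rewrite mulr_ge0 ?expR_ge0// ltW. Qed.

Let mE : measurable_fun setT (fun xt : measurableTypeR R * measurableTypeR R => xt.1 <= xt.2).
Proof. by apply: measurable_fun_ler. Qed.

(** Integration by parts through Tonelli, with [exp (- s x)] written as the integral of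
    [s exp (- s t)] over [t >= x]. [laplace_U] brings the density [F] to the same value, so the
    masses of the intervals [[0, t]] suffice to compare the two. *)
Let laplace_nu s : 0 < s ->
  (\int[nu]_(x in `[0%R, +oo[) (expR (- (s * x)))%:E =
   \int[leb]_(t in pos) ((s * expR (- (s * t)))%:E * (U t)%:E))%E.
Proof.
move=> s0.
pose w : measurableTypeR R -> R := \1_(`[0%R, +oo[%classic).
have mw : measurable_fun setT w by exact: measurable_indic.
have w0 x : 0 <= w x by rewrite /w indicE.
have := @tonelli_kernel R _ _ nu (fun x t => x <= t) (fun t => s * expR (- (s * t))) w
  mE (mk s) (fun t => k0 (t := t) s0) mw w0.
rewrite [X in X = _ -> _](_ : _ = (\int[nu]_(x in `[0%R, +oo[) (expR (- (s * x)))%:E)%E); last first.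
  rewrite [RHS]integral_mkcond; apply: eq_integral => x _.
  rewrite patchE /w indicE /=; case: ifPn => [|_]; last by rewrite mul0e.
  rewrite inE/= in_itv/= andbT => x0.
  by rewrite integral_kernel_ge// mul1e.
move=> ->; apply: eq_integral => t; rewrite inE/= in_itv/= andbT => t0.
congr (_ * _)%E; rewrite -nuE//.
transitivity (\int[nu]_x (\1_(`[0%R, t]%classic : set R) x)%:E)%E; last first.
  by rewrite integral_indic ?setIT.
apply: eq_integral => x _; rewrite /w !indicE -natrM mulnb; congr ((nat_of_bool _)%:R)%:E.
apply/idP/idP.
  by move=> /andP[xt]; rewrite inE/= in_itv/= andbT => x0; rewrite inE/= in_itv/= x0.
by rewrite inE/= in_itv/= => /andP[x0 xt]; rewrite xt inE/= in_itv/= x0.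
Qed.

Let laplace_U s : 0 < s ->
  (\int[leb]_(t in pos) (expR (- (s * t)) * F t)%:E =
   \int[leb]_(t in pos) ((s * expR (- (s * t)))%:E * (U t)%:E))%E.
Proof.
move=> s0.
pose w : measurableTypeR R -> R := F \_ pos.
have mw : measurable_fun setT w by exact/(measurable_restrictT _ _).1.
have w0 x : 0 <= w x.
  by rewrite /w patchE; case: ifP => //; rewrite inE/= in_itv/= andbT => x0; exact: F_ge0.
have := @tonelli_kernel R _ _ leb (fun x t => x <= t) (fun t => s * expR (- (s * t))) w
  mE (mk s) (fun t => k0 (t := t) s0) mw w0.
rewrite [X in X = _ -> _](_ : _ = (\int[leb]_(t in pos) (expR (- (s * t)) * F t)%:E)%E); last first.
  rewrite [RHS]integral_mkcond; apply: eq_integral => x _.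
  rewrite patchE /w patchE /=; case: ifPn => [|_]; last by rewrite mul0e.
  rewrite inE/= in_itv/= andbT => x0.
  by rewrite integral_kernel_ge// ?(ltW x0)// -EFinM mulrC.
move=> ->; apply: eq_integral => t; rewrite inE/= in_itv/= andbT => t0.
congr (_ * _)%E; rewrite UE// -integral_pos_le [RHS]integral_mkcond.
by apply: eq_integral => x _; rewrite /w !patchE; case: ifP => _ //; rewrite mulr0.
Qed.

Let integrable_expF s : 0 < s -> leb.-integrable pos (fun t => (expR (- (s * t)) * F t)%:E).
Proof.
move=> s0; apply: eq_integrable (integrableZl _ s^-1 (Fint s0)) => // t _.
by rewrite /= -!mulrA -EFinM mulKf// gt_eqF.
Qed.

Let integrable_nu s : 0 < s ->
  nu.-integrable (`[0%R, +oo[%classic : set R) (fun x => (expR (- (s * x)))%:E).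
Proof.
move=> s0; apply/integrableP; split.
  apply/measurable_EFinP; apply: measurable_funTS.
  exact: (@measurable_expN _ _ _ setT id).
under eq_integral => x _ do rewrite gee0_abs ?lee_fin ?expR_ge0//.
rewrite laplace_nu// -laplace_U//.
have : (\int[leb]_(t in pos) (expR (- (s * t)) * F t)%:E)%E \is a fin_num.
  by apply: integrable_fin_num; [exact: measurable_itv|exact: integrable_expF].
by rewrite ltey_eq => ->.
Qed.

Let laplace_nuF s : 0 < s ->
  \int[nu]_(x in `[0, +oo[) expR (- (s * x)) = \int[leb]_(t in pos) (expR (- (s * t)) * F t).
Proof. by move=> s0; exact: (congr1 fine (etrans (laplace_nu s0) (esym (laplace_U s0)))). Qed.

Lemma opA_average s : 0 < s ->
  opA rho a s = s `^ rho * \int[leb]_(t in pos) (expR (- (s * t)) * F t).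
Proof.
by move=> s0; rewrite /opA stieltjesE laplace_nuF.
Qed.

Lemma completely_monotone_laplace (f : R -> R) :
  (forall s : R, 0 < s -> f s = \int[leb]_(t in pos) (expR (- (s * t)) * F t)) ->
  completely_monotone f.
Proof.
move=> fE n s s0.
have mD : measurable (`[0%R, +oo[%classic : set (measurableTypeR R)) by exact: measurable_itv.
have mY : measurable_fun (`[0%R, +oo[%classic : set (measurableTypeR R)) (id : _ -> R) by [].
have Y0 (x : R) : `[0%R, +oo[%classic x -> 0 <= x by rewrite /= in_itv/= andbT.
have fL t : 0 < t -> f t = lap nu `[0%R, +oo[%classic id 0 t.
  move=> t0; rewrite (fE t t0); apply: (etrans (esym (laplace_nuF t0))).
  by apply: eq_Rintegral => x _; rewrite expr0 mul1r.
have fn t : 0 < t -> derive1n n f t = (-1) ^+ n * lap nu `[0%R, +oo[%classic id n t.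
  by move=> t0; exact: (@derive1n_lap _ _ _ nu _ _ mD mY Y0 integrable_nu).
split; last first.
  rewrite fn// mulrA -exprD addnn -mul2n exprM sqrrN expr1n expr1n mul1r.
  exact: lap_ge0.
have D := @is_derive_lap _ _ _ nu _ _ mD mY Y0 integrable_nu n s s0.
apply: (@near_eq_derivable _ _ _ (fun t => (-1) ^+ n * lap nu `[0%R, +oo[%classic id n t)).
  by near=> t; rewrite fn//; near: t; exact: lt_nbhsr.
by apply: derivableM => //; have [] := D.
Unshelve. all: by end_near. Qed.

(** [B_rho] applied to [x^beta F(x)] integrates [t^(rho - 1 + beta) F(t) = F(t)], because
    [rho = 1 - beta], and thus returns the average [a]; complete monotonicity is that of the Laplace
    transform of [nu]. *)
Lemma inverse_operators (q : R -> R) : logper r q ->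
  (forall s : R, 0 < s -> q s = s `^ rho * \int[leb]_(t in pos) (expR (- (s * t)) * F t)) ->
  is_invA r rho q a /\ is_invB r rho a (fun x => x `^ beta * F x).
Proof.
move=> [q0 _ _ _ qr] qE; split; last by split; [exact: logper_powR_tail|exact: opB_powR_tail].
split; [|exact: logper_mono_average|by move=> s s0; rewrite opA_average// qE].
split => //; apply: completely_monotone_laplace => s s0.
by rewrite qE// mulrA -powRD ?addNr ?powRr0 ?mul1r// (gt_eqF s0) implybT.
Qed.

End LaplaceStieltjes.

Section RightLimits.
Context {R : realType}.
Implicit Types (F p : R -> R) (A : set R) (x y r c g : R).

Lemma right_continuous_mulr F x c : 0 < c -> F @ (x * c)^'+ --> F (x * c) ->
  (fun y => F (y * c)) @ x^'+ --> F (x * c).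
Proof.
move=> c0 Fx; apply: cvg_trans Fx; move=> B [e /= e0 HB].
exists (e / c) => /=; first by rewrite divr_gt0.
move=> y /= xy xlty; apply: HB => /=; last by rewrite ltr_pM2r.
by rewrite -mulrBl normrM (gtr0_norm c0) -ltr_pdivlMr.
Qed.

Lemma nonincreasing_pos_dense F A : countable A ->
  (forall x : R, 0 < x -> F @ x^'+ --> F x) ->
  (forall x y, 0 < x -> x <= y -> ~ A x -> ~ A y -> F y <= F x) -> nonincreasing_pos F.
Proof.
move=> cA Frc Fni x y x0; rewrite le_eqVlt => /predU1P[->//|xy].
have y0 := lt_trans x0 xy.
apply/ler_addgt0Pr => e e0; have e20 : 0 < e / 2 by rewrite divr_gt0.
have /cvgrPdist_lt/(_ _ e20)[d1 /= d10 H1] := Frc x x0.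
have /cvgrPdist_lt/(_ _ e20)[d2 /= d20 H2] := Frc y y0.
have xm : x < Num.min y (x + d1) by rewrite lt_min xy ltrDl.
have [u /andP[xu +] Au] := cocountable_right_dense cA xm.
rewrite lt_min => /andP[uy ud].
have yd : y < y + d2 by rewrite ltrDl.
have [v /andP[yv vd] Av] := cocountable_right_dense cA yd.
have := H1 u; rewrite /= distrC gtr0_norm ?subr_gt0// ltrBlDl => /(_ ud xu).
have := H2 v; rewrite /= distrC gtr0_norm ?subr_gt0// ltrBlDl => /(_ vd yv).
have := Fni u v (lt_trans x0 xu) (ltW (lt_trans uy yv)) Au Av.
rewrite !ltr_norml => ? /andP[? ?] /andP[? ?]; lra.
Qed.

(** [x * r ^+ N] eventually exceeds any [y], so [F x = F (x * r ^+ N) <= F y] for all [x] and [y].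
    This is the source of the constants at [beta = 0] and [beta = 1], where the scaling exponent of
    the limit is 0. *)
Lemma nonincreasing_periodic_const r F : 1 < r -> nonincreasing_pos F ->
  (forall x : R, 0 < x -> F (x * r) = F x) -> forall x : R, 0 < x -> F x = F 1.
Proof.
move=> r1 Fni Fr.
have le x y : 0 < x -> 0 < y -> F x <= F y.
  move=> x0 y0; have /cvgryPge/(_ (y / x))[N _ HN] := exprn_pinfty r1.
  rewrite -(logperX r1 Fr N x0); apply: Fni => //.
  by rewrite mulrC -ler_pdivrMr//; exact: HN (leqnn N).
by move=> x x0; apply/eqP; rewrite eq_le !le.
Qed.

End RightLimits.

Section ScaledSequences.
Context {R : realType} (r : R) (ell : R -> R).
Hypotheses (r_gt1 : 1 < r) (ell_sv : slowly_varying ell).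
Implicit Types (F u : R -> R) (A : set R) (x g : R).
Local Notation scale := (scale r ell).
Local Notation scaled := (scaled r ell).

Let r_gt0 : 0 < r. Proof. by rewrite (lt_trans _ r_gt1). Qed.
Let rX_gt0 n : 0 < r ^+ n. Proof. by rewrite exprn_gt0. Qed.

(** The mechanism of [scaled_limit_periodic] for a limit known only off a countable set: [x] and
    [x * r] must both avoid [A], whence the union with [A / r], and right-continuity fills the
    gaps. *)
Lemma scaled_limit_powR g u F A : countable A ->
  (forall x : R, 0 < x -> F @ x^'+ --> F x) ->
  (forall x, 0 < x -> ~ A x -> u (r ^+ n * x) / scale g n @[n --> \oo] --> F x) ->
  forall x : R, 0 < x -> F (x * r) = r `^ (- g) * F x.
Proof.
move=> cA Frc uF.
have cA' : countable (A `|` [set x / r | x in A]).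
  rewrite -bigcup2E; apply: bigcup_countable => // i _.
  case: i => [|[|i]] //=; exact: (sub_countable (card_image_le _ _)).
apply: (right_continuous_eq cA').
- by move=> x x0; apply: right_continuous_mulr => //; apply: Frc; rewrite mulr_gt0.
- by move=> x x0; apply: cvgM; [exact: cvg_cst|exact: Frc].
move=> x x0 Ax; have Ax1 : ~ A x by move=> H; apply: Ax; left.
have Ax2 : ~ A (x * r) by move=> H; apply: Ax; right; exists (x * r) => //; rewrite mulfK// gt_eqF.
have xr0 : 0 < x * r by rewrite mulr_gt0.
have H1 := uF _ xr0 Ax2.
have H2 : u (r ^+ n * (x * r)) / scale g n @[n --> \oo] --> r `^ (- g) * F x.
  have H3 : u (r ^+ n.+1 * x) / scale g n.+1 @[n --> \oo] --> F x.
    by rewrite (cvg_shiftS (fun n => u (r ^+ n * x) / scale g n)); exact: uF.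
  rewrite (_ : (fun n => _) = fun n => scale g n.+1 / scale g n * (u (r ^+ n.+1 * x) / scale g n.+1)).
    exact: cvgM (@scale_ratio _ r ell r_gt1 ell_sv g) H3.
  apply/funext => n; rewrite (_ : r ^+ n * (x * r) = r ^+ n.+1 * x); last by rewrite exprSr; ring.
  by field; rewrite !gt_eqF ?scale_gt0.
exact: (cvg_unique _ H1 H2).
Qed.

Lemma scaled_lip a H h (A B K : R) n : 0 < A ->
  (forall s : R, 0 < s -> is_derive s 1 H (h s)) ->
  (forall s, A <= s <= B -> `|scaled (a - 1) h n s| <= K) ->
  forall s t, A <= s <= B -> A <= t <= B ->
  `|scaled a H n s - scaled a H n t| <= K * `|s - t|.
Proof.
move=> A0 Hh hK s t sAB tAB.
have D x : 0 < x -> is_derive x 1 (scaled a H n) (scaled (a - 1) h n x).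
  by move=> x0; exact: is_derive_scaled.
have [x [xAB _ _ ->]] := MVT_pos A0 D tAB sAB.
by rewrite normrM ler_wpM2r// hK.
Qed.

End ScaledSequences.

(** * From tails to Laplace asymptotics *)

Section AbelianAsymptotics.
Context {R : realType} (r : R) (ell : R -> R).
Hypotheses (r_gt1 : 1 < r) (ell_sv : slowly_varying ell).
Context d (T : measurableType d) (mu : {finite_measure set T -> \bar R}).
Variables (Y : T -> R) (m : nat).
Hypotheses (mY : measurable_fun setT Y) (Y0 : forall x, 0 <= Y x)
  (intYm : mu.-integrable setT (EFin \o (fun x => Y x ^+ m))).
Implicit Types (beta s t z : R) (j n : nat) (F q : R -> R) (A : set R).
Local Notation scale := (scale r ell).
Local Notation scaled := (scaled r ell).
Local Notation rem := (rem mu setT Y m).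
Local Notation tail := (tail mu Y m).
Local Notation low := (low mu Y m).
Local Notation leb := (@lebesgue_measure R).
Local Notation pos := (`]0%R, +oo[%classic : set R).

Let r_gt0 : 0 < r. Proof. by rewrite (lt_trans _ r_gt1). Qed.
Let rX_gt0 n : 0 < r ^+ n. Proof. by rewrite exprn_gt0. Qed.
Let YT x : setT x -> 0 <= Y x. Proof. by move=> _; exact: Y0. Qed.
Let int1 : mu.-integrable setT (EFin \o cst 1).
Proof. exact: finite_measure_integrable_cst. Qed.
Let rem0_ge0 s : 0 < s -> 0 <= rem 0 s. Proof. exact: rem_ge0. Qed.

(** A zero at [z] propagates to all [z / r ^+ n] by the scaling relation, and then everywhere by
    monotonicity. The Abelian theorem would give [rem 1] the rescaled limit 0, whereas that limit is
    [q 1 > 0] at [s = 1]. *)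
Lemma tail_limit_gt0 j beta q F A : (j <= m)%N -> 0 <= beta < 1 -> (beta = 0 -> j = 0%N) ->
  logper r q -> asymp0 (rem 1) (fun s => s `^ beta * ell s^-1 * q s) ->
  nonincreasing_pos F -> (forall x : R, 0 < x -> F @ x^'+ --> F x) -> countable A ->
  (forall t, 0 < t -> ~ A t -> tail j (r ^+ n * t) / scale (j%:R + beta) n @[n --> \oo] --> F t) ->
  forall x : R, 0 < x -> 0 < F x.
Proof.
move=> jm b01 bj qr Hq Fni Frc cA HF z z0.
have F_ge0 : forall t, 0 < t -> 0 <= F t.
  apply: nonincreasing_pos_ge0 cA Fni _ => t t0 At.
  have /cvgr_to_ge := HF t t0 At; apply; apply: nearW => n.
  by rewrite divr_ge0 ?tail_ge0// ltW// scale_gt0.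
rewrite lt_neqAle eq_sym F_ge0// andbT; apply/negP => /eqP Fz.
have Fper := scaled_limit_powR r_gt1 ell_sv cA Frc HF.
have Fzn n : F (z / r ^+ n) = 0.
  elim: n => [|n IH]; first by rewrite expr0 divr1.
  have zn0 : 0 < z / r ^+ n.+1 by rewrite divr_gt0.
  have := Fper _ zn0; rewrite (_ : _ * r = z / r ^+ n); last first.
    by rewrite exprSr; field; rewrite !gt_eqF.
  by rewrite IH => /esym/eqP; rewrite mulf_eq0 gt_eqF ?powR_gt0//= => /eqP.
have F00 t : 0 < t -> F t = 0.
  move=> t0; apply/eqP; rewrite eq_le F_ge0// andbT.
  have /cvgryPge/(_ (z / t))[N _ HN] := exprn_pinfty r_gt1.
  rewrite -(Fzn N); apply: Fni; first by rewrite divr_gt0.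
  by rewrite ler_pdivrMr// mulrC -ler_pdivrMr//; exact: HN (leqnn N).
have [_] := abelian_tail r_gt1 ell_sv mY Y0 intYm jm b01 bj Fni cA HF ltr01.
rewrite (_ : \int[leb]_(t in pos) _ = 0); last first.
  rewrite /Rintegral integral0_eq// => t; rewrite /= in_itv/= andbT => t0.
  by rewrite F00// mulr0.
have [q0 _ _ _ _] := qr.
have := asymp0_scaled r_gt1 ell_sv qr Hq ltr01; rewrite powR1 mul1r => H1 H2.
by have := q0 1 ltr01; rewrite (cvg_unique _ H1 H2)// ltxx.
Qed.

(** From [x psi_0(x) <= psi_1(x)] one gets [s * rem 0 s <= rem 1 s], so the derivative is controlled
    by the function itself; the latter is nondecreasing, and its rescaled values at the right end
    are bounded since they converge. *)
Lemma rem1_scaled_lip beta (A B : R) : 0 < A ->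
  (forall s : R, 0 < s -> cvgn (fun n => scaled beta (rem 1) n s)) ->
  exists (K : R) N, 0 <= K /\
  forall n s t, (N <= n)%N -> A <= s <= B -> A <= t <= B ->
  `|scaled beta (rem 1) n s - scaled beta (rem 1) n t| <= K * `|s - t|.
Proof.
move=> A0 cv; pose M := Num.max A B.
have M0 : 0 < M by rewrite lt_max A0.
have /cvg_ex[l Hl] := cv M M0; have [C HC] := cvg_seq_ubound Hl.
exists (`|C| / A), 0%N; split; first by rewrite divr_ge0// ltW.
move=> n s t _; apply: (@scaled_lip _ r ell r_gt1 ell_sv beta (rem 1) (rem 0) A B _ n A0).
  by move=> x x0; exact: is_derive_rem.
move=> x /andP[Ax xB]; have x0 := lt_le_trans A0 Ax.
have xn0 : 0 < x / r ^+ n by rewrite divr_gt0.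
have c0 : 0 < scale beta n by rewrite scale_gt0.
have le1 : x / r ^+ n * rem 0 (x / r ^+ n) <= rem 1 (x / r ^+ n).
  rewrite !remE mulrC -RintegralZr//; last exact: rem_integrable.
  apply: le_Rintegral => //.
  - exact: (integrableZr measurableT _ (rem_integrable measurableT mY YT int1 intYm (leq0n _) xn0)).
  - exact: rem_integrable.
  - move=> y _; rewrite subn0 subSS subn0 exprS -mulrA [Y y * _]mulrC -mulrA ler_wpM2l ?exprn_ge0//.
    have := psi_deriv_le 0 (mulr_ge0 (ltW xn0) (Y0 y)); rewrite mul1r.
    by apply: le_trans; rewrite le_eqVlt; apply/orP; left; apply/eqP; ring.
have MC : scaled beta (rem 1) n M <= `|C| by rewrite (le_trans (HC n))// ler_norm.
have xM : scaled beta (rem 1) n x <= scaled beta (rem 1) n M.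
  have xM' : x / r ^+ n <= M / r ^+ n by rewrite ler_pM2r ?invr_gt0// le_max xB orbT.
  by apply: ler_wpM2r; [rewrite invr_ge0 ltW|exact: rem_nd].
rewrite ger0_norm; last by rewrite /scaled divr_ge0 ?rem0_ge0// ltW// scale_gt0.
rewrite /scaled scaleB1// ler_pdivlMr//.
apply: le_trans (le_trans xM MC); rewrite /scaled ler_pdivlMr//.
apply: le_trans le1.
apply: (@le_trans _ _ (rem 0 (x / r ^+ n) / r ^+ n * A)).
  by rewrite le_eqVlt; apply/orP; left; apply/eqP; field; rewrite !gt_eqF.
rewrite [leRHS](_ : _ = rem 0 (x / r ^+ n) / r ^+ n * x); last by ring.
by rewrite ler_wpM2l// divr_ge0 ?rem0_ge0// ltW.
Qed.

(** The integral over []0, 1[] alone is at least [F 1] times the increment of [t^j psi_1(s t)], that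
    is [F 1 * psi 1 s]. *)
Lemma integral_kern_gt0 j F s : 0 < s -> nonincreasing_pos F -> (forall x : R, 0 < x -> 0 < F x) ->
  leb.-integrable pos (fun t => (kern j s t * F t)%:E) ->
  0 < \int[leb]_(t in pos) (kern j s t * F t).
Proof.
move=> s0 Fni F0 I.
have mk : measurable_fun pos (kern j s).
  apply: measurable_funTS; apply: continuous_measurable_fun => t; exact: continuous_kern.
have E : (\int[leb]_(t in pos) ((t < 1)%R%:R * kern j s t)%:E = (1 ^+ j * psi 1 (s * 1))%:E)%E.
  apply: (@integral_kernel_lt R (fun t => t ^+ j * psi 1 (s * t))) => //.
  - by rewrite mulr0 psi0 mulr0.
  - by move=> y _; exact: is_derive_kern.
  - by move=> y; exact: kern_ge0.
  - by move=> y _; exact: continuous_kern.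
  - exact: kern_cvg0.
have mlt : measurable_fun pos (fun t : R => (t < 1)%R%:R : R).
  apply: measurable_funTS; rewrite (_ : (fun t => _) = \1_(`]-oo, 1[%classic)).
    exact: measurable_indic.
  apply/funext => t; rewrite indicE; have [t1|t1] := ltP t 1.
    by rewrite mem_set//= in_itv/= t1.
  by rewrite memNset//= in_itv/= => /lt_geF; rewrite t1.
rewrite -lte_fin /Rintegral fineK; last by apply: integrable_fin_num => //; exact: measurable_itv.
apply: (@lt_le_trans _ _ ((F 1)%:E * \int[leb]_(t in pos) ((t < 1)%R%:R * kern j s t)%:E)%E).
  rewrite E -EFinM lte_fin mulr_gt0 ?F0// expr1n mul1r mulr1 /= expr0 fact0 divr1.
  by rewrite subr_gt0 -[ltRHS]expR0 ltr_expR oppr_lt0.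
rewrite -ge0_integralZl//=; last 3 first.
- by apply/measurable_EFinP; exact: measurable_funM.
- by move=> t; rewrite in_itv/= andbT => t0; rewrite lee_fin mulr_ge0// kern_ge0.
- by rewrite lee_fin ltW// F0.
apply: ge0_le_integral => //=.
- by move=> t; rewrite in_itv/= andbT => t0; rewrite -EFinM lee_fin !mulr_ge0// ?kern_ge0// ltW// F0.
- by apply/measurable_EFinP; do 2 apply: measurable_funM => //.
- by apply/measurable_EFinP; apply: measurable_funM => //; exact: nonincreasing_pos_measurable.
- move=> t; rewrite in_itv/= andbT => t0; rewrite -EFinM lee_fin.
  have [t1|t1] := ltP t 1.
    by rewrite mul1r mulrC ler_wpM2l ?kern_ge0// Fni// ltW.
  by rewrite mul0r mulr0 mulr_ge0 ?kern_ge0// ltW// F0.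
Qed.

Lemma abelian_tail_asymp0 j beta F A : (j <= m)%N -> 0 <= beta < 1 -> (beta = 0 -> j = 0%N) ->
  nonincreasing_pos F -> (forall x : R, 0 < x -> 0 < F x) -> countable A ->
  (forall t, 0 < t -> ~ A t -> tail j (r ^+ n * t) / scale (j%:R + beta) n @[n --> \oo] --> F t) ->
  exists q, logper r q /\ asymp0 (rem 1) (fun s => s `^ beta * ell s^-1 * q s).
Proof.
move=> jm b01 bj Fni F0 cA HF.
have abel s : 0 < s -> _ := abelian_tail r_gt1 ell_sv mY Y0 intYm jm b01 bj Fni cA HF (s := s).
have lim s : 0 < s -> scaled beta (rem 1) n s @[n --> \oo] --> \int[leb]_(t in pos) (kern j s t * F t).
  by move=> /abel[].
have G0 s : 0 < s -> 0 < \int[leb]_(t in pos) (kern j s t * F t).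
  by move=> s0; apply: integral_kern_gt0 => //; have [] := abel s s0.
have [] := equilip_asymp0 r_gt1 ell_sv (a := beta) (H := rem 1) G0 lim.
  move=> A' B A0; apply: rem1_scaled_lip => // s s0.
  by apply/cvg_ex; eexists; exact: lim.
by move=> qr hq; eexists; split; [exact: qr|exact: hq].
Qed.

Lemma abelian_low_const (c : R) A s : 0 <= c -> countable A ->
  (forall t, 0 < t -> ~ A t -> low (r ^+ n * t) / scale 0 n @[n --> \oo] --> c) ->
  0 < s -> scaled 0 (rem 0) n s @[n --> \oo] --> c.
Proof.
move=> c0 cA HF s0.
have := @abelian_low _ _ _ r_gt1 ell_sv _ _ _ _ _ mY Y0 intYm (fun=> c) A s _ cA HF s0.
rewrite (_ : \int[leb]_(t in pos) _ = c); first by apply => x y _ _; exact: lexx.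
rewrite /Rintegral -[RHS]/(fine c%:E); congr fine.
have := integral_kernel_ge s0 (lexx 0); rewrite mulr0 oppr0 expR0 => E.
rewrite -[RHS]mule1 -E -ge0_integralZl//=.
- apply: eq_integral => t; rewrite inE/= in_itv/= andbT => t0.
  by rewrite (ltW t0) mul1r -EFinM mulrC.
- apply/measurable_EFinP; apply: (eq_measurable_fun (fun t => s * expR (- (s * t)))).
    by move=> t; rewrite inE/= in_itv/= andbT => t0; rewrite (ltW t0) mul1r.
  apply: measurable_funM => //; apply: measurable_funTS.
  exact: (@measurable_expN _ _ _ setT id).
- by move=> t _; rewrite lee_fin mulr_ge0// mulr_ge0 ?expR_ge0// ltW.
Qed.

Lemma abelian_low_asymp0 (c : R) A : 0 < c -> countable A ->
  (forall t, 0 < t -> ~ A t -> low (r ^+ n * t) / scale 0 n @[n --> \oo] --> c) ->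
  asymp0 (rem 0) (fun s => s `^ 0 * ell s^-1 * c).
Proof.
move=> c0 cA HF.
have lim s : 0 < s -> scaled 0 (rem 0) n s @[n --> \oo] --> c.
  by move=> s0; exact: abelian_low_const (ltW c0) cA HF s0.
have [] := equilip_asymp0 r_gt1 ell_sv (a := 0) (H := rem 0) (G := fun=> c) (fun _ _ => c0) lim.
  (* [rem0_deriv_le] controls the derivative at [x] by [rem 0] at [x / 2]; as [rem 0] is
     nonincreasing, its rescaled values at [A' / 2] bound the whole interval. *)
  move=> A' B A0; have A20 : 0 < A' / 2 by rewrite divr_gt0.
  have [C HC] := cvg_seq_ubound (lim _ A20).
  exists (2 * `|C| / A'), 0%N; split; first by rewrite divr_ge0 ?mulr_ge0// ltW.
  move=> n s t _; apply: (@scaled_lip _ r ell r_gt1 ell_sv 0 (rem 0)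
    (fun s => - lap mu setT Y m.+2 s) A' B _ n A0).
    by move=> x x0; exact: is_derive_rem0.
  move=> x /andP[Ax xB]; have x0 := lt_le_trans A0 Ax.
  have xn0 : 0 < x / r ^+ n by rewrite divr_gt0.
  have c0n : 0 < scale 0 n by rewrite scale_gt0.
  have le1 : x / r ^+ n * `|- lap mu setT Y m.+2 (x / r ^+ n)| <= 2 * rem 0 (x / r ^+ n / 2).
    exact: rem0_deriv_le.
  have le2 : rem 0 (x / r ^+ n / 2) <= `|C| * scale 0 n.
    rewrite -ler_pdivrMr// (le_trans _ (ler_norm _))// (le_trans _ (HC n))//.
    rewrite /scaled ler_pM2r ?invr_gt0// rem0_ni ?divr_gt0//.
    by rewrite mulrAC ler_pM2r ?invr_gt0// ler_pM2r ?invr_gt0.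
  rewrite /scaled scaleB1// normrM (ger0_norm (_ : 0 <= (_ * _)^-1)); last first.
    by rewrite invr_ge0 mulr_ge0// ltW.
  have rc0 : 0 < r ^+ n * scale 0 n by apply: mulr_gt0.
  rewrite ler_pdivrMr//.
  apply: (@le_trans _ _ (2 * (`|C| * scale 0 n) / (x / r ^+ n))).
    by rewrite ler_pdivlMr// mulrC (le_trans le1)// ler_pM2l.
  have -> : 2 * (`|C| * scale 0 n) / (x / r ^+ n) = 2 * `|C| * (r ^+ n * scale 0 n) * x^-1.
    by field; rewrite !gt_eqF.
  rewrite [leLHS]mulrAC; apply: ler_wpM2r; first by rewrite mulr_ge0// ltW.
  by apply: ler_wpM2l; rewrite ?mulr_ge0// lef_pV2 ?posrE.
move=> _.
have -> : (fun s => s `^ 0 * ell s^-1 * c) = (fun s => s `^ 0 * ell s^-1 * (s `^ (- 0) * c)).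
  by apply/funext => s; rewrite oppr0 powRr0 !mul1r.
exact.
Qed.

End AbelianAsymptotics.

Lemma eq_pos_opB {R : realType} (rho : R) (p q : R -> R) : eq_pos p q -> eq_pos (opB rho p) (opB rho q).
Proof.
move=> pq x x0; rewrite /opB; congr (_ * _); case: ifP => _.
  by apply: eq_Rintegral => t; rewrite inE/= in_itv/= => /andP[t0 _]; rewrite pq.
apply: eq_Rintegral => t; rewrite inE/= in_itv/= andbT => xt.
by rewrite pq// (lt_trans x0).
Qed.

(** * The equivalences, for a finite measure and a nonnegative function Y *)

Section Equivalences.
Context {R : realType} (r : R) (ell : R -> R).
Hypotheses (r_gt1 : 1 < r) (ell_sv : slowly_varying ell).
Context d (T : measurableType d) (mu : {finite_measure set T -> \bar R}).
Variables (Y : T -> R) (m : nat).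
Hypotheses (mY : measurable_fun setT Y) (Y0 : forall x, 0 <= Y x)
  (intYm : mu.-integrable setT (EFin \o (fun x => Y x ^+ m))).
Variable beta : R.
Hypothesis beta01 : 0 <= beta <= 1.
Implicit Types (s t z : R) (j n k : nat) (p q F : R -> R) (A : set R).
Local Notation scale := (scale r ell).
Local Notation scaled := (scaled r ell).
Local Notation rem := (rem mu setT Y m).
Local Notation tail := (tail mu Y m).
Local Notation low := (low mu Y m).
Local Notation leb := (@lebesgue_measure R).
Local Notation pos := (`]0%R, +oo[%classic : set R).

Let r_gt0 : 0 < r. Proof. by rewrite (lt_trans _ r_gt1). Qed.
Let rX_gt0 n : 0 < r ^+ n. Proof. by rewrite exprn_gt0. Qed.
Let YT x : setT x -> 0 <= Y x. Proof. by move=> _; exact: Y0. Qed.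
Let int1 : mu.-integrable setT (EFin \o cst 1).
Proof. exact: finite_measure_integrable_cst. Qed.
Let beta_ge0 : 0 <= beta. Proof. by case/andP: beta01. Qed.

(** [k = m] is the asymptotics of [f_m], with exponent [alpha], and [k = 0] that of [g_m]; each step
    down is one differentiation. *)
Definition rem_asymp k q := logper r q /\
  asymp0 (rem k.+1) (fun s => s `^ (k%:R + beta) * ell s^-1 * q s).

Lemma rem_asymp_unique k q q' : rem_asymp k q -> rem_asymp k q' -> eq_pos q q'.
Proof.
by move=> [qr hq] [q'r hq'] x; exact: (asymp0_unique r_gt1 ell_sv qr q'r hq hq').
Qed.

Let natB1 k : k.+1%:R + beta - 1 = k%:R + beta.
Proof. by rewrite -natr1; ring. Qed.

Lemma rem_asymp_down k q : (k < m)%N -> rem_asymp k.+1 q ->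
  exists2 q', rem_asymp k q' & is_invB r (k.+1%:R + beta) q q'.
Proof.
move=> km [qr hq].
have a0 : 0 < k.+1%:R + beta by rewrite ltr_pwDl.
have H1 s : 0 < s -> is_derive s 1 (rem k.+2) (rem k.+1 s) by move=> s0; exact: is_derive_rem.
have H2 s : 0 < s -> is_derive s 1 (rem k.+1) (rem k s).
  by move=> s0; apply: is_derive_rem => //; exact: ltnW.
have H3 s : 0 < s -> 0 <= rem k.+1 s by move=> s0; exact: rem_ge0.
have H4 s : 0 < s -> s ^+ 2 * `|rem k s| <= (k.+1%:R * k.+2%:R) * rem k.+2 s.
  by move=> s0; exact: rem_deriv2_le.
have H5 s t : 0 < s -> s <= t -> rem k.+1 s <= rem k.+1 t.
  by move=> s0 st; apply: rem_nd => //; exact: ltnW.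
have [q' [q'r hq' E]] := asymp0_derive r_gt1 ell_sv H1 H2 H3 H4 qr hq a0 (or_introl H5).
by exists q' => //; split; rewrite // -natB1.
Qed.

Lemma rem_asymp_up k q' : (k < m)%N -> rem_asymp k q' -> exists q, rem_asymp k.+1 q.
Proof.
move=> km [q'r]; rewrite -natB1 => hq'.
have a0 : 0 < k.+1%:R + beta by rewrite ltr_pwDl.
have H1 s : 0 < s -> is_derive s 1 (rem k.+2) (rem k.+1 s) by move=> s0; exact: is_derive_rem.
have H2 := rem_cvg0 measurableT mY YT int1 intYm km.
exact: (asymp0_primitive r_gt1 ell_sv a0 H1 H2 q'r hq').
Qed.

(** Each differentiation supplies one inverse of B. Uniqueness of the log-periodic factor identifies
    the function reached at [k = 0] with the given [p]. *)
Lemma rem_asymp_iter k q p : (k <= m)%N -> rem_asymp k q -> rem_asymp 0 p ->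
  is_invB_iter r (k%:R + beta) k q p.
Proof.
elim: k q => [|k IH] q km hq hp; first exact: rem_asymp_unique hp hq.
have [h hh hB] := rem_asymp_down km hq.
by exists h => //; rewrite natB1; exact: IH (ltnW km) hh hp.
Qed.

Lemma rem_asymp_ex k : (k <= m)%N ->
  (exists q, rem_asymp k q) <-> (exists q, rem_asymp 0 q).
Proof.
elim: k => [//|k IH] km; rewrite -(IH (ltnW km)); split => -[q hq].
  by have [q' hq' _] := rem_asymp_down km hq; exists q'.
exact: rem_asymp_up hq.
Qed.

Definition lap_asymp q := logper r q /\
  asymp0 (rem 0) (fun s => s `^ (beta - 1) * ell s^-1 * q s).

Lemma lap_asymp_down q : 0 < beta -> rem_asymp 0 q ->
  exists2 q', lap_asymp q' & is_invB r beta q q'.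
Proof.
move=> b0 [qr]; rewrite add0r => hq.
have H1 s : 0 < s -> is_derive s 1 (rem 1) (rem 0 s) by move=> s0; exact: is_derive_rem.
have H2 s : 0 < s -> is_derive s 1 (rem 0) (- lap mu setT Y m.+2 s).
  by move=> s0; exact: is_derive_rem0.
have H3 s : 0 < s -> 0 <= rem 0 s by move=> s0; exact: rem_ge0.
have H4 s : 0 < s -> s ^+ 2 * `|- lap mu setT Y m.+2 s| <= 4 * rem 1 s.
  by move=> s0; exact: rem1_deriv2_le.
have H5 s t : 0 < s -> s <= t -> rem 0 t <= rem 0 s by move=> s0 st; exact: rem0_ni.
have [q' [q'r hq' E]] := asymp0_derive r_gt1 ell_sv H1 H2 H3 H4 qr hq b0 (or_intror H5).
by exists q'.
Qed.

Lemma lap_asymp_up q' : 0 < beta -> lap_asymp q' -> exists q, rem_asymp 0 q.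
Proof.
move=> b0 [q'r hq'].
have H1 s : 0 < s -> is_derive s 1 (rem 1) (rem 0 s) by move=> s0; exact: is_derive_rem.
have H2 := rem_cvg0 measurableT mY YT int1 intYm (leq0n m).
have [q [qr hq]] := asymp0_primitive r_gt1 ell_sv b0 H1 H2 q'r hq'.
by exists q; split; rewrite // add0r.
Qed.

Lemma lap_asymp_invB q q' : 0 < beta -> rem_asymp 0 q -> lap_asymp q' -> is_invB r beta q q'.
Proof.
move=> b0 hq [q'r hq']; have [q1 [q1r hq1] [_ E]] := lap_asymp_down b0 hq.
split => // x x0; rewrite -E//; apply: eq_pos_opB => // y.
exact: (asymp0_unique r_gt1 ell_sv q'r q1r hq' hq1).
Qed.

Definition tail_asymp j p := logper r p /\ forall z, continuity_point p z ->
  tail j (r ^+ n * z) / scale (j%:R + beta) n @[n --> \oo] --> z `^ (- (j%:R + beta)) * p z.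

Let powRKN a x (c : R) : 0 < x -> x `^ (- a) * (x `^ a * c) = c.
Proof.
by move=> x0; rewrite mulrA -powRD ?addNr ?powRr0 ?mul1r// (gt_eqF x0) implybT.
Qed.

Lemma tail_asymp_limit j p : tail_asymp j p ->
  let F x := x `^ (- (j%:R + beta)) * p x in
  let A := [set z | 0 < z /\ ~ {for z, continuous p}] in
  [/\ nonincreasing_pos F, forall x : R, 0 < x -> F @ x^'+ --> F x,
      forall x : R, 0 < x -> 0 < F x, countable A &
      forall t, 0 < t -> ~ A t -> tail j (r ^+ n * t) / scale (j%:R + beta) n @[n --> \oo] --> F t].
Proof.
move=> [[p0 _ prc _ _] hp] F A.
have cA : countable A by exact: countable_discontinuities.
have lim t : 0 < t -> ~ A t -> tail j (r ^+ n * t) / scale (j%:R + beta) n @[n --> \oo] --> F t.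
  by move=> t0 At; apply: hp; split => //; apply: contrapT => ct; apply: At.
have Frc x : 0 < x -> F @ x^'+ --> F x.
  move=> x0; apply: cvgM; last exact: prc.
  by apply: cvg_at_right_filter; exact: continuous_powR.
split => //; last by move=> x x0; rewrite mulr_gt0 ?powR_gt0 ?p0.
apply: (nonincreasing_pos_dense cA Frc) => x y x0 xy Ax Ay.
have y0 := lt_le_trans x0 xy.
apply: (ler_cvg_to (lim y y0 Ay) (lim x x0 Ax)); apply: nearW => n.
rewrite ler_pM2r ?invr_gt0 ?scale_gt0//; apply: tail_ni => //.
by rewrite ler_pM2l.
Qed.

Lemma tauber_limit j q : (j <= m)%N -> beta < 1 -> (beta = 0 -> j = 0%N) -> rem_asymp 0 q ->
  exists F, let A := [set z | 0 < z /\ ~ {for z, continuous F}] in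
  [/\ nonincreasing_pos F, forall x : R, 0 < x -> F @ x^'+ --> F x,
      forall x : R, 0 < x -> 0 < F x, countable A &
      (forall x : R, 0 < x -> F (x * r) = r `^ (- (j%:R + beta)) * F x) /\
      forall t, 0 < t -> ~ A t -> tail j (r ^+ n * t) / scale (j%:R + beta) n @[n --> \oo] --> F t].
Proof.
move=> jm b1 bj [qr]; rewrite add0r => hq.
have b01 : 0 <= beta < 1 by rewrite beta_ge0.
have [F [Fni Frc HF]] := tauber_tail r_gt1 ell_sv mY Y0 intYm jm qr hq.
exists F; move=> A.
have cA : countable A by exact: countable_discontinuities.
have lim t : 0 < t -> ~ A t -> tail j (r ^+ n * t) / scale (j%:R + beta) n @[n --> \oo] --> F t.
  by move=> t0 At; apply: HF => //; apply: contrapT => ct; apply: At.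
split => //; first exact: tail_limit_gt0 jm b01 bj qr hq Fni Frc cA lim.
by split => //; exact: (@scaled_limit_powR _ r ell r_gt1 ell_sv _ (tail j) F A cA Frc lim).
Qed.

Lemma rem_asymp_tail j q : (j <= m)%N -> beta < 1 -> (beta = 0 -> j = 0%N) -> rem_asymp 0 q ->
  exists p, tail_asymp j p.
Proof.
move=> jm b1 bj hq; have [F [Fni Frc F0 cA [Fr lim]]] := tauber_limit jm b1 bj hq.
exists (fun x => x `^ (j%:R + beta) * F x); split.
  by apply: logper_powR_mul => //; rewrite addr_ge0.
move=> z [z0 pz]; rewrite powRKN//; apply: lim => // -[_]; apply.
(* The limit is known at the continuity points of [F]; near [z > 0] the function [F] is a continuous
   power times the candidate [p], so continuity of [p] at [z] suffices. *)
suff : (fun x => x `^ (- (j%:R + beta)) * (x `^ (j%:R + beta) * F x)) @ z --> F z.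
  apply: cvg_trans; apply: near_eq_cvg; near=> y; rewrite powRKN//.
  by near: y; exact: lt_nbhsr.
rewrite -[X in _ --> X](powRKN (j%:R + beta) _ z0); apply: cvgM; last exact: pz.
exact: continuous_powR.
Unshelve. all: by end_near. Qed.

Lemma tail_asymp_rem j p : (j <= m)%N -> beta < 1 -> (beta = 0 -> j = 0%N) -> tail_asymp j p ->
  exists q, rem_asymp 0 q.
Proof.
move=> jm b1 bj hp; have [Fni Frc F0 cA lim] := tail_asymp_limit hp.
have b01 : 0 <= beta < 1 by rewrite beta_ge0.
have [q [qr hq]] := abelian_tail_asymp0 r_gt1 ell_sv mY Y0 intYm jm b01 bj Fni F0 cA lim.
by exists q; split; rewrite // add0r.
Qed.

Lemma rem_asymp_tail_limit j q p s : (j <= m)%N -> beta < 1 -> (beta = 0 -> j = 0%N) ->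
  rem_asymp 0 q -> tail_asymp j p -> 0 < s ->
  s `^ beta * q s = \int[leb]_(t in pos) (kern j s t * (t `^ (- (j%:R + beta)) * p t)).
Proof.
move=> jm b1 bj [qr]; rewrite add0r => hq hp s0.
have [Fni Frc F0 cA lim] := tail_asymp_limit hp.
have b01 : 0 <= beta < 1 by rewrite beta_ge0.
have [_ H] := abelian_tail r_gt1 ell_sv mY Y0 intYm jm b01 bj Fni cA lim s0.
exact: (cvg_unique _ (asymp0_scaled r_gt1 ell_sv qr hq s0) H).
Qed.

Definition low_asymp p := logper r p /\ forall z, continuity_point p z ->
  low (r ^+ n * z) / scale 0 n @[n --> \oo] --> p z.

Lemma logper_cst (c : R) : 0 < c -> logper r (fun=> c).
Proof. by move=> c0; apply: continuous_logper => // x _; exact: cvg_cst. Qed.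

(** [scale 0] carries no power of [r], so [p] itself is a limit of nondecreasing functions off a
    countable set; being also periodic, it is constant. *)
Lemma low_asymp_const p : low_asymp p -> exists2 c, 0 < c & eq_pos p (fun=> c).
Proof.
move=> [[p0 _ prc _ pr] hp]; exists (p 1) => [|x x0]; first exact: p0.
have cA := countable_discontinuities prc.
apply: oppr_inj; apply: (@nonincreasing_periodic_const _ r (fun x => - p x)) => //; last first.
  by move=> y y0; rewrite pr.
apply: (nonincreasing_pos_dense cA); first by move=> y y0; apply: cvgN; exact: prc.
move=> y z y0 yz Ay Az; have z0 := lt_le_trans y0 yz; rewrite lerN2.
have lim t : 0 < t -> ~ [set z | 0 < z /\ ~ {for z, continuous p}] t ->
    low (r ^+ n * t) / scale 0 n @[n --> \oo] --> p t.
  by move=> t0 At; apply: hp; split => //; apply: contrapT => ct; apply: At.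
apply: (ler_cvg_to (lim y y0 Ay) (lim z z0 Az)); apply: nearW => n.
rewrite ler_pM2r ?invr_gt0 ?scale_gt0//; apply: low_nd => //.
by rewrite ler_pM2l.
Qed.

Lemma low_asymp_lap p : beta = 1 -> low_asymp p ->
  exists2 c, 0 < c & eq_pos p (fun=> c) /\ lap_asymp (fun=> c).
Proof.
move=> b1 hp; have [c c0 pc] := low_asymp_const hp; exists c => //; split => //; split.
  exact: logper_cst.
rewrite b1 subrr; apply: (abelian_low_asymp0 r_gt1 ell_sv mY Y0 intYm c0 (countable0 R)) => t t0 _.
rewrite -(pc t t0); apply: hp.2; split => //.
have : cst c @ t --> p t by rewrite pc//; exact: cvg_cst.
apply: cvg_trans; apply: near_eq_cvg; near=> y; rewrite /= pc//.
by near: y; exact: lt_nbhsr.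
Unshelve. all: by end_near. Qed.

(** The Tauberian limit is a constant, a priori only nonnegative. The Abelian theorem gives the same
    constant as rescaled limit of [rem 0], which is [q 1 > 0] at [s = 1]. *)
Lemma lap_asymp_low q : beta = 1 -> lap_asymp q -> exists p, low_asymp p.
Proof.
move=> b1 [qr hq]; have [F [Fni Frc HF]] := tauber_low r_gt1 ell_sv mY Y0 qr hq.
move: HF hq; rewrite b1 subrr => HF hq.
have cA := countable_discontinuities Frc.
set A := [set z | _] in cA.
have lim t : 0 < t -> ~ A t -> - (low (r ^+ n * t)) / scale 0 n @[n --> \oo] --> F t.
  move=> t0 At; under eq_fun do rewrite mulNr.
  by apply: HF => //; apply: contrapT => ct; apply: At.
have Fc : forall x, 0 < x -> F x = F 1.
  apply: (nonincreasing_periodic_const r_gt1 Fni) => x x0.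
  by rewrite (scaled_limit_powR r_gt1 ell_sv (u := fun x => - low x) cA Frc lim)// oppr0 powRr0 mul1r.
have lim' t : 0 < t -> ~ A t -> low (r ^+ n * t) / scale 0 n @[n --> \oo] --> - F 1.
  move=> t0 At; rewrite -(Fc t t0).
  rewrite (_ : (fun n => _) = fun n => - (- low (r ^+ n * t) / scale 0 n)); last first.
    by apply/funext => n; rewrite mulNr opprK.
  exact: cvgN (lim t t0 At).
have [u /andP[u0 _] Au] := cocountable_right_dense cA (@ltr01 R).
have c0 : 0 <= - F 1.
  have /cvgr_to_ge := lim' u u0 Au; apply; apply: nearW => n.
  by rewrite divr_ge0 ?low_ge0// ltW// scale_gt0.
have E := cvg_unique _ (asymp0_scaled r_gt1 ell_sv qr hq ltr01)
  (abelian_low_const r_gt1 ell_sv mY Y0 intYm c0 cA lim' ltr01).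
have {}c0 : 0 < - F 1 by rewrite -E// powR1 mul1r; case: qr => q0 _ _ _ _; exact: q0.
exists (fun=> - F 1); split; first exact: logper_cst.
move=> z [z0 _]; apply: lim' => // -[_]; apply.
have : cst (F 1) @ z --> F z by rewrite Fc//; exact: cvg_cst.
apply: cvg_trans; apply: near_eq_cvg; near=> y; rewrite /= Fc//.
by near: y; exact: lt_nbhsr.
Unshelve. all: by end_near. Qed.

End Equivalences.

(** * Relations between the limit functions *)

Section Relations.
Context {R : realType} (r : R) (ell : R -> R).
Hypotheses (r_gt1 : 1 < r) (ell_sv : slowly_varying ell).
Context d (T : measurableType d) (mu : {finite_measure set T -> \bar R}).
Variables (Y : T -> R) (m : nat).
Hypotheses (mY : measurable_fun setT Y) (Y0 : forall x, 0 <= Y x)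
  (intYm : mu.-integrable setT (EFin \o (fun x => Y x ^+ m))).
Implicit Types (s t z x beta : R) (j n k : nat) (p q F : R -> R) (A : set R).
Local Notation scale := (scale r ell).
Local Notation rem_asymp := (rem_asymp r ell mu Y m).
Local Notation lap_asymp := (lap_asymp r ell mu Y m).
Local Notation tail_asymp := (tail_asymp r ell mu Y m).
Local Notation low_asymp := (low_asymp r ell mu Y m).
Local Notation tail := (tail mu Y m).
Local Notation tail_weighted := (tail_weighted r mu Y m).
Local Notation leb := (@lebesgue_measure R).
Local Notation pos := (`]0%R, +oo[%classic : set R).

Let r_gt0 : 0 < r. Proof. by rewrite (lt_trans _ r_gt1). Qed.
Let rX_gt0 n : 0 < r ^+ n. Proof. by rewrite exprn_gt0. Qed.

Lemma tail_weighted_up x n : 0 < x ->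
  mu.-integrable setT (fun y => ((r ^+ n * x < Y y)%R%:R * (Y y / r ^+ n) `^ m%:R * Y y ^+ (m - m))%:E) /\
  tail_weighted m m%:R x n = tail 0 (r ^+ n * x) / (r ^+ n) ^+ m.
Proof.
move=> x0.
have E y : (r ^+ n * x < Y y)%R%:R * (Y y / r ^+ n) `^ m%:R * Y y ^+ (m - m) =
    (r ^+ n * x < Y y)%R%:R * Y y ^+ (m - 0) / (r ^+ n) ^+ m :> R.
  rewrite subnn expr0 mulr1 subn0 powR_mulrn ?divr_ge0 ?(ltW (rX_gt0 n))//.
  by rewrite expr_div_n mulrA.
have I := integrable_tail mY Y0 intYm 0 (r ^+ n * x).
split.
  by apply: eq_integrable (integrableZr measurableT ((r ^+ n) ^+ m)^-1 I) => // y _; rewrite E.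
rewrite /tail -RintegralZr//; apply: eq_Rintegral => y _; exact: E.
Qed.

Lemma tail_weighted_down x n : 0 < x ->
  mu.-integrable setT (fun y => ((r ^+ n * x < Y y)%R%:R * (Y y / r ^+ n) `^ (- m%:R) * Y y ^+ (m - 0))%:E) /\
  tail_weighted 0 (- m%:R) x n = tail m (r ^+ n * x) * (r ^+ n) ^+ m.
Proof.
move=> x0.
have E y : (r ^+ n * x < Y y)%R%:R * (Y y / r ^+ n) `^ (- m%:R) * Y y ^+ (m - 0) =
    (r ^+ n * x < Y y)%R%:R * Y y ^+ (m - m) * (r ^+ n) ^+ m :> R.
  have [xY|_] := ltP (r ^+ n * x) (Y y); last by rewrite !mul0r.
  have y0 : 0 < Y y by rewrite (lt_trans _ xY)// mulr_gt0.
  rewrite subnn expr0 mulr1 subn0 powRN powR_mulrn ?divr_ge0 ?(ltW (rX_gt0 n))//.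
  by rewrite expr_div_n !mul1r; field; rewrite !expf_neq0 ?gt_eqF.
have I := integrable_tail mY Y0 intYm m (r ^+ n * x).
split.
  by apply: eq_integrable (integrableZr measurableT ((r ^+ n) ^+ m) I) => // y _; rewrite E.
rewrite /tail -RintegralZr//; apply: eq_Rintegral => y _; exact: E.
Qed.

(** Integrability is assumed for [k f], which says nothing on [f] when [k = 0]; the case matters
    because [m = 0] is allowed, and there both sides are 0. *)
Let Rintegral_natZ (k : nat) (f : R -> R) x :
  leb.-integrable (`]x, +oo[%classic : set R) (EFin \o (fun t => k%:R * f t)) ->
  \int[leb]_(t in `]x, +oo[) (k%:R * f t) = k%:R * \int[leb]_(t in `]x, +oo[) f t.
Proof.
have [->|k0] := eqVneq (k%:R : R) 0.
  by move=> _; rewrite mul0r /Rintegral integral0_eq// => t _; rewrite mul0r.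
move=> I; rewrite -[RHS]mulrC -[LHS](mulfVK k0) mulrC [LHS]mulrC; congr (_ * _).
rewrite mulrC -RintegralZl//; apply: eq_Rintegral => t _.
by rewrite mulKf.
Qed.

Let powRDe a b x : 0 < x -> x `^ a * x `^ b = x `^ (a + b).
Proof. by move=> x0; rewrite powRD// (gt_eqF x0) implybT. Qed.

(** Let [F0] and [Fm] be the limits of [tail 0] and [tail m], so that [p0 = x^beta F0] and
    [p = x^(m + beta) Fm]. [inverse_operators] applied to [F0] gives [a] and [p0]; the two relations
    are [tail_average] with exponents [- m] and [m]. *)
Lemma inverse_relations beta q p : 0 < beta < 1 ->
  rem_asymp beta 0 q -> tail_asymp beta m p ->
  exists a p0,
    [/\ is_invA r (1 - beta) q a,
        is_invB r (1 - beta) a p0,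
        eq_pos p (fun x => p0 x - m%:R * opB (- m%:R - beta) p0 x) &
        eq_pos p0 (fun x => p x + m%:R * opB (- beta) p x)].
Proof.
move=> b01 hq hp; have /andP[b0 b1] := b01.
have b01' : 0 <= beta <= 1 by rewrite !ltW.
have b01'' : 0 <= beta < 1 by rewrite b1 ltW.
have bj j : beta = 0 -> j = 0%N by move=> b00; move: b0; rewrite b00 ltxx.
have [F0 [F0ni F0rc F0_gt0 cA0 [F0r lim0]]] := tauber_limit r_gt1 ell_sv mY Y0 intYm b01' (leq0n m) b1 (@bj _) hq.
have [Fmni Fmrc Fm_gt0 cAm limm] := tail_asymp_limit r_gt1 ell_sv mY Y0 intYm hp.
set A0 := [set z | _] in cA0 lim0; set Am := [set z | _] in cAm limm.
set Fm := fun x => x `^ (- (m%:R + beta)) * p x in Fmni Fmrc Fm_gt0 limm.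
have abel s : 0 < s -> _ := abelian_tail r_gt1 ell_sv mY Y0 intYm (leq0n m) b01'' (@bj _) F0ni cA0 lim0 (s := s).
have kE s t : kern 0 s t = s * expR (- (s * t)) by rewrite /kern !mul0r add0r expr0 mul1r.
have F0int s : 0 < s -> leb.-integrable pos (fun t => (s * expR (- (s * t)) * F0 t)%:E).
  by move=> /abel[I _]; apply: eq_integrable I => // t _; rewrite kE.
have [qr hq'] := hq.
have qE s : 0 < s -> q s = s `^ (1 - beta) * \int[leb]_(t in pos) (expR (- (s * t)) * F0 t).
  move=> s0; have [_ H] := abel s s0.
  rewrite add0r in hq'.
  have E := cvg_unique (@Rhausdorff R) (asymp0_scaled r_gt1 ell_sv qr hq' s0) H.
  have I : leb.-integrable pos (EFin \o (fun t => expR (- (s * t)) * F0 t)).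
    apply: eq_integrable (integrableZl _ s^-1 (F0int s s0)) => // t _.
    by rewrite /= -!mulrA -EFinM mulKf// gt_eqF.
  have -> : q s = s `^ (- beta) * (s `^ beta * q s).
    by rewrite mulrA powRDe// addNr powRr0 mul1r.
  rewrite E; rewrite (_ : Rintegral _ _ _ = s * \int[leb]_(t in pos) (expR (- (s * t)) * F0 t)).
    by rewrite mulrA -{2}(powRr1 (ltW s0)) powRDe// addrC.
  by rewrite -RintegralZl//; apply: eq_Rintegral => t _; rewrite kE mulrA.
have F0r' x : 0 < x -> F0 (x * r) = r `^ (- beta) * F0 x by move=> x0; rewrite F0r// add0r.
have [invA invB] := inverse_operators r_gt1 b01 F0_gt0 F0ni F0rc F0r' F0int qr qE.
eexists; exists (fun x => x `^ beta * F0 x); split; [exact: invA|exact: invB| |].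
(* First relation: weighting [tail 0] by [Y^(-m)] gives [tail m], so [F0] is integrated and [Fm] is
   the limit of the weighted tails. *)
- have IW x n : 0 < x -> mu.-integrable setT
      (fun y => ((r ^+ n * x < Y y)%R%:R * (Y y / r ^+ n) `^ (- m%:R) * Y y ^+ (m - 0))%:E).
    by move=> x0; have [] := tail_weighted_down n x0.
  have cU : countable (A0 `|` Am).
    by rewrite -bigcup2E; apply: bigcup_countable => // i _; case: i => [|[|i]] //=.
  have L t : 0 < t -> ~ (A0 `|` Am) t ->
      tail_weighted 0 (- m%:R) t n / scale (0%:R + beta) n @[n --> \oo] --> Fm t.
    move=> t0 At; rewrite (_ : (fun n => _) = fun n => tail m (r ^+ n * t) / scale (m%:R + beta) n).
      by apply: limm => // Amt; apply: At; right.
    apply/funext => n; have [_ ->] := tail_weighted_down n t0; rewrite add0r scaleDn//.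
    by field; rewrite !expf_neq0 ?gt_eqF ?scale_gt0.
  have L0 t : 0 < t -> ~ (A0 `|` Am) t ->
      tail 0 (r ^+ n * t) / scale (0%:R + beta) n @[n --> \oo] --> F0 t.
    by move=> t0 At; apply: lim0 => // A0t; apply: At; left.
  have s0 : 0 <= (- 1) * - m%:R :> R by rewrite mulrNN mul1r.
  have bb : - m%:R < 0%:R + beta by rewrite add0r (le_lt_trans _ b0)// oppr_le0.
  have TA := tail_average r_gt1 ell_sv mY Y0 intYm (ltW b0) s0 bb IW
    F0ni F0rc Fmrc cU L0 L.
  move=> x x0; have [I E] := TA x x0.
  have -> : p x = x `^ (m%:R + beta) * Fm x.
    by rewrite /Fm mulrA powRDe// subrr powRr0 mul1r.
  have -> : opB (- m%:R - beta) (fun x => x `^ beta * F0 x) x =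
      x `^ (m%:R + beta) * \int[leb]_(t in `]x, +oo[) (t `^ (- m%:R - 1) * F0 t).
    rewrite /opB opprB opprK addrC ifF; last by apply/negbTE; rewrite -leNgt; lra.
    congr (_ * _); apply: eq_Rintegral => t; rewrite inE/= in_itv/= andbT => xt.
    rewrite mulrA powRDe ?(lt_trans x0)//; congr (_ `^ _ * _); ring.
  have {}I : leb.-integrable (`]x, +oo[%classic : set R)
      (EFin \o (fun t => m%:R * (t `^ (- m%:R - 1) * F0 t))).
    by apply: eq_integrable I => // t _; rewrite /= mulrNN mul1r mulrA.
  rewrite [m%:R * (_ * _)]mulrCA -Rintegral_natZ//.
  rewrite (_ : Rintegral _ _ _ = -1 * (Fm x - x `^ (- m%:R) * F0 x)).
    have -> : x `^ beta = x `^ (m%:R + beta) * x `^ (- m%:R) by rewrite powRDe//; congr powR; ring.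
    ring.
  by rewrite -E; apply: eq_Rintegral => t _; rewrite mulrNN mul1r mulrA.
(* Second relation, with the roles exchanged: weighting [tail m] by [Y^m] gives back [tail 0]. The
   condition [b < j + beta] becomes [m < m + beta], which is where [beta > 0] enters. *)
- have IW x n : 0 < x -> mu.-integrable setT
      (fun y => ((r ^+ n * x < Y y)%R%:R * (Y y / r ^+ n) `^ m%:R * Y y ^+ (m - m))%:E).
    by move=> x0; have [] := tail_weighted_up n x0.
  have cU : countable (A0 `|` Am).
    by rewrite -bigcup2E; apply: bigcup_countable => // i _; case: i => [|[|i]] //=.
  have L t : 0 < t -> ~ (A0 `|` Am) t ->
      tail_weighted m m%:R t n / scale (m%:R + beta) n @[n --> \oo] --> F0 t.
    move=> t0 At; rewrite (_ : (fun n => _) = fun n => tail 0 (r ^+ n * t) / scale (0%:R + beta) n).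
      by apply: lim0 => // A0t; apply: At; left.
    apply/funext => n; have [_ ->] := tail_weighted_up n t0; rewrite add0r scaleDn//.
    by field; rewrite !expf_neq0 ?gt_eqF ?scale_gt0.
  have Lm t : 0 < t -> ~ (A0 `|` Am) t ->
      tail m (r ^+ n * t) / scale (m%:R + beta) n @[n --> \oo] --> Fm t.
    by move=> t0 At; apply: limm => // A0t; apply: At; right.
  have s0 : 0 <= 1 * m%:R :> R by rewrite mul1r.
  have bb : m%:R < m%:R + beta by rewrite ltrDl.
  have TA := tail_average r_gt1 ell_sv mY Y0 intYm (ltW b0) s0 bb IW
    Fmni Fmrc F0rc cU Lm L.
  move=> x x0; have [I E] := TA x x0.
  have -> : p x = x `^ (m%:R + beta) * Fm x.
    by rewrite /Fm mulrA powRDe// subrr powRr0 mul1r.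
  have -> : opB (- beta) p x = x `^ beta * \int[leb]_(t in `]x, +oo[) (t `^ (m%:R - 1) * Fm t).
    rewrite /opB opprK ifF; last by apply/negbTE; rewrite -leNgt; lra.
    congr (_ * _); apply: eq_Rintegral => t; rewrite inE/= in_itv/= andbT => xt.
    rewrite /Fm mulrA powRDe ?(lt_trans x0)//; congr (_ `^ _ * _); ring.
  have {}I : leb.-integrable (`]x, +oo[%classic : set R)
      (EFin \o (fun t => m%:R * (t `^ (m%:R - 1) * Fm t))).
    by apply: eq_integrable I => // t _; rewrite /= mul1r mulrA.
  rewrite [m%:R * (_ * _)]mulrCA -Rintegral_natZ//.
  rewrite (_ : Rintegral _ _ _ = 1 * (F0 x - x `^ m%:R * Fm x)).
    by rewrite [m%:R + beta]addrC -powRDe//; ring.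
  by rewrite -E; apply: eq_Rintegral => t _; rewrite mul1r mulrA.
Qed.

Lemma constant_relation0 q p : rem_asymp 0 0 q -> tail_asymp 0 0 p ->
  exists2 c : R, 0 < c & eq_pos p (fun=> c) /\ eq_pos q (fun=> c).
Proof.
move=> hq hp; have b01 : 0 <= (0 : R) <= 1 by rewrite lexx ler01.
have [Fni _ _ _ _] := tail_asymp_limit r_gt1 ell_sv mY Y0 intYm hp.
have [[p0 _ _ _ pr] _] := hp.
have FE x : x `^ (- (0%:R + 0)) * p x = p x by rewrite addr0 oppr0 powRr0 mul1r.
have pc : eq_pos p (fun=> p 1).
  apply: (nonincreasing_periodic_const r_gt1) => // x y x0 xy.
  by have := Fni x y x0 xy; rewrite !FE.
exists (p 1); first exact: p0.
split => // s s0.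
have := rem_asymp_tail_limit r_gt1 ell_sv mY Y0 intYm b01 (leq0n m) ltr01 (fun _ => erefl) hq hp s0.
rewrite powRr0 mul1r => ->.
have := integral_kernel_ge s0 (lexx 0); rewrite mulr0 oppr0 expR0 => E.
rewrite /Rintegral -[RHS]/(fine (p 1)%:E); congr fine.
rewrite -[RHS]mule1 -E -ge0_integralZl//=.
- apply: eq_integral => t; rewrite inE/= in_itv/= andbT => t0.
  by rewrite FE pc// (ltW t0) mul1r -EFinM mulrC /kern !mul0r add0r expr0 mul1r.
- apply/measurable_EFinP; apply: (eq_measurable_fun (fun t => s * expR (- (s * t)))).
    by move=> t; rewrite inE/= in_itv/= andbT => t0; rewrite (ltW t0) mul1r.
  apply: measurable_funM => //; apply: measurable_funTS.
  exact: (@measurable_expN _ _ _ setT id).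
- by move=> t _; rewrite lee_fin mulr_ge0// mulr_ge0 ?expR_ge0// ltW.
- by rewrite lee_fin ltW// p0.
Qed.

(** The constant [c] of [low] is also that of [rem 0], since the kernel [s exp (- s t)] has mass 1,
    and [q = B_1 c] is the mean of a constant. *)
Lemma constant_relation1 q p : rem_asymp 1 0 q -> low_asymp p ->
  exists2 c : R, 0 < c & eq_pos p (fun=> c) /\ eq_pos q (fun=> c).
Proof.
move=> hq hp; have b01 : 0 <= (1 : R) <= 1 by rewrite lexx ler01.
have [c c0 [pc hc]] := low_asymp_lap r_gt1 ell_sv mY Y0 intYm (erefl 1) hp.
exists c => //; split => // s s0.
have [_ <-//] := lap_asymp_invB r_gt1 ell_sv mY Y0 intYm ltr01 hq hc.
rewrite /opB ltr01 powRN powRr1 ?(ltW s0)//.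
rewrite (_ : Rintegral _ _ _ = c * fine (leb `]0%R, s]%classic)).
  by rewrite lebesgue_measure_itv/= lte_fin s0 /= subr0; field; rewrite gt_eqF.
transitivity (\int[leb]_(t in `]0, s]) cst c t); last exact: Rintegral_cst.
by apply: eq_Rintegral => t _; rewrite subrr powRr0 mul1r.
Qed.

End Relations.

(** * Translation to the law of a random variable *)

Lemma asymp0_congr {R : realType} (f f' g : R -> R) :
  (forall s : R, 0 < s -> f s = f' s) -> asymp0 f g -> asymp0 f' g.
Proof.
move=> ff'; apply: cvg_trans; apply: near_eq_cvg; near=> s.
have s0 : 0 < s by near: s; exact: nbhs_right_gt.
by rewrite ff'.
Unshelve. all: by end_near. Qed.

Lemma eq_asymp0 {R : realType} (f f' g : R -> R) :
  (forall s : R, 0 < s -> f s = f' s) -> asymp0 f g <-> asymp0 f' g.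
Proof. by move=> ff'; split; apply: asymp0_congr => // s s0; rewrite ff'. Qed.

Section ScaledPowR.
Context {R : realType} (r : R) (ell : R -> R).
Hypotheses (r_gt1 : 1 < r) (ell_sv : slowly_varying ell).

(** The tail condition normalises at [r ^+ n * z] and [scale] at [r ^+ n]; slow variation reduces
    the quotient of the two to the power of [z]. *)
Lemma scale_powR_cvg (a z l : R) (u : nat -> R) : 0 < z ->
  ((r ^+ n * z) `^ a / ell (r ^+ n * z) * u n @[n --> \oo] --> l) <->
  (u n / scale r ell a n @[n --> \oo] --> z `^ (- a) * l).
Proof.
move=> z0; have r0 : 0 < r by rewrite (lt_trans _ r_gt1).
have rX n : 0 < r ^+ n by rewrite exprn_gt0.
have [ell0 _ ellv] := ell_sv.
have za : z `^ a != 0 by rewrite gt_eqF ?powR_gt0.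
have zl : ell (z * r ^+ n) / ell (r ^+ n) @[n --> \oo] --> (1 : R).
  exact: (cvg_comp _ _ (exprn_pinfty r_gt1) (ellv z z0)).
have E n : u n / scale r ell a n = z `^ (- a) * (ell (z * r ^+ n) / ell (r ^+ n)) *
    ((r ^+ n * z) `^ a / ell (r ^+ n * z) * u n).
  have e1 : ell (z * r ^+ n) != 0 by rewrite gt_eqF// ell0// mulr_gt0.
  have e2 : ell (r ^+ n) != 0 by rewrite gt_eqF// ell0.
  have e3 : (r ^+ n) `^ a != 0 by rewrite gt_eqF// powR_gt0.
  rewrite /scale !powRN [r ^+ n * z]mulrC powRM ?(ltW z0) ?(ltW (rX n))//.
  by field; rewrite e1 e2 e3 za.
have E' n : (r ^+ n * z) `^ a / ell (r ^+ n * z) * u n =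
    z `^ a * (ell (z * r ^+ n) / ell (r ^+ n))^-1 * (u n / scale r ell a n).
  rewrite E powRN; have e1 : ell (z * r ^+ n) != 0 by rewrite gt_eqF// ell0// mulr_gt0.
  have e2 : ell (r ^+ n) != 0 by rewrite gt_eqF// ell0.
  by rewrite [r ^+ n * z]mulrC; field; rewrite e1 e2 za.
split=> H.
- under eq_fun do rewrite E.
  apply: cvgM => //; rewrite -[X in _ --> X]mulr1.
  by apply: cvgM => //; exact: cvg_cst.
- under eq_fun do rewrite E'.
  have -> : l = z `^ a * 1^-1 * (z `^ (- a) * l) by rewrite powRN; field.
  apply: cvgM => //; apply: cvgM; first exact: cvg_cst.
  by apply: cvgV => //; exact: oner_neq0.
Qed.

Lemma scale0 n : scale r ell 0 n = ell (r ^+ n).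
Proof. by rewrite /scale oppr0 powRr0 mul1r. Qed.

End ScaledPowR.

Section Distribution.
Context {d : measure_display} {T : measurableType d} {R : realType}.
Context {P : probability T R} (X : {RV P >-> R}) (m : nat).
Hypotheses (X_ge0 : forall t, 0 <= X t) (X_moment : ('E_P[fun t => (X t ^+ m)%R] < +oo)%E).

Lemma Rintegral_distribution (b : R -> bool) (D : set R) (f : R -> R) :
  measurable D -> (forall x, D x <-> b x) -> measurable_fun D f -> (forall x, D x -> 0 <= f x) ->
  \int[distribution P X]_(x in D) f x = \int[P]_t ((b (X t))%:R * f (X t)).
Proof.
move=> mD Db mf f0; rewrite /Rintegral; congr fine.
rewrite /distribution ge0_integral_pushforward//; last 2 first.
- exact/measurable_EFinP.
- by move=> x; rewrite inE => /f0; rewrite lee_fin.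
rewrite integral_mkcond; apply: eq_integral => t _; rewrite patchE.
case: ifPn => [|]; first by rewrite inE => /Db /= ->; rewrite mul1r.
by move=> /negP; rewrite inE /= => nD; case: (boolP (b _)) => [/Db//|_]; rewrite mul0r.
Qed.

Lemma integrable_moment : P.-integrable setT (EFin \o (fun t => X t ^+ m)).
Proof.
apply/integrableP; split; first by apply/measurable_EFinP; exact: measurable_funX.
under eq_integral => t _ do rewrite gee0_abs ?lee_fin ?exprn_ge0//.
by move: X_moment; rewrite unlock.
Qed.

Let mX : measurable_fun setT X. Proof. by []. Qed.
Let intXm := integrable_moment.
Let int1 : P.-integrable setT (EFin \o cst 1).
Proof. exact: finite_measure_integrable_cst. Qed.
Local Notation rem := (rem P setT X m).

Lemma laplaceE s : 0 < s -> laplace X s = lap P setT X 0 s.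
Proof.
move=> s0; rewrite /laplace (@Rintegral_distribution (fun x => 0 <= x))//.
- by apply: eq_Rintegral => t _; rewrite X_ge0 expr0.
- by move=> x; rewrite /= in_itv/= andbT.
- by apply: measurable_funTS; exact: (@measurable_expN _ _ _ setT id).
Qed.

(** Integrating [psi k.+1 x = x^k / k! - psi k x] at [x = s X] subtracts one Taylor term and flips
    the sign. The induction stops at [m.+1], whose last step consumes the moment of order [m]. *)
Lemma f_E s : 0 < s -> f_ X m s = rem m.+1 s.
Proof.
move=> s0.
have Ik i : (i <= m)%N -> P.-integrable setT (EFin \o (fun t => (s * X t) ^+ i / i`!%:R)).
  move=> im; apply: eq_integrable (integrableZl measurableT (s ^+ i / i`!%:R)
    (integrable_pow mX X_ge0 intXm im)) => // t _.
  by rewrite /= -EFinM exprMn; congr EFin; ring.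
have H k : (k <= m.+1)%N -> P.-integrable setT (EFin \o (fun t => psi k (s * X t))) /\
    \int[P]_t psi k (s * X t) =
    (-1) ^+ k * (laplace X s - \sum_(i < k) moment X i * ((- s) ^+ i / i`!%:R)).
  elim: k => [_|k IH km].
    split; first exact: expN_integrable.
    rewrite big_ord0 subr0 expr0 mul1r laplaceE//.
    by apply: eq_Rintegral => t _; rewrite expr0 mul1r.
  have [I E] := IH (ltnW km).
  split; first exact: (integrableB measurableT (Ik k km) I).
  rewrite (_ : Rintegral _ _ _ = \int[P]_t ((s * X t) ^+ k / k`!%:R) - \int[P]_t psi k (s * X t)).
    rewrite E big_ord_recr/= (_ : Rintegral _ _ _ = s ^+ k / k`!%:R * moment X k).
      have -> : s ^+ k = (- 1) ^+ k * (- s) ^+ k by rewrite -exprMn mulrNN mul1r.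
      by rewrite exprS; ring.
    rewrite /moment unlock -[fine _]/(\int[P]_t (X t ^+ k)) -RintegralZl//; last exact: (integrable_pow mX X_ge0 intXm km).
    by apply: eq_Rintegral => t _; rewrite exprMn; ring.
  rewrite -RintegralB//; exact: Ik.
have [_ E] := H m.+1 (leqnn _).
rewrite /f_ -E; apply: eq_Rintegral => t _.
by rewrite subnn expr0 mul1r.
Qed.

Lemma g_E s : 0 < s -> g_ X m s = rem 1 s.
Proof.
move=> s0; rewrite /g_ -[RHS]/(rem 1%N s) -(subSnn m).
apply: (@derive1n_chain _ (fun n => rem (m.+1 - n)) m) => //.
- move=> n t nm t0; rewrite subSS subSn; last exact: ltnW.
  by apply: is_derive_rem => //; exact: leq_subr.
- by move=> t t0; rewrite subn0 f_E.
Qed.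

Lemma laplace_derivE s : 0 < s -> (-1) ^+ m.+1 * derive1n m.+1 (laplace X) s = rem 0 s.
Proof.
move=> s0; rewrite (@derive1n_lap _ _ _ P setT X)//; last exact: laplaceE.
  by rewrite mulrA -exprD addnn -mul2n exprM sqrrN expr1n expr1n mul1r rem0E.
by move=> t t0; exact: expN_integrable.
Qed.

Lemma tail0E x : 0 < x ->
  \int[distribution P X]_(y in `]x, +oo[) y ^+ m = tail P X m 0 x.
Proof.
move=> x0; rewrite (@Rintegral_distribution (fun y => x < y))//.
- by rewrite /tail subn0.
- by move=> y; rewrite /= in_itv/= andbT.
- by move=> y; rewrite /= in_itv/= andbT => /(lt_trans x0)/ltW/exprn_ge0.
Qed.

Lemma low_E x : \int[distribution P X]_(y in `[0, x]) y ^+ m.+1 = low P X m x.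
Proof.
rewrite (@Rintegral_distribution (fun y => 0 <= y <= x))//.
- by apply: eq_Rintegral => t _; rewrite X_ge0.
- by move=> y; rewrite /= in_itv/= => /andP[/exprn_ge0].
Qed.

Lemma tailmE x : 1 - distr_fun X x = tail P X m m x.
Proof.
have -> : tail P X m m x = \int[distribution P X]_(y in `]x, +oo[) 1.
  rewrite (@Rintegral_distribution (fun y => x < y))//.
  - by apply: eq_Rintegral => t _; rewrite subnn expr0.
  - by move=> y; rewrite /= in_itv/= andbT.
rewrite (_ : Rintegral _ _ _ = 1 * fine (ccdf X x)); last exact: Rintegral_cst.
rewrite mul1r ccdf_1_cdf fineB//; exact: fin_num_measure.
Qed.

End Distribution.

Section Translation.
Context {d : measure_display} {T : measurableType d} {R : realType}.
Context {P : probability T R} (X : {RV P >-> R}) (m : nat) (r beta : R) (ell : R -> R).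
Hypotheses (X_ge0 : forall t, 0 <= X t) (X_moment : ('E_P[fun t => (X t ^+ m)%R] < +oo)%E)
  (r_gt1 : 1 < r) (ell_sv : slowly_varying ell).
Implicit Types (p q : R -> R).

Lemma f_asympE q : f_asymp X m r (m%:R + beta) ell q <-> rem_asymp r ell P X m beta m q.
Proof. by rewrite /f_asymp /rem_asymp (eq_asymp0 _ (f_E X_ge0 X_moment)). Qed.

Lemma g_asympE q : g_asymp X m r beta ell q <-> rem_asymp r ell P X m beta 0 q.
Proof. by rewrite /g_asymp /rem_asymp (eq_asymp0 _ (g_E X_ge0 X_moment)) add0r. Qed.

Lemma laplace_deriv_asympE q :
  laplace_deriv_asymp X m r beta ell q <-> lap_asymp r ell P X m beta q.
Proof. by rewrite /laplace_deriv_asymp /lap_asymp (eq_asymp0 _ (laplace_derivE m X_ge0)). Qed.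

Let r_gt0 : 0 < r. Proof. by rewrite (lt_trans _ r_gt1). Qed.
Let rX_gt0 n : 0 < r ^+ n. Proof. by rewrite exprn_gt0. Qed.

Lemma tail_limit0E p : beta = 0 ->
  tail_limit X m r (m%:R + beta) beta ell p <-> tail_asymp r ell P X m 0 0 p.
Proof.
move=> b0; rewrite /tail_limit /tail_asymp.
have E z : 0 < z -> (fun n => (ell (r ^+ n))^-1 *
     \int[distribution P X]_(y in `](r ^+ n * z), +oo[) y ^+ m) =
   (fun n => tail P X m 0 (r ^+ n * z) / scale r ell (0%:R + 0) n).
  by move=> z0; apply/funext => n; rewrite tail0E ?mulr_gt0// addr0 scale0 mulrC.
split=> -[pr hp]; split=> // z zp; have [z0 _] := zp.
- have [H _ _] := hp z zp; move: (H b0).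
  by rewrite E// [in X in _ -> _ --> X]addr0 oppr0 powRr0 mul1r.
- split; [move=> _|by rewrite b0 ltxx|by rewrite b0 => /eqP; rewrite eq_sym oner_eq0].
  by have := hp z zp; rewrite E// [in X in _ --> X -> _]addr0 oppr0 powRr0 mul1r.
Qed.

Lemma tail_limitE p : 0 < beta < 1 ->
  tail_limit X m r (m%:R + beta) beta ell p <-> tail_asymp r ell P X m beta m p.
Proof.
move=> b01; rewrite /tail_limit /tail_asymp; have /andP[b0 b1] := b01.
have E z : (fun n => (r ^+ n * z) `^ (m%:R + beta) / ell (r ^+ n * z) *
     (1 - distr_fun X (r ^+ n * z))) =
   (fun n => (r ^+ n * z) `^ (m%:R + beta) / ell (r ^+ n * z) * tail P X m m (r ^+ n * z)).
  by apply/funext => n; rewrite (@tailmE _ _ _ P X m).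
split=> -[pr hp]; split=> // z zp; have [z0 _] := zp.
- have [_ H _] := hp z zp; move: (H b01); rewrite E.
  by move/(scale_powR_cvg r_gt1 ell_sv _ _ (fun n => tail P X m m (r ^+ n * z)) z0).
- split; [by move=> b00; move: b0; rewrite b00 ltxx|move=> _|by move=> b11; move: b1; rewrite b11 ltxx].
  rewrite E; apply/(scale_powR_cvg r_gt1 ell_sv _ _ (fun n => tail P X m m (r ^+ n * z)) z0).
  exact: hp.
Qed.

Lemma tail_limit1E p : beta = 1 ->
  tail_limit X m r (m%:R + beta) beta ell p <-> low_asymp r ell P X m p.
Proof.
move=> b1; rewrite /tail_limit /low_asymp.
have E z : (fun n => (ell (r ^+ n))^-1 *
     \int[distribution P X]_(y in `[0, (r ^+ n * z)]) y ^+ m.+1) =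
   (fun n => low P X m (r ^+ n * z) / scale r ell 0 n).
  by apply/funext => n; rewrite low_E// scale0 mulrC.
split=> -[pr hp]; split=> // z zp.
- by have [_ _ H] := hp z zp; move: (H b1); rewrite E.
- split; [by rewrite b1 => /eqP; rewrite oner_eq0|by rewrite b1 ltxx andbF|move=> _].
  by rewrite E; exact: hp.
Qed.

End Translation.

Unset Implicit Arguments.

Theorem theorem4 (d : measure_display) (T : measurableType d) (R : realType)
    (P : probability T R) (X : {RV P >-> R}) (m : nat) (r alpha beta : R)
    (ell : R -> R)
    (X_ge0 : forall t, 0 <= X t)
    (X_moment : ('E_P[fun t => (X t ^+ m)%R] < +oo)%E)
    (r_gt1 : 1 < r)
    (ell_sv : slowly_varying ell)
    (beta01 : 0 <= beta <= 1)
    (alphaE : alpha = m%:R + beta) :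
  [/\ (exists qt, f_asymp X m r alpha ell qt) <->
        (exists q, g_asymp X m r beta ell q),
      (exists q, g_asymp X m r beta ell q) <->
        (exists p, tail_limit X m r alpha beta ell p) &
      0 < beta ->
        ((exists q, g_asymp X m r beta ell q) <->
         (exists q1, laplace_deriv_asymp X m r beta ell q1)) /\
        (forall q q1, g_asymp X m r beta ell q ->
           laplace_deriv_asymp X m r beta ell q1 -> is_invB r beta q q1)]
  /\
  [/\ forall qt q, f_asymp X m r alpha ell qt -> g_asymp X m r beta ell q ->
        is_invB_iter r alpha m qt q,
      0 < beta < 1 ->
        forall q p, g_asymp X m r beta ell q ->
          tail_limit X m r alpha beta ell p ->
        exists a p0,
          [/\ is_invA r (1 - beta) q a,
              is_invB r (1 - beta) a p0,
              eq_pos p (fun x => p0 x - m%:R * opB (- m%:R - beta) p0 x) &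
              eq_pos p0 (fun x => p x + m%:R * opB (- beta) p x)] &
      beta = 0 \/ beta = 1 ->
        forall q p, g_asymp X m r beta ell q ->
          tail_limit X m r alpha beta ell p ->
        exists2 c : R, 0 < c & eq_pos p (fun=> c) /\ eq_pos q (fun=> c)].
Proof.
have mX : measurable_fun setT X by [].
have intXm := integrable_moment X_ge0 X_moment.
have fE q := f_asympE r beta ell X_ge0 X_moment q.
have gE q := g_asympE r beta ell X_ge0 X_moment q.
have lE q := laplace_deriv_asympE m r beta ell X_ge0 q.
have t0E p (b0 : beta = 0) : tail_limit X m r (m%:R + beta) beta ell p <-> tail_asymp r ell P X m 0 0 p.
  exact: tail_limit0E.
have tE p (bb : 0 < beta < 1) :
    tail_limit X m r (m%:R + beta) beta ell p <-> tail_asymp r ell P X m beta m p.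
  exact: tail_limitE.
have t1E p (b1 : beta = 1) : tail_limit X m r (m%:R + beta) beta ell p <-> low_asymp r ell P X m p.
  exact: tail_limit1E.
have ex_iff (U V : (R -> R) -> Prop) : (forall q, U q <-> V q) -> (exists q, U q) <-> (exists q, V q).
  by move=> UV; split=> -[q /UV]; exists q.
rewrite alphaE; split; split.
- rewrite (ex_iff _ _ fE) (ex_iff _ _ gE).
  exact: (rem_asymp_ex r_gt1 ell_sv mX X_ge0 intXm beta01 (leqnn m)).
- rewrite (ex_iff _ _ gE).
  (* The tail condition is read on [tail 0] for [beta = 0], on [tail m] for [0 < beta < 1], and on
     [low] for [beta = 1], where the passage goes through [rem 0]. *)
  have [b0|bN0] := eqVneq beta 0.
    rewrite (ex_iff _ _ (fun p => t0E p b0)).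
    move: beta01; rewrite b0 => b01; split=> -[q].
      exact: (rem_asymp_tail r_gt1 ell_sv mX X_ge0 intXm b01 (leq0n m) ltr01 (fun _ => erefl)).
    exact: (tail_asymp_rem r_gt1 ell_sv mX X_ge0 intXm b01 (leq0n m) ltr01 (fun _ => erefl)).
  have b0 : 0 < beta by rewrite lt_neqAle eq_sym bN0; case/andP: beta01.
  have [b1|bN1] := eqVneq beta 1.
    rewrite (ex_iff _ _ (fun p => t1E p b1)); split=> -[q].
      move=> /(lap_asymp_down r_gt1 ell_sv mX X_ge0 intXm b0)[q1 hq1 _].
      exact: (lap_asymp_low r_gt1 ell_sv mX X_ge0 intXm b1 hq1).
    move=> /(low_asymp_lap r_gt1 ell_sv mX X_ge0 intXm b1)[c c0 [_ hc]].
    exact: (lap_asymp_up r_gt1 ell_sv mX X_ge0 intXm b0 hc).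
  have b1 : beta < 1 by rewrite lt_neqAle bN1; case/andP: beta01.
  have bj : beta = 0 -> m = 0%N by move=> b00; move: b0; rewrite b00 ltxx.
  have bb : 0 < beta < 1 by rewrite b0.
  rewrite (ex_iff _ _ (fun p => tE p bb)); split=> -[q].
    exact: (rem_asymp_tail r_gt1 ell_sv mX X_ge0 intXm beta01 (leqnn m) b1 bj).
  exact: (tail_asymp_rem r_gt1 ell_sv mX X_ge0 intXm beta01 (leqnn m) b1 bj).
- move=> b0; split.
    rewrite (ex_iff _ _ gE) (ex_iff _ _ lE); split=> -[q].
      by move=> /(lap_asymp_down r_gt1 ell_sv mX X_ge0 intXm b0)[q1 hq1 _]; exists q1.
    exact: (lap_asymp_up r_gt1 ell_sv mX X_ge0 intXm b0).
  move=> q q1 /gE hq /lE hq1.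
  exact: (lap_asymp_invB r_gt1 ell_sv mX X_ge0 intXm b0 hq hq1).
- move=> qt q /fE hqt /gE hq.
  exact: (rem_asymp_iter r_gt1 ell_sv mX X_ge0 intXm beta01 (leqnn m) hqt hq).
- move=> bb q p /gE hq /(tE p bb) hp.
  exact: (inverse_relations r_gt1 ell_sv mX X_ge0 intXm bb hq hp).
- case=> [b0|b1] q p /gE hq.
    move=> /(t0E p b0) hp; rewrite b0 in hq.
    exact: (constant_relation0 r_gt1 ell_sv mX X_ge0 intXm hq hp).
  move=> /(t1E p b1) hp; rewrite b1 in hq.
  exact: (constant_relation1 r_gt1 ell_sv mX X_ge0 intXm hq hp).
Qed.
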